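(* Let $\sigma_{\mathrm p}^2>0$, $N_0>0$, $E_{\mathrm s}>0$, and let $\mathcal X\subset\mathbb C$ be a finite set of constellation points such that a uniformly distributed $s\in\mathcal X$ satisfies $\mathbb E[|s|^2]=E_{\mathrm s}$. For each $N=2^\ell$ ($\ell\ge 0$ an integer), let $s^{(N)}=[s_1,\dots,s_N]^T$ have i.i.d. entries uniform on $\mathcal X$, let $\theta_1,\dots,\theta_N$ be i.i.d. real Gaussian random variables with mean $0$ and variance $\sigma_{\mathrm p}^2$, and let $n^{(N)}=[n_1,\dots,n_N]^T$ have i.i.d. circularly symmetric complex Gaussian entries with variance $N_0$, where $s^{(N)}$, $(\theta_1,\dots,\theta_N)$ and $n^{(N)}$ are independent. Let the received signal for Hadamard-rotated transmission be $$r^{(N)}=\Theta\, f_{\mathsf H_{2N}}(s^{(N)})+n^{(N)},\qquad \Theta=\operatorname{diag}(e^{j\theta_1},\dots,e^{j\theta_N}),$$ and let the derotated signal be $\tilde r^{(N)}=f_{\mathsf H_{2N}^T}(r^{(N)})$, with entries $\tilde r^{(N)}_1,\dots,\tilde r^{(N)}_N$. Set $\alpha=e^{-\sigma_{\mathrm p}^2/2}$ and, for $1\le i\le N$, write $$\tilde r^{(N)}_i=\alpha s_i+\tilde n^{(N)}_i .$$ Then, for every fixed index $i\geq 1$, as $N\to\infty$ through powers of two, $\tilde n^{(N)}_i$ converges in distribution to a complex Gaussian random variable $\tilde n_i$ with variance $N_0+E_{\mathrm s}\bigl(1-e^{-\sigma_{\mathrm p}^2}\bigr)$. Moreover, if $\mathcal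 X$ is a standard QAM format, then $\tilde n_i$ is circularly symmetric.
   Context: $j$ denotes the imaginary unit. Real-component maps: $g:\mathbb C^N\to\mathbb R^{2N}$ is $g([z_1,\dots,z_N]^T)=[\Re z_1,\Im z_1,\dots,\Re z_N,\Im z_N]^T$, with inverse $g^{-1}([x_1,\dots,x_{2N}]^T)=[x_1+jx_2,\dots,x_{2N-1}+jx_{2N}]^T$. For a real $2N\times 2N$ matrix $\mathsf R$, $f_{\mathsf R}:\mathbb C^N\to\mathbb C^N$ is defined by $f_{\mathsf R}(s)=g^{-1}(\mathsf R\,g(s))$. Hadamard rotation matrices: $\mathsf H_1=1$, $\mathsf H_2=\frac{1}{\sqrt2}\begin{bmatrix}1&1\\-1&1\end{bmatrix}$, and $\mathsf H_{2^\ell}=\mathsf H_2\otimes\mathsf H_{2^{\ell-1}}$, where $\otimes$ is the Kronecker product. Each $\mathsf H_{2^\ell}$ is a real orthogonal matrix. A complex Gaussian random variable is one whose real and imaginary parts are jointly Gaussian; the variance of a complex random variable $z$ is $\mathbb E[|z-\mathbb E z|^2]$. It is circularly symmetric if $e^{j\phi}z$ has the same distribution as $z$ for every $\phi\in\mathbb R$ (for complex Gaussian $z$ this is equivalent to $\mathbb E[z]=0$ and $\mathbb E[z^2]=0$). A standard QAM format is a square QAM constellation $\mathcal X=\{a(2p-1-m)+ja(2q-1-m): p,q\in\{1,\dots,m\}\}$ with $a>0$ and $m=2^k$, $k\ge1$ (e.g. QPSK, 16QAM, 64QAM, 256QAM).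
   Formalization: The constellation is additionally assumed to have zero mean, E[s]=0; without it the claim fails: for X={1} the effective noise is e^{jθ_1}−α plus independent Gaussian noise for every N, which is not Gaussian. *)

(* Defs.v *)
From HB Require Import structures.
From mathcomp Require Import all_boot all_order all_algebra.
From mathcomp Require Import finmap.
From mathcomp Require Import all_classical all_reals all_analysis.
From mathcomp Require Import complex mxtens.

Set Implicit Arguments.
Unset Strict Implicit.
Unset Printing Implicit Defensive.

Import Order.TTheory GRing.Theory Num.Theory numFieldNormedType.Exports.

Local Open Scope classical_set_scope.
Local Open Scope complex_scope.
Local Open Scope ring_scope.

(* Usual topology and Borel sigma-algebra of the complex plane. *)
HB.instance Definition _ (R : realType) := NormedModule.copy R[i] R[i]^o.
HB.instance Definition _ (R : realType) :=
  Measurable.copy R[i] (g_sigma_algebraType (@open R[i])).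

Section probability_notions.
Context {R : realType}.

(* normal_prob takes the standard deviation as parameter, and its value at    *)
(* standard deviation 0 is a dummy (uniform on [0, 1]); degenerate Gaussians  *)
(* are Dirac measures here.                                                   *)
Definition gaussian_law (m sd : R) (A : set R) : \bar R :=
  if sd == 0 then \d_m A else normal_prob m sd A.

Definition is_gaussian d (T : measurableType d) (P : probability T R)
    (m sd : R) (X : T -> R) : Prop :=
  forall A : set R, measurable A -> P (X @^-1` A) = gaussian_law m sd A.

(* Joint Gaussianity of (Re Z, Im Z): all real linear combinations are        *)
(* Gaussian, possibly degenerate.                                             *)
Definition complex_gaussian d (T : measurableType d) (P : probability T R)
    (Z : T -> R[i]) : Prop :=
  forall a b : R, exists m sd : R, 0 <= sd /\
    is_gaussian P m sd (fun t => a * complex.Re (Z t) + b * complex.Im (Z t)).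

Definition cexpectation d (T : measurableType d) (P : probability T R)
    (Z : T -> R[i]) : R[i] :=
  fine 'E_P[fun t => complex.Re (Z t)]%E
  +i* fine 'E_P[fun t => complex.Im (Z t)]%E.

(* Normc.normc is the modulus with values in R; the norm `|z| of R[i] takes   *)
(* its values in R[i].                                                        *)
Definition cvariance d (T : measurableType d) (P : probability T R)
    (Z : T -> R[i]) : \bar R :=
  'E_P[fun t => (Normc.normc (Z t - cexpectation P Z) ^+ 2)%R]%E.

Definition expi (x : R) : R[i] := cos x +i* sin x.

Definition circularly_symmetric d (T : measurableType d) (P : probability T R)
    (Z : T -> R[i]) : Prop :=
  forall (phi : R) (A : set R[i]), measurable A ->
    P ((fun t => expi phi * Z t) @^-1` A) = P (Z @^-1` A).

Definition uniform_on d (T : measurableType d) (P : probability T R)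
    (X : {fset R[i]}) (Z : T -> R[i]) : Prop :=
  X != fset0 /\
  forall x, x \in X -> P [set t | Z t = x] = ((#|` X|%:R)^-1)%:E.

Definition independent_classes d (T : measurableType d) (P : probability T R)
    (I : finType) (F : I -> set (set T)) : Prop :=
  forall (J : {set I}) (A : I -> set T), (forall i, i \in J -> F i (A i)) ->
    P (\bigcap_(i in [set` J]) A i) = (\prod_(i in J) P (A i))%E.

Definition independent_rvs d (T : measurableType d) (P : probability T R)
    d' (T' : measurableType d') (I : finType) (X : I -> T -> T') : Prop :=
  independent_classes P (fun i => g_sigma_algebra_preimage (X i)).

(* Independence of three random vectors; g_sigma_preimage X is the            *)
(* sigma-algebra generated by all the entries of X.                           *)
Definition independent_vectors3 d (T : measurableType d) (P : probability T R)
    d1 (T1 : measurableType d1) d2 (T2 : measurableType d2)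
    d3 (T3 : measurableType d3) (N : nat)
    (X : 'I_N -> T -> T1) (Y : 'I_N -> T -> T2) (Z : 'I_N -> T -> T3) : Prop :=
  independent_classes P
    (tnth [tuple g_sigma_preimage X; g_sigma_preimage Y; g_sigma_preimage Z]).

(* Weak convergence of laws, tested on bounded continuous functions; the      *)
(* sample space may vary along the sequence.                                  *)
Definition cvg_in_distribution (d : nat -> measure_display)
    (T : forall l, measurableType (d l)) (P : forall l, probability (T l) R)
    (Z : forall l, T l -> R[i])
    d' (T' : measurableType d') (Q : probability T' R) (W : T' -> R[i]) : Prop :=
  (forall l, measurable_fun setT (Z l)) /\
  forall f : R[i] -> R, continuous f -> (exists M : R, forall z, `|f z| <= M) ->
    ('E_(P l)[fun t => f (Z l t)] @[l --> \oo] --> 'E_Q[fun t => f (W t)])%E.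

End probability_notions.

Section hadamard_rotation.
Context {R : realType}.

(* mxtens_index (k, b) = 2 k + b, so real parts sit at the even (0-based)     *)
(* positions and imaginary parts at the odd ones.                             *)
Definition to_real (N : nat) (z : 'cV[R[i]]_N) : 'cV[R]_(N * 2) :=
  \col_j (if (mxtens_unindex j).2 == ord0
          then complex.Re (z (mxtens_unindex j).1 0)
          else complex.Im (z (mxtens_unindex j).1 0)).

Definition of_real (N : nat) (x : 'cV[R]_(N * 2)) : 'cV[R[i]]_N :=
  \col_k (x (mxtens_index (k, ord0)) 0 +i* x (mxtens_index (k, ord_max)) 0).

Definition real_map (N : nat) (M : 'M[R]_(N * 2)) (z : 'cV[R[i]]_N) :
    'cV[R[i]]_N :=
  of_real (M *m to_real z).

Definition hadamard2 : 'M[R]_2 :=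
  (Num.sqrt 2)^-1 *: \matrix_(i, j) (if (j < i)%N then -1 else 1).

Fixpoint hadamard (l : nat) : 'M[R]_(2 ^ l) :=
  match l with
  | 0 => 1%:M
  | l'.+1 => castmx (esym (expnS 2 l'), esym (expnS 2 l'))
                    (hadamard2 *t hadamard l')
  end.

(* The rotation of order 2 N for N = 2 ^ l. *)
Definition hadamard_rot (l : nat) : 'M[R]_(2 ^ l * 2) :=
  castmx (expnSr 2 l, expnSr 2 l) (hadamard l.+1).

Definition received (l : nat) (s : 'cV[R[i]]_(2 ^ l)) (theta : 'cV[R]_(2 ^ l))
    (n : 'cV[R[i]]_(2 ^ l)) : 'cV[R[i]]_(2 ^ l) :=
  diag_mx (\row_k expi (theta k 0)) *m real_map (hadamard_rot l) s + n.

Definition derotated (l : nat) (s : 'cV[R[i]]_(2 ^ l)) (theta : 'cV[R]_(2 ^ l))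
    (n : 'cV[R[i]]_(2 ^ l)) : 'cV[R[i]]_(2 ^ l) :=
  real_map (hadamard_rot l)^T (received s theta n).

Definition effective_noise (sigmap : R) (l : nat) (s : 'cV[R[i]]_(2 ^ l))
    (theta : 'cV[R]_(2 ^ l)) (n : 'cV[R[i]]_(2 ^ l)) : 'cV[R[i]]_(2 ^ l) :=
  derotated s theta n - (expR (- (sigmap ^+ 2 / 2)))%:C *: s.

(* Entry number i (0-based); the default 0 is only met when N <= i, i.e. for  *)
(* finitely many N.                                                           *)
Definition entry (N : nat) (z : 'cV[R[i]]_N) (i : nat) : R[i] :=
  if insub i is Some k then z k 0 else 0.

Definition square_qam (X : {fset R[i]}) : Prop :=
  exists (a : R) (k : nat), [/\ 0 < a, (1 <= k)%N &
    forall z, z \in X <-> exists p q : nat,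
      [/\ (1 <= p <= 2 ^ k)%N, (1 <= q <= 2 ^ k)%N &
          z = a * (2 * p%:R - 1 - (2 ^ k)%:R)
              +i* (a * (2 * q%:R - 1 - (2 ^ k)%:R))]].

End hadamard_rotation.

(* Main.v *)
(* In complex notation the rotation f_H is a unimodular constant times the real
   Hadamard matrix H of order N, so the effective noise in entry i is
   sum_j H_ji (e^(i theta_j) - alpha) (H s)_j plus a rotated copy of the channel
   noise.  Conditionally on s the summands are independent, so the characteristic
   function is the expectation over s of prod_j chi(H_ji A_j, H_ji B_j) times the
   Gaussian factor of the channel noise, where A_j, B_j are the entries of the
   Hadamard transforms of two linear forms of s and chi is the characteristic
   function of the centred phase term.  As |H_ji| = N^(-1/2) and the A_j, B_j have
   bounded third moments, chi can be replaced by its Gaussian approximation at cost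
   O(N^(-1/2)).  Parseval's identity then turns the product over j into a product
   over the i.i.d. symbols s_m, whose expectation is (E exp (- G(s_1) / N))^N,
   converging to exp (- E G(s_1)).  Levy's continuity theorem in the plane concludes;
   for a square QAM format the limit quadratic form is a multiple of u^2 + v^2
   because multiplication by i preserves the constellation. *)
Require Import Defs.
From HB Require Import structures.
From mathcomp Require Import all_boot all_order all_algebra.
From mathcomp Require Import finmap.
From mathcomp Require Import all_classical all_reals all_analysis.
From mathcomp Require Import complex mxtens.
From mathcomp Require Import measurable_realfun.
From mathcomp Require Import ring lra.

Import Order.TTheory GRing.Theory Num.Theory numFieldNormedType.Exports.

Local Open Scope classical_set_scope.
Local Open Scope complex_scope.
Local Open Scope ring_scope.

Set Implicit Arguments.
Unset Strict Implicit.
Unset Printing Implicit Defensive.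

(** * Integrals of bounded measurable functions *)

(** The zero mean of the symbols is what makes the arguments of chi small. The first row of H is
    constant and positive, so a non-zero mean would create an entry of order N^(1/2) in H s;
    multiplied by H_ji it gives an argument of order one, where chi is not close to its Gaussian
    approximation. With zero mean, each entry of H s is a weighted sum of centred bounded variables
    with squared weights adding up to 1, and a sub-Gaussian estimate bounds its third moment
    uniformly in N. The entries of H s are in general dependent, so the average over s of the
    product over j cannot be factored directly. Only after every factor has become Gaussian does the
    total exponent become a quadratic form that an orthogonal matrix preserves, and it then splits
    over the independent symbols. Conditioning on s is carried out as a finite sum over all symbol
    vectors, so that independence enters only through expectations of products of bounded functions.
    All errors are explicit multiples of N^(-1/2), with constants that do not depend on the row or
    on N. *)

Section bounded_measurable.
Context {R : realType} {d : measure_display} {T : measurableType d}.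

(** A class closed under ring operations and integrable for every probability. Characteristic
    functions only integrate functions of this kind, so integrability conditions reduce to closure
    properties. *)
Definition bmeas (f : T -> R) : Prop :=
  measurable_fun setT f /\ exists M, forall x, `|f x| <= M.

Lemma bmeas_cst c : bmeas (fun=> c).
Proof. by split; [exact: measurable_cst|exists `|c|]. Qed.

Lemma bmeasD f g : bmeas f -> bmeas g -> bmeas (fun x => f x + g x).
Proof.
move=> [mf [M fM]] [mg [N gN]]; split; first exact: measurable_funD.
by exists (M + N) => x; rewrite (le_trans (ler_normD _ _))// lerD.
Qed.

Lemma bmeasN f : bmeas f -> bmeas (fun x => - f x).
Proof.
move=> [mf [M fM]]; split; first exact: measurableT_comp.
by exists M => x; rewrite normrN.
Qed.

Lemma bmeasB f g : bmeas f -> bmeas g -> bmeas (fun x => f x - g x).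
Proof. by move=> bf bg; apply: bmeasD => //; exact: bmeasN. Qed.

Lemma bmeasM f g : bmeas f -> bmeas g -> bmeas (fun x => f x * g x).
Proof.
move=> [mf [M fM]] [mg [N gN]]; split; first exact: measurable_funM.
by exists (M * N) => x; rewrite normrM ler_pM.
Qed.

Lemma bmeas_sum (I : Type) (r : seq I) (F : I -> T -> R) :
  (forall i, bmeas (F i)) -> bmeas (fun x => \sum_(i <- r) F i x).
Proof.
move=> bF; elim: r => [|i r IH].
  by under eq_fun do rewrite big_nil; exact: bmeas_cst.
by under eq_fun do rewrite big_cons; exact: bmeasD.
Qed.

Lemma bmeas_norm f : bmeas f -> bmeas (fun x => `|f x|).
Proof.
move=> [mf [M fM]]; split; first exact: measurableT_comp.
by exists M => x; rewrite normr_id.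
Qed.

Variable P : probability T R.

Lemma bmeas_integrable f : bmeas f -> P.-integrable setT (EFin \o f).
Proof.
move=> [mf [M fM]]; apply: measurable_bounded_integrable => //.
  by rewrite -ge0_fin_numE// fin_num_measure.
exists M; split; first by rewrite num_real.
by move=> x Mx y _; exact: le_trans (fM y) (ltW Mx).
Qed.

Lemma RintD f g : bmeas f -> bmeas g ->
  \int[P]_x (f x + g x) = \int[P]_x f x + \int[P]_x g x.
Proof. by move=> bf bg; rewrite RintegralD//; exact: bmeas_integrable. Qed.

Lemma RintB f g : bmeas f -> bmeas g ->
  \int[P]_x (f x - g x) = \int[P]_x f x - \int[P]_x g x.
Proof. by move=> bf bg; rewrite RintegralB//; exact: bmeas_integrable. Qed.

Lemma RintZl c f : bmeas f -> \int[P]_x (c * f x) = c * \int[P]_x f x.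
Proof. by move=> bf; rewrite RintegralZl//; exact: bmeas_integrable. Qed.

Lemma RintZr c f : bmeas f -> \int[P]_x (f x * c) = \int[P]_x f x * c.
Proof. by move=> bf; rewrite RintegralZr//; exact: bmeas_integrable. Qed.

Lemma Rint_cst c : \int[P]_x c = c.
Proof. by rewrite Rintegral_cst//= probability_setT mulr1. Qed.

Lemma Rint_sum (I : Type) (r : seq I) (F : I -> T -> R) :
  (forall i, bmeas (F i)) ->
  \int[P]_x (\sum_(i <- r) F i x) = \sum_(i <- r) \int[P]_x F i x.
Proof.
move=> bF; elim: r => [|i r IH].
  by under eq_Rintegral do rewrite big_nil; rewrite big_nil Rint_cst.
under eq_Rintegral do rewrite big_cons.
by rewrite RintD//; [rewrite IH big_cons|exact: bmeas_sum].
Qed.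

Lemma le_Rint f g : bmeas f -> bmeas g -> (forall x, f x <= g x) ->
  \int[P]_x f x <= \int[P]_x g x.
Proof. by move=> bf bg fg; apply: le_Rintegral => //; exact: bmeas_integrable. Qed.

Lemma Rint_norm_le f M : bmeas f -> (forall x, `|f x| <= M) ->
  `|\int[P]_x f x| <= M.
Proof.
move=> bf fM; rewrite ler_norml -{1}(Rint_cst M) -{2}(Rint_cst M).
have bM := bmeas_cst M.
rewrite -mulN1r -RintZl// !le_Rint//.
- by move=> x; have := fM x; rewrite ler_norml => /andP[].
- by apply: bmeasM => //; exact: bmeas_cst.
- by move=> x; have := fM x; rewrite ler_norml mulN1r => /andP[].
Qed.

Lemma EFin_Rint f : bmeas f -> (\int[P]_x (f x)%:E)%E = (\int[P]_x f x)%:E.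
Proof.
by move=> bf; rewrite fineK//; apply: integrable_fin_num => //; exact: bmeas_integrable.
Qed.

Lemma Rint_bounded_cvg (F : nat -> T -> R) (f : T -> R) (M : R) :
  (forall n, measurable_fun setT (F n)) -> measurable_fun setT f ->
  (forall n x, `|F n x| <= M) ->
  (forall x, F n x @[n --> \oo] --> f x) ->
  \int[P]_x F n x @[n --> \oo] --> \int[P]_x f x.
Proof.
move=> mF mf FM Ff.
have mF' n : measurable_fun setT (EFin \o F n) by exact/measurable_EFinP.
have mf' : measurable_fun setT (EFin \o f) by exact/measurable_EFinP.
have Ff' : {ae P, forall x, setT x -> (F n x)%:E @[n --> \oo] --> (f x)%:E}.
  by apply: aeW => x _; apply/cvg_EFin; [exact: nearW|exact: Ff].
have FM' : {ae P, forall x n, setT x -> (`|(EFin \o F n) x| <= (EFin \o cst M) x)%E}.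
  by apply: aeW => x n _; rewrite lee_fin.
have [/= _ _ h] := dominated_convergence measurableT mF' mf' Ff'
  (bmeas_integrable (bmeas_cst M)) FM'.
have fM x : `|f x| <= M.
  rewrite -(cvg_lim (@Rhausdorff R) (cvg_norm (Ff x))).
  apply: limr_le; first exact: cvgP (cvg_norm (Ff x)).
  exact: nearW.
have bf : bmeas f by split => //; exists M.
have bF n : bmeas (F n) by split => //; exists M.
by apply/fine_cvg; move: h; rewrite EFin_Rint.
Qed.

End bounded_measurable.

Lemma bmeas_comp {R : realType} d1 d2 (T1 : measurableType d1) (T2 : measurableType d2)
    (h : T1 -> T2) (f : T2 -> R) :
  bmeas f -> measurable_fun setT h -> bmeas (fun x => f (h x)).
Proof.
move=> [mf [M fM]] mh; split; first exact: measurableT_comp.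
by exists M => x.
Qed.

(** * Product probabilities and Fubini for bounded functions *)

Section product_probability.
Context {R : realType} d1 d2 {T1 : measurableType d1} {T2 : measurableType d2}.
Variables (P : probability T1 R) (Q : probability T2 R).

(** A name for the product measure, to which the probability structure can be attached. *)
Definition product_prob : set (T1 * T2) -> \bar R := (P \x Q)%E.

HB.instance Definition _ := Measure.on product_prob.

Let product_probT : product_prob setT = 1%E.
Proof.
rewrite /product_prob -setXTT product_measure1E//=.
by rewrite !probability_setT mule1.
Qed.

HB.instance Definition _ :=
  @Measure_isProbability.Build _ _ _ product_prob product_probT.

Variable F : T1 * T2 -> R.
Hypothesis bF : bmeas F.

Let intF : (P \x Q)%E.-integrable setT (EFin \o F) :=
  @bmeas_integrable _ _ _ product_prob _ bF.

Lemma bmeas_pair1 x : bmeas (fun y => F (x, y)).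
Proof.
case: bF => mF [M FM]; split; last by exists M => y.
exact: (measurableT_comp mF (pair1_measurable x)).
Qed.

Lemma bmeas_pair2 y : bmeas (fun x => F (x, y)).
Proof.
case: bF => mF [M FM]; split; last by exists M => x.
exact: (measurableT_comp mF (pair2_measurable y)).
Qed.

Lemma bmeas_Rint1 : bmeas (fun x => \int[Q]_y F (x, y)).
Proof.
split.
  apply/measurable_EFinP; rewrite (_ : _ \o _ = fubini_F Q (EFin \o F)).
    exact: (measurable_fubini_F intF).
  by apply/funext => x /=; rewrite -EFin_Rint//; exact: bmeas_pair1.
case: bF => mF [M FM]; exists M => x.
by apply: Rint_norm_le => //; exact: bmeas_pair1.
Qed.

Lemma bmeas_Rint2 : bmeas (fun y => \int[P]_x F (x, y)).
Proof.
split.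
  apply/measurable_EFinP; rewrite (_ : _ \o _ = fubini_G P (EFin \o F)).
    exact: (measurable_fubini_G intF).
  by apply/funext => x /=; rewrite -EFin_Rint//; exact: bmeas_pair2.
case: bF => mF [M FM]; exists M => x.
by apply: Rint_norm_le => //; exact: bmeas_pair2.
Qed.

Lemma Rint_product_prob : \int[product_prob]_z F z = \int[P]_x \int[Q]_y F (x, y).
Proof.
rewrite /Rintegral; congr fine.
transitivity (\int[P]_x fubini_F Q (EFin \o F) x)%E.
  by rewrite (integral12_prod_meas1 intF).
apply: eq_integral => x _; rewrite /fubini_F/= fineK//.
by apply: integrable_fin_num => //; exact/bmeas_integrable/bmeas_pair1.
Qed.

Lemma Rint_fubini : \int[P]_x \int[Q]_y F (x, y) = \int[Q]_y \int[P]_x F (x, y).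
Proof.
rewrite -Rint_product_prob /Rintegral; congr fine.
transitivity (\int[Q]_x fubini_G P (EFin \o F) x)%E.
  by rewrite (integral21_prod_meas1 intF).
apply: eq_integral => x _; rewrite /fubini_G/= fineK//.
by apply: integrable_fin_num => //; exact/bmeas_integrable/bmeas_pair2.
Qed.

End product_probability.

Lemma Rint_product_probM {R : realType} d1 d2 {T1 : measurableType d1}
    {T2 : measurableType d2} (P : probability T1 R) (Q : probability T2 R)
    (f : T1 -> R) (g : T2 -> R) : bmeas f -> bmeas g ->
  \int[product_prob P Q]_z (f z.1 * g z.2) = \int[P]_x f x * \int[Q]_y g y.
Proof.
move=> bf bg; rewrite (@Rint_product_prob _ _ _ _ _ _ _ (fun z => f z.1 * g z.2)).
  rewrite -RintZr//; apply: eq_Rintegral => x _ /=.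
  by rewrite RintZl.
apply: bmeasM.
  by apply: (bmeas_comp bf); exact: measurable_fst.
by apply: (bmeas_comp bg); exact: measurable_snd.
Qed.

(** * Transfer of integrals between variables with the same law *)

Section equal_laws.
Context {R : realType} d1 d2 d3 {T1 : measurableType d1} {T2 : measurableType d2}
  {T3 : measurableType d3}.
Variables (P : {measure set T1 -> \bar R}) (Q : {measure set T2 -> \bar R}).
Variables (X : T1 -> T3) (Y : T2 -> T3).
Hypotheses (mX : measurable_fun setT X) (mY : measurable_fun setT Y).
Hypothesis XY : forall A, measurable A -> P (X @^-1` A) = Q (Y @^-1` A).

Let eq_int (f : T3 -> \bar R) :
  (\int[pushforward P X]_x f x = \int[pushforward Q Y]_x f x)%E.
Proof. by apply: eq_measure_integral => A mA _; exact: XY. Qed.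

(** Both integrals are integrals of [f] against the common pushforward measure; integrability passes
    from one side to the other through the integral of the absolute value. *)
Lemma eq_law_integral (f : T3 -> R) : measurable_fun setT f ->
  P.-integrable setT (EFin \o (f \o X)) ->
  Q.-integrable setT (EFin \o (f \o Y)) /\
  (\int[P]_x (f (X x))%:E = \int[Q]_x (f (Y x))%:E)%E.
Proof.
move=> mf iX.
have mf' : measurable_fun setT (EFin \o f) by exact/measurable_EFinP.
have iY : Q.-integrable setT (EFin \o (f \o Y)).
  apply/integrableP; split; first by apply/measurable_EFinP; exact: measurableT_comp.
  have mf1 : measurable_fun setT (fun x => `|(f x)%:E|%E) by exact: measurableT_comp.
  have -> : (\int[Q]_x `|(EFin \o (f \o Y)) x| =
      \int[pushforward Q Y]_x `|(f x)%:E|)%E.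
    by rewrite ge0_integral_pushforward.
  by rewrite -eq_int ge0_integral_pushforward//; case/integrableP: iX.
split => //.
have := integral_pushforward mX mf' (mu := P) (D := setT).
rewrite preimage_setT => /(_ iX measurableT) /= <-.
have := integral_pushforward mY mf' (mu := Q) (D := setT).
rewrite preimage_setT => /(_ iY measurableT) /= <-.
exact: eq_int.
Qed.

Lemma eq_law_Rint (f : T3 -> R) : measurable_fun setT f ->
  P.-integrable setT (EFin \o (f \o X)) ->
  \int[P]_x f (X x) = \int[Q]_x f (Y x).
Proof. by move=> mf iX; rewrite /Rintegral (eq_law_integral mf iX).2. Qed.

End equal_laws.

(** * Moments and characteristic function of the normal law *)

Section normal_density_change.
Context {R : realType} (m s : R).
Notation mu := (@lebesgue_measure R).

(** Two densities of the same measure agree almost everywhere. This turns the change of variables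
    for the abstract Radon-Nikodym derivative into one for the explicit normal density. *)
Let RN_pdf : ae_eq mu setT
  (Radon_Nikodym_SigmaFinite.f (normal_prob m s) mu) (fun x => (normal_pdf m s x)%:E).
Proof.
have dom := @normal_prob_dominates R m s.
apply: integral_ae_eq => //.
- exact: Radon_Nikodym_SigmaFinite.f_integrable.
- by apply/measurable_EFinP; exact: measurable_normal_pdf.
- move=> E _ mE.
  by rewrite -(Radon_Nikodym_SigmaFinite.f_integral dom).
Qed.

Lemma ge0_integral_normal_prob (f : R -> \bar R) : (forall x, 0 <= f x)%E ->
  measurable_fun setT f ->
  (\int[normal_prob m s]_x f x = \int[mu]_x (f x * (normal_pdf m s x)%:E))%E.
Proof.
move=> f0 mf; rewrite -(Radon_Nikodym_SigmaFinite.change_of_variables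
  (@normal_prob_dominates R m s) f0 measurableT mf).
have iRN := Radon_Nikodym_SigmaFinite.f_integrable (@normal_prob_dominates R m s).
apply: ae_eq_integral => //.
- by apply: emeasurable_funM => //; exact: measurable_int iRN.
- apply: emeasurable_funM => //.
  by apply/measurable_EFinP; exact: measurable_normal_pdf.
- exact: ae_eqe_mul2l.
Qed.

Lemma integrable_normal_prob (f : R -> R) : measurable_fun setT f ->
  (normal_prob m s).-integrable setT (EFin \o f) <->
  mu.-integrable setT (EFin \o (fun x => f x * normal_pdf m s x)).
Proof.
move=> mf.
have mp := @measurable_normal_pdf R m s.
have E : (\int[normal_prob m s]_x `|(f x)%:E| =
    \int[mu]_x `|(f x * normal_pdf m s x)%:E|)%E.
  rewrite ge0_integral_normal_prob//; last first.
    by apply: measurableT_comp => //; exact/measurable_EFinP.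
  apply: eq_integral => x _.
  by rewrite !abse_EFin normrM (ger0_norm (normal_pdf_ge0 _ _ _)) EFinM.
split=> /integrableP[_ h]; apply/integrableP; split.
- by apply/measurable_EFinP; exact: measurable_funM.
- by rewrite -E.
- exact/measurable_EFinP.
- by rewrite /comp E.
Qed.

Lemma integral_normal_prob (f : R -> R) : measurable_fun setT f ->
  (normal_prob m s).-integrable setT (EFin \o f) ->
  \int[normal_prob m s]_x f x = \int[mu]_x (f x * normal_pdf m s x).
Proof.
move=> mf intf.
have mp := @measurable_normal_pdf R m s.
have mEf : measurable_fun setT (EFin \o f) by exact/measurable_EFinP.
rewrite /Rintegral [in LHS]integralE [in RHS]integralE.
rewrite !ge0_integral_normal_prob//; last 2 first.
- exact: measurable_funeneg.
- exact: measurable_funepos.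
congr (fine (_ - _)); apply: eq_integral => x _.
- rewrite !funeposE /= -!EFin_max -EFinM; congr EFin.
  by rewrite maxr_pMl ?normal_pdf_ge0// mul0r.
- rewrite !funenegE /= -!EFin_max -EFinM; congr EFin.
  by rewrite maxr_pMl ?normal_pdf_ge0// mul0r mulNr.
Qed.

End normal_density_change.

Section integral_of_derivative.
Context {R : realType}.
Notation mu := (@lebesgue_measure R).

Lemma Rint_symmetric_cvg (f : R -> R) (m : R) :
  mu.-integrable setT (EFin \o f) ->
  \int[mu]_(x in `[m - n%:R, m + n%:R]) f x @[n --> \oo] --> \int[mu]_x f x.
Proof.
move=> intf.
have mf : measurable_fun setT f by apply/measurable_EFinP; exact: measurable_int intf.
pose g n := f \_ (`[m - n%:R, m + n%:R]%classic).
have mg n : measurable_fun setT (g n).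
  by apply/(measurable_restrictT _ _).1 => //; exact: measurable_funTS.
have gf : {ae mu, forall x, setT x -> (EFin \o g n) x @[n --> \oo] --> (EFin \o f) x}.
  apply: aeW => x _; apply: cvg_near_cst.
  near=> n; rewrite /g/= patchE ifT// inE/= in_itv/=.
  have : `|x - m| <= n%:R by near: n; exact: nbhs_infty_ger.
  by rewrite ler_distl.
have gle : {ae mu, forall x n, setT x -> (`|(EFin \o g n) x| <= (abse \o (EFin \o f)) x)%E}.
  apply: aeW => x n _; rewrite /g/= patchE; case: ifPn => // _.
  by rewrite normr0 lee_fin.
have mEg n : measurable_fun setT (EFin \o g n) by exact/measurable_EFinP.
have mEf : measurable_fun setT (EFin \o f) by exact/measurable_EFinP.
have [/= _ _ h] := @dominated_convergence _ _ _ mu setT measurableT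
  (fun n => EFin \o g n) (EFin \o f) (abse \o (EFin \o f)) mEg mEf gf
  (integrable_abse intf) gle.
have iE : (\int[mu]_x (f x)%:E = (\int[mu]_x f x)%:E)%E.
  by rewrite fineK//; apply: integrable_fin_num.
under eq_fun do rewrite Rintegral_mkcond.
by apply/fine_cvg; move: h; rewrite iE.
Unshelve. all: end_near. Qed.

(** The fundamental theorem of calculus on [[m - n, m + n]] leaves boundary terms that tend to 0,
    while dominated convergence identifies the limit of the truncated integrals. *)
Lemma Rint_derivative_eq0 (F f : R -> R) (m : R) :
  (forall x : R, is_derive x (1 : R) F (f x)) -> continuous f ->
  mu.-integrable setT (EFin \o f) ->
  F (m + n%:R) @[n --> \oo] --> 0 -> F (m - n%:R) @[n --> \oo] --> 0 ->
  \int[mu]_x f x = 0.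
Proof.
move=> dF cf intf F1 F2.
rewrite -(cvg_lim (@Rhausdorff R) (Rint_symmetric_cvg m intf)).
apply/(cvg_lim (@Rhausdorff R)); rewrite -[X in _ --> X](subrr 0).
have : F (m + n%:R) - F (m - n%:R) @[n --> \oo] --> 0 - 0 by exact: cvgB.
apply: cvg_trans; apply: near_eq_cvg; near=> n.
rewrite /Rintegral (@continuous_FTC2 _ f F)//.
- have : (0 < n)%N by near: n; exact: nbhs_infty_gt.
  by rewrite -(ltr0n R) => n0; lra.
- exact: continuous_subspaceT.
- have cF : continuous F.
    move=> x; apply: differentiable_continuous; apply/derivable1_diffP.
    exact: ex_derive.
  split.
  + by move=> x _; exact: ex_derive.
  + exact/cvg_at_right_filter/cF.
  + exact/cvg_at_left_filter/cF.
- by move=> x _; rewrite derive1E; exact: derive_val.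
Unshelve. all: end_near. Qed.

End integral_of_derivative.

Section derivation_rules.
Context {R : realType}.
Implicit Types (f g : R -> R) (x a b : R).

Lemma is_derive1D f g x a b : is_derive x (1 : R) f a -> is_derive x (1 : R) g b ->
  is_derive x (1 : R) (fun y => f y + g y) (a + b).
Proof. exact: is_deriveD. Qed.

Lemma is_derive1M f g x a b : is_derive x (1 : R) f a -> is_derive x (1 : R) g b ->
  is_derive x (1 : R) (fun y => f y * g y) (a * g x + f x * b).
Proof.
move=> df dg; have := is_deriveM df dg.
by rewrite /GRing.scale/= addrC (mulrC (g x)).
Qed.

Lemma is_derive1_compE f g x a b : is_derive (g x) (1 : R) f a ->
  is_derive x (1 : R) g b -> is_derive x (1 : R) (fun y => f (g y)) (a * b).
Proof. exact: is_derive1_comp. Qed.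

Lemma is_derive1_affine (c m x : R) :
  is_derive x (1 : R) (fun y => c * (y - m)) c.
Proof.
have h : is_derive x (1 : R) (fun y : R => y + (- m)) (1 + 0).
  exact: is_derive1D.
have := is_derive1M (is_derive_cst c x (1 : R)) h.
by rewrite mul0r add0r addr0 mulr1.
Qed.

End derivation_rules.

(** * Stein's identity for the normal law *)

Section normal_moments.
Context {R : realType} (m s : R).
Hypothesis s_gt0 : 0 < s.
Notation mu := (@lebesgue_measure R).
Notation p := (normal_pdf m s).

Let s_neq0 : s != 0. Proof. by rewrite gt_eqF. Qed.

Lemma is_derive_normal_pdf (x : R) :
  is_derive x (1 : R) p (- ((x - m) / s ^+ 2) * p x).
Proof.
have pE : p = (fun y => normal_peak s *
    expR ((- (s ^+ 2 *+ 2)^-1 * (y - m)) * (1 * (y - m)))).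
  apply/funext => y; rewrite /normal_pdf (negbTE s_neq0) /normal_fun.
  by congr (_ * expR _); field.
rewrite pE.
have d1 := is_derive1M (is_derive1_affine (- (s ^+ 2 *+ 2)^-1) m x) (is_derive1_affine 1 m x).
have d2 := is_derive1_compE (is_derive_expR _) d1.
have := is_derive1M (is_derive_cst (normal_peak s) x (1 : R)) d2.
rewrite mul0r add0r => d3; apply: (is_derive_eq d3).
by rewrite /=; move: (expR _) (normal_peak s) => E K; field.
Qed.

(** With [y = (x - m) ^ 2 / (2 s ^ 2)] this is [y exp (- y) <= 1], which follows from
    [y <= 1 + y <= exp y]. *)
Lemma normal_pdf_sqr_le x : (x - m) ^+ 2 * p x <= 2 * s ^+ 2 * normal_peak s.
Proof.
rewrite /normal_pdf (negbTE s_neq0) /normal_fun mulNr expRN.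
set y := (X in expR X).
have y0 : 0 <= y by apply: divr_ge0; [exact: sqr_ge0|apply/mulrn_wge0/sqr_ge0].
have -> : (x - m) ^+ 2 = 2 * s ^+ 2 * y by rewrite /y; field.
have yE : y * (expR y)^-1 <= 1.
  by rewrite ler_pdivrMr ?expR_gt0// mul1r (le_trans _ (expR_ge1Dx _))// lerDr.
have -> : 2 * s ^+ 2 * y * (normal_peak s * (expR y)^-1) =
  2 * s ^+ 2 * normal_peak s * (y * (expR y)^-1) by ring.
apply: ler_piMr => //; apply: mulr_ge0; last exact: normal_peak_ge0.
by apply: mulr_ge0 => //; exact: sqr_ge0.
Qed.

(** Half of the Gaussian exponent absorbs the square; the other half is, up to a constant, the
    density with standard deviation [s * sqrt 2], which is integrable. *)
Lemma normal_integrable_sqr :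
  (normal_prob m s).-integrable setT (EFin \o (fun x : R => (x - m) ^+ 2)).
Proof.
have msq : measurable_fun setT (fun x : R => (x - m) ^+ 2).
  by apply: measurable_funX; exact: measurable_funB.
apply/integrable_normal_prob => //.
pose s' := s * Num.sqrt 2.
have s'2 : s' ^+ 2 = s ^+ 2 * 2 by rewrite exprMn sqr_sqrtr.
have s'0 : s' != 0 by rewrite mulf_neq0// gt_eqF// sqrtr_gt0.
pose C := 4 * s ^+ 2 * normal_peak s / normal_peak s'.
apply: (@le_integrable _ _ _ mu setT measurableT _
    (fun x => (C * normal_pdf m s' x)%:E)).
- by apply/measurable_EFinP; apply: measurable_funM => //; exact: measurable_normal_pdf.
- move=> x _ /=; rewrite lee_fin ger0_norm; last first.
    by rewrite mulr_ge0 ?sqr_ge0 ?normal_pdf_ge0.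
  have pk' : 0 < normal_peak s' by exact: normal_peak_gt0.
  have pk : 0 < normal_peak s by exact: normal_peak_gt0.
  rewrite ger0_norm; last first.
    apply: mulr_ge0; last exact: normal_pdf_ge0.
    apply: divr_ge0; last exact: ltW.
    by apply: mulr_ge0; [apply: mulr_ge0 => //; exact: sqr_ge0|exact: ltW].
  rewrite /normal_pdf (negbTE s_neq0) (negbTE s'0) /normal_fun !mulNr !expRN.
  rewrite s'2; set y := _ / (s ^+ 2 * 2 *+ 2).
  have y0 : 0 <= y by apply: divr_ge0; [exact: sqr_ge0|apply: mulrn_wge0; rewrite mulr_ge0// sqr_ge0].
  have -> : (x - m) ^+ 2 / (s ^+ 2 *+ 2) = y + y by rewrite /y; field.
  have -> : (x - m) ^+ 2 = 4 * s ^+ 2 * y by rewrite /y; field.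
  rewrite expRD; have ye := expR_ge1Dx y; have e0 := expR_gt0 y.
  have -> : C * (normal_peak s' * (expR y)^-1) = 4 * s ^+ 2 * normal_peak s * (expR y)^-1.
    by rewrite /C; field; rewrite !gt_eqF.
  have -> : 4 * s ^+ 2 * y * (normal_peak s / (expR y * expR y)) =
    4 * s ^+ 2 * normal_peak s * (expR y)^-1 * (y / expR y).
    by field; rewrite gt_eqF.
  have yE : y / expR y <= 1 by rewrite ler_pdivrMr// mul1r (le_trans _ ye)// lerDr.
  apply: ler_piMr => //.
  apply: mulr_ge0; last by rewrite invr_ge0 ltW.
  by apply: mulr_ge0; [apply: mulr_ge0 => //; exact: sqr_ge0|exact: ltW].
- under eq_fun do rewrite EFinM.
  by apply: integrableZl => //; exact: integrable_normal_pdf.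
Qed.

Lemma normal_integrable_quad (f : R -> R) (A : R) : measurable_fun setT f ->
  (forall x, `|f x| <= A * (1 + (x - m) ^+ 2)) ->
  (normal_prob m s).-integrable setT (EFin \o f).
Proof.
move=> mf fA.
apply: (@le_integrable _ _ _ (normal_prob m s) setT measurableT _
    (fun x => (A * (1 + (x - m) ^+ 2))%:E)).
- exact/measurable_EFinP.
- move=> x _ /=; rewrite lee_fin (le_trans (fA x))//.
  exact: ler_norm.
- under eq_fun do rewrite EFinM EFinD.
  apply: integrableZl => //.
  have h1 := @bmeas_integrable _ _ _ (normal_prob m s) _ (bmeas_cst 1).
  exact: (integrableD measurableT h1 normal_integrable_sqr).
Qed.

(** The function [g - (x - m) G / s ^ 2] times the density is the derivative of [G] times the
    density, so its integral is 0; the linear growth of [G] makes the boundary terms vanish. *)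
Lemma stein (G g : R -> R) (A : R) : (forall x : R, is_derive x (1 : R) G (g x)) ->
  continuous g -> (forall x, `|g x| <= A) ->
  (forall x, `|G x| <= A * (1 + `|x - m|)) ->
  \int[normal_prob m s]_x ((x - m) * G x) = s ^+ 2 * \int[normal_prob m s]_x g x.
Proof.
move=> dG cg gA GA.
have A0 : 0 <= A by exact: le_trans (gA m).
have cG : continuous G.
  move=> x; apply: differentiable_continuous; apply/derivable1_diffP.
  exact: ex_derive.
have mg : measurable_fun setT g by exact: continuous_measurable_fun.
have mG : measurable_fun setT G by exact: continuous_measurable_fun.
have mxG : measurable_fun setT (fun x : R => (x - m) * G x).
  by apply: measurable_funM => //; exact: measurable_funB.
have ig : (normal_prob m s).-integrable setT (EFin \o g).
  by apply: bmeas_integrable; split => //; exists A.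
have ixG : (normal_prob m s).-integrable setT (EFin \o (fun x : R => (x - m) * G x)).
  apply: (@normal_integrable_quad _ (2 * A)) => // x.
  rewrite normrM (le_trans (ler_wpM2l _ (GA x)))// -(real_normK (num_real (x - m))).
  have := mulr_ge0 A0 (sqr_ge0 (`|x - m| - 2^-1)); move: `|x - m| => z; nra.
have i1 : (normal_prob m s).-integrable setT
    (EFin \o (fun x : R => s ^- 2 * ((x - m) * G x))).
  by rewrite /comp; under eq_fun do rewrite EFinM; exact: integrableZl.
have i0 : (normal_prob m s).-integrable setT
    (EFin \o (fun x : R => g x - s ^- 2 * ((x - m) * G x))).
  by rewrite /comp; under eq_fun do rewrite EFinB; exact: integrableB.
have m0 : measurable_fun setT (fun x : R => g x - s ^- 2 * ((x - m) * G x)).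
  by apply: measurable_funB => //; exact: measurable_funM.
suff : \int[normal_prob m s]_x (g x - s ^- 2 * ((x - m) * G x)) = 0.
  rewrite RintegralB//.
  rewrite RintegralZl// => /eqP; rewrite subr_eq0 => /eqP ->.
  by rewrite mulrA divff ?mul1r// expf_neq0.
rewrite integral_normal_prob//.
(* For [|x - m| >= 1] the bound on [G] is at most [2 A |x - m|]; the rest of [C] bounds
   [(x - m) ^ 2] times the density. *)
pose C := 2 * A * (2 * s ^+ 2 * normal_peak s).
have bound x : 1 <= `|x - m| -> `|G x * p x| <= C / `|x - m|.
  move=> x1; have x0 : 0 < `|x - m| by exact: lt_le_trans x1.
  have p0 := normal_pdf_ge0 m s x.
  rewrite normrM (ger0_norm p0) ler_pdivlMr//.
  apply: (@le_trans _ _ (2 * A * `|x - m| * p x * `|x - m|)).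
    rewrite ler_pM2r// ler_wpM2r// (le_trans (GA x))//; nra.
  have := normal_pdf_sqr_le x; rewrite -[X in X * _]real_normK ?num_real// => h.
  by rewrite /C; nra.
have lim0 (h : nat -> R) : (forall n, `|h n - m| = n%:R) ->
    G (h n) * p (h n) @[n --> \oo] --> 0.
  move=> hn; apply: norm_cvg0.
  (* Since [harmonic n] is [1 / (n + 1)], the bound [C / n] needs the factor 2, and it is only
     available for [n >= 1]. *)
  apply: (@squeeze_cvgr _ _ _ _ (cst 0) (fun n => (2 * C) * harmonic n)).
  - near=> n; rewrite normr_ge0/=.
    have n0 : (0 < n)%N by near: n; exact: nbhs_infty_gt.
    have n1 : 1 <= n%:R :> R by rewrite ler1n.
    rewrite (le_trans (bound _ _)) ?hn// /harmonic/=.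
    have C0 : 0 <= C.
      by rewrite /C !mulr_ge0 ?sqr_ge0 ?normal_peak_ge0// ltW.
    rewrite ler_pdivrMr ?(lt_le_trans _ n1)//.
    set k : R := n.+1%:R^-1; have k1 : k * (n%:R + 1) = 1.
      by rewrite natr1 mulVf.
    have -> : 2 * C * k * n%:R = 2 * C * (k * (n%:R + 1) - k) by ring.
    have k2 : k <= 2^-1 by rewrite lef_pV2 ?posrE// -natr1; lra.
    by rewrite k1; nra.
  - exact: cvg_cst.
  - rewrite -[X in _ --> X](mulr0 (2 * C)); apply: cvgM; first exact: cvg_cst.
    exact: cvg_harmonic.
apply: (@Rint_derivative_eq0 _ (fun x => G x * p x) _ m).
- move=> x; apply: (is_derive_eq (is_derive1M (dG x) (is_derive_normal_pdf x))).
  by field.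
- move=> x; apply: cvgM; last exact: continuous_normal_pdf.
  apply: cvgB; first exact: cg.
  apply: cvgM; first exact: cvg_cst.
  apply: cvgM; last exact: cG.
  by apply: cvgB; [exact: cvg_id|exact: cvg_cst].
- exact/integrable_normal_prob.
- by apply: lim0 => n; rewrite addrAC subrr add0r ger0_norm.
- by apply: lim0 => n; rewrite addrAC subrr add0r normrN ger0_norm.
Unshelve. all: end_near. Qed.

End normal_moments.

Section normal_characteristic_function.
Context {R : realType} (m s : R).
Hypothesis s_gt0 : 0 < s.
Notation N := (normal_prob m s).

Lemma normal_mean0 : \int[N]_x (x - m) = 0.
Proof.
have := @stein _ m s s_gt0 (cst 1) (cst 0) 1 (fun x => is_derive_cst _ _ _) (fun=> cvg_cst _).
rewrite Rint_cst mulr0 => <-.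
- by apply: eq_Rintegral => x _; rewrite mulr1.
- by move=> x; rewrite normr0.
- by move=> x; rewrite normr1 mul1r lerDl.
Qed.

Lemma normal_variance : \int[N]_x ((x - m) ^+ 2) = s ^+ 2.
Proof.
have d x : is_derive x (1 : R) (fun y => y - m) 1.
  by have := is_derive1_affine 1 m x; under eq_fun do rewrite mul1r.
have := @stein _ m s s_gt0 (fun x => x - m) (cst 1) 1 d (fun=> cvg_cst _).
rewrite Rint_cst mulr1 => <-//.
- by move=> x; rewrite normr1.
- by move=> x; rewrite mul1r lerDr.
Qed.

Section cosine_type.
Variables c c' : R -> R.
Hypotheses (dc : forall x : R, is_derive x (1 : R) c (c' x))
  (dc' : forall x : R, is_derive x (1 : R) c' (- c x)).
Hypotheses (c1 : forall x, `|c x| <= 1) (c'1 : forall x, `|c' x| <= 1).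

Let cont_of (f f' : R -> R) : (forall x : R, is_derive x (1 : R) f (f' x)) -> continuous f.
Proof.
move=> df x; apply: differentiable_continuous; apply/derivable1_diffP.
exact: ex_derive.
Qed.

Let mc : measurable_fun setT c.
Proof. by apply: continuous_measurable_fun; exact: (cont_of dc). Qed.

Let maff t : measurable_fun setT (fun x : R => t * (x - m)).
Proof.
exact: (measurable_funM (measurable_cst t) (measurable_funB (@measurable_id _ _ _) (measurable_cst m))).
Qed.

Let bc t : bmeas (fun x : R => c (t * (x - m))).
Proof. by split; [exact: (measurableT_comp mc (maff t))|exists 1 => x; exact: c1]. Qed.

Let y t := \int[N]_x c (t * (x - m)).

Let dcomp (f f' : R -> R) (b a t : R) : (forall x : R, is_derive x (1 : R) f (f' x)) ->
  is_derive t (1 : R) (fun t => f (t * (a - b))) ((a - b) * f' (t * (a - b))).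
Proof.
move=> df.
have h : is_derive t (1 : R) (fun y : R => y * (a - b)) (a - b).
  have := is_derive1M (is_derive_id t (1 : R)) (is_derive_cst (a - b) t (1 : R)).
  by rewrite mulr0 addr0 mul1r.
by have := is_derive1_compE (df _) h; rewrite mulrC.
Qed.

Let dcomp2 (f f' : R -> R) (t x : R) : (forall x : R, is_derive x (1 : R) f (f' x)) ->
  is_derive x (1 : R) (fun x => f (t * (x - m))) (t * f' (t * (x - m))).
Proof.
move=> df.
by have := is_derive1_compE (df _) (is_derive1_affine t m x); rewrite mulrC.
Qed.

(* Differentiating under the integral and integrating by parts (Stein) gives the
   equation [y' = - s ^ 2 t y] solved below. *)
Let y_derive t : is_derive t (1 : R) y (- (s ^+ 2 * t * y t)).
Proof.
have Ia : (`]t - 1, t + 1[%classic : set R) t by rewrite /= in_itv/=; lra.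
have d1E a x : partial1of2 (fun t x => c (t * (x - m))) a x = (x - m) * c' (a * (x - m)).
  by rewrite partial1of2E; have := dcomp m x a dc => -[].
have iG : N.-integrable setT (EFin \o (fun x : R => `|x - m|)).
  apply: (@normal_integrable_quad _ _ _ s_gt0 _ 1).
    by apply: measurableT_comp => //; exact: measurable_funB.
  move=> x; rewrite normr_id mul1r -(real_normK (num_real (x - m))).
  by move: `|x - m| => z; nra.
have iF a : (`]t - 1, t + 1[%classic : set R) a -> N.-integrable setT (EFin \o (fun x : R => c (a * (x - m)))).
  by move=> _; exact: (@bmeas_integrable _ _ _ N _ (bc a)).
have der a x : (`]t - 1, t + 1[%classic : set R) a -> [set: R] x ->
    derivable ((fun t x => c (t * (x - m))) ^~ x) a 1.
  by move=> _ _; have := dcomp m x a dc => -[].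
have ub a x : (`]t - 1, t + 1[%classic : set R) a -> [set: R] x ->
    `|partial1of2 (fun t x => c (t * (x - m))) a x| <= `|x - m|.
  by move=> _ _; rewrite d1E normrM ler_piMr.
have h1 := @derivable_under_integral R _ _ N (fun t x => c (t * (x - m))) setT measurableT
  t _ _ Ia iF der (fun x => `|x - m|) (fun x => normr_ge0 _) iG ub.
have h2 := @differentiation_under_integral R _ _ N (fun t x => c (t * (x - m))) setT measurableT
  t _ _ Ia iF der (fun x => `|x - m|) (fun x => normr_ge0 _) iG ub.
apply: DeriveDef => //; rewrite -derive1E h2.
under eq_Rintegral do rewrite d1E.
have e1 (x : R) : is_derive x (1 : R) (fun x => c' (t * (x - m))) (t * - c (t * (x - m))).
  exact: (dcomp2 t x dc').
have e2 : continuous (fun x : R => t * - c (t * (x - m))).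
  move=> x; apply: cvgM; first exact: cvg_cst.
  apply: cvgN; apply: (@cvg_comp _ _ _ (fun x => t * (x - m)) c _ (nbhs (t * (x - m)))).
    by apply: cvgM; [exact: cvg_cst|apply: cvgB; [exact: cvg_id|exact: cvg_cst]].
  exact: (cont_of dc).
have e3 (x : R) : `|t * - c (t * (x - m))| <= 1 + `|t|.
  by rewrite normrM normrN (le_trans (ler_wpM2l _ (c1 _)))// mulr1 lerDr.
have e4 (x : R) : `|c' (t * (x - m))| <= (1 + `|t|) * (1 + `|x - m|).
  rewrite (le_trans (c'1 _))// -[leLHS]mulr1 ler_pM// lerDl//.
rewrite (stein s_gt0 e1 e2 e3 e4) RintegralZl//; last first.
  exact: (@bmeas_integrable _ _ _ N _ (bmeasN (bc t))).
under eq_Rintegral do rewrite -mulN1r.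
by rewrite (@RintZl _ _ _ N _ _ (bc t)) -/(y t); ring.
Qed.

(** Cosine and sine are treated together as bounded solutions of [c'' = - c]. By the differential
    equation for [y], the product of [y] and [exp (s ^ 2 t ^ 2 / 2)] has derivative 0, so it keeps
    its value [c 0] at the origin. *)
Lemma normal_cosine_type t :
  \int[N]_x c (t * (x - m)) = c 0 * expR (- (s ^+ 2 * t ^+ 2 / 2)).
Proof.
pose w (t : R) := y t * expR (((s ^+ 2 / 2) * (t - 0)) * (1 * (t - 0))).
have dw (u : R) : is_derive u (1 : R) w 0.
  have d1 := is_derive1M (is_derive1_affine (s ^+ 2 / 2) 0 u) (is_derive1_affine 1 0 u).
  have d2 := is_derive1_compE (is_derive_expR _) d1.
  apply: (is_derive_eq (is_derive1M (y_derive u) d2)).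
  by rewrite /=; move: (expR _) (y u) => e z; field.
have := is_derive_0_is_cst t 0 dw; rewrite /w !subr0 !(mul0r, mulr0) expR0 mulr1.
rewrite (_ : y 0 = c 0); last first.
  by rewrite /y; under eq_Rintegral do rewrite mul0r; rewrite Rint_cst.
move=> <-; rewrite -[RHS]mulrA -expRD.
set v := (X in expR X); have -> : v = 0 by rewrite /v; field.
by rewrite expR0 mulr1.
Qed.

End cosine_type.

Lemma normal_cos t : \int[N]_x cos (t * (x - m)) = expR (- (s ^+ 2 * t ^+ 2 / 2)).
Proof.
rewrite (@normal_cosine_type cos (fun x => - sin x) (@is_derive_cos R)).
- by rewrite cos0 mul1r.
- by move=> x; rewrite ler_norml cos_geN1 cos_le1.
- by move=> x; rewrite normrN ler_norml sin_geN1 sin_le1.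
Qed.

Lemma normal_sin t : \int[N]_x sin (t * (x - m)) = 0.
Proof.
rewrite (@normal_cosine_type sin cos (@is_derive_sin R) (@is_derive_cos R)).
- by rewrite sin0 mul0r.
- by move=> x; rewrite ler_norml sin_geN1 sin_le1.
- by move=> x; rewrite ler_norml cos_geN1 cos_le1.
Qed.

End normal_characteristic_function.

(* [normal_prob] lives on the type [R] with its Borel structure presented as a
   generated sigma-algebra, which is not convertible to the canonical
   measurable structure of [R]; [normal_law] is the same measure on the latter. *)
Definition normal_law {R : realType} (m s : R) (A : set R) : \bar R :=
  normal_prob m s A.

Section normal_law.
Context {R : realType} (m s : R).

Let normal_law0 : normal_law m s set0 = 0%E.
Proof. exact: (measure0 (normal_prob m s)). Qed.

Let normal_law_ge0 A : (0 <= normal_law m s A)%E.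
Proof. exact: (measure_ge0 (normal_prob m s)). Qed.

Let normal_law_sigma_additive : semi_sigma_additive (normal_law m s).
Proof. exact: (@measure_semi_sigma_additive _ _ _ (normal_prob m s)). Qed.

HB.instance Definition _ := isMeasure.Build _ R R (normal_law m s)
  normal_law0 normal_law_ge0 normal_law_sigma_additive.

Let normal_lawT : normal_law m s setT = 1%E.
Proof. exact: (probability_setT (normal_prob m s)). Qed.

HB.instance Definition _ :=
  @Measure_isProbability.Build _ R R (normal_law m s) normal_lawT.

Lemma integral_normal_law (f : R -> R) : measurable_fun setT f ->
  (normal_prob m s).-integrable setT (EFin \o f) ->
  (normal_law m s).-integrable setT (EFin \o f) /\
  (\int[normal_prob m s]_x (f x)%:E = \int[normal_law m s]_x (f x)%:E)%E.
Proof.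
exact: (@eq_law_integral R _ _ _ _ R R (normal_prob m s) (normal_law m s) id id).
Qed.

Lemma Rint_normal_law (f : R -> R) : bmeas f ->
  \int[normal_law m s]_x f x = \int[normal_prob m s]_x f x.
Proof.
move=> bf; rewrite /Rintegral (integral_normal_law bf.1 _).2//.
exact: (@bmeas_integrable _ _ _ (normal_prob m s) _ bf).
Qed.

End normal_law.

(** * Characteristic functions of laws on the plane *)

Section plane_metric.
Context {R : realType}.

Definition l1dist (x y : R * R) : R := `|x.1 - y.1| + `|x.2 - y.2|.

Lemma l1dist_ge0 x y : 0 <= l1dist x y.
Proof. exact: addr_ge0. Qed.

Lemma l1distxx x : l1dist x x = 0.
Proof. by rewrite /l1dist !subrr normr0 addr0. Qed.

Lemma l1dist_tri x y z : l1dist x z <= l1dist x y + l1dist y z.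
Proof.
rewrite /l1dist addrACA lerD//.
- by rewrite (le_trans _ (ler_normD _ _))// addrA subrK.
- by rewrite (le_trans _ (ler_normD _ _))// addrA subrK.
Qed.

Lemma l1distC x y : l1dist x y = l1dist y x.
Proof. by rewrite /l1dist (distrC x.1) (distrC x.2). Qed.

(** An open set is the union of the rational boxes that it contains, and there are countably many of
    them. *)
Lemma l1open_measurable (U : set (R * R)) :
  (forall x, U x -> exists2 e, 0 < e & forall y, l1dist x y < e -> U y) ->
  measurable U.
Proof.
move=> oU.
pose box (q : rat * rat * rat) : set (R * R) :=
  `](ratr q.1.1 - ratr q.2), (ratr q.1.1 + ratr q.2)[%classic `*`
  `](ratr q.1.2 - ratr q.2), (ratr q.1.2 + ratr q.2)[%classic.
have -> : U = \bigcup_(q in [set q | box q `<=` U]) box q.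
  apply/seteqP; split => [x Ux|x [q /= qU qx]]; last exact: qU.
  have [e e0 eU] := oU _ Ux.
  (* A box of half-width [r] whose centre is within [r] of [x] contains [x], and each coordinate of
     its points is within [2 r < e / 2] of that of [x]. The lower bound [e / 8] only keeps [r]
     positive. *)
  have [r] : exists r : rat, (e / 8 : R) < ratr r < e / 4.
    have : (e / 8 : R) < e / 4 by lra.
    by move=> /rat_in_itvoo[r]; rewrite in_itv/=; exists r.
  move=> /andP[r1 r2].
  have app (a : R) : exists q : rat, `|a - ratr q| < ratr r.
    have : a - ratr r < a + ratr r by lra.
    by move=> /rat_in_itvoo[q]; rewrite in_itv/= => h; exists q; rewrite ltr_distlC.
  have [q1 hq1] := app x.1; have [q2 hq2] := app x.2.
  exists (q1, q2, r) => /=.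
    move=> y [/=]; rewrite !in_itv/= => /andP[a1 a2] /andP[b1 b2].
    apply: eU; rewrite /l1dist; move: hq1 hq2; rewrite !ltr_norml => /andP[c1 c2] /andP[d1 d2].
    have h1 : `|x.1 - y.1| < e / 2 by rewrite ltr_norml; apply/andP; split; lra.
    have h2 : `|x.2 - y.2| < e / 2 by rewrite ltr_norml; apply/andP; split; lra.
    lra.
  move: hq1 hq2; rewrite !ltr_norml => /andP[c1 c2] /andP[d1 d2].
  by split; rewrite /= in_itv/=; apply/andP; split; lra.
rewrite bigcup_mkcond; apply: countable_bigcupT_measurable => // q.
case: ifP => // _.
by apply: measurableX; exact: measurable_itv.
Qed.

Lemma l1lsc_measurable (h : R * R -> R) :
  (forall x e, 0 < e -> exists2 r, 0 < r & forall y, l1dist x y < r -> h x - e < h y) ->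
  measurable_fun setT h.
Proof.
move=> lsc _; apply: (measurability _ (RGenOInfty.measurableE R)) => //.
move=> /= _ [_ [a ->] <-]; rewrite setTI; apply: l1open_measurable => x /=.
rewrite in_itv/= andbT => ax.
have [r r0 hr] := lsc x (h x - a) (ltac:(lra)).
by exists r => // y /hr; rewrite in_itv/= andbT; lra.
Qed.

Lemma l1lip_measurable (h : R * R -> R) (K : R) :
  (forall x y, `|h x - h y| <= K * l1dist x y) -> measurable_fun setT h.
Proof.
move=> lip; apply: l1lsc_measurable => x e e0.
have K1 : 0 < `|K| + 1 by rewrite ltr_wpDl.
exists (e / (`|K| + 1)); first by rewrite divr_gt0.
move=> y; rewrite ltr_pdivlMr// => xy.
have := lip x y; have d0 := l1dist_ge0 x y; have := ler_norm K.
have := ler_norm (h x - h y); nra.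
Qed.

End plane_metric.

(** * Change of normal law and smoothing error *)

Section normal_tilt.
Context {R : realType}.

(** Here [q] is the likelihood ratio of two normal laws. It replaces a law whose centre varies by a
    fixed one, as needed to see a Gaussian smoothing as a mixture over a single probability. *)
Lemma Rint_normal_tilt (m s z e : R) (h q : R -> R) : bmeas h ->
  measurable_fun setT q -> (forall x, q x * normal_pdf m s x = normal_pdf z e x) ->
  \int[normal_law m s]_x (h x * q x) = \int[normal_law z e]_x h x.
Proof.
move=> bh mq qE.
have mf : measurable_fun setT (fun x => h x * q x).
  by apply: measurable_funM => //; case: bh.
have ih := @bmeas_integrable _ _ _ (normal_prob z e) _ bh.
have i1 : (normal_prob m s).-integrable setT (EFin \o (fun x => h x * q x)).
  apply/integrable_normal_prob => //.
  under eq_fun do rewrite -mulrA qE.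
  exact/(integrable_normal_prob _ _ bh.1).
transitivity (\int[normal_prob m s]_x (h x * q x)).
  by congr fine; exact: esym (integral_normal_law mf i1).2.
rewrite (Rint_normal_law _ _ bh).
rewrite (integral_normal_prob bh.1 ih) (integral_normal_prob mf i1).
by apply: eq_Rintegral => x _; rewrite -mulrA qE.
Qed.

(* [2 e |x - z| <= e ^ 2 + (x - z) ^ 2] reduces the first absolute moment to the variance. *)
Lemma Rint_normal_lip (z e K : R) (h : R -> R) : 0 < e -> bmeas h ->
  (forall x, `|h x - h z| <= K * `|x - z|) ->
  `|\int[normal_law z e]_x h x - h z| <= K * e.
Proof.
move=> e0 bh hK; rewrite Rint_normal_law//.
have K0 : 0 <= K.
  have := hK (z + 1); rewrite addrAC subrr add0r normr1 mulr1.
  exact: le_trans.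
have mh := bh.1.
have isq := @normal_integrable_sqr R z e e0.
have ib := @bmeas_integrable _ _ _ (normal_prob z e) _ (bmeas_cst (K * e / 2)).
have i2 : (normal_prob z e).-integrable setT
    (EFin \o (fun x : R => K * e / 2 + K / (2 * e) * (x - z) ^+ 2)).
  rewrite /comp; under eq_fun do rewrite EFinD EFinM.
  have h2 := integrableZl measurableT (K / (2 * e)) isq.
  exact: (integrableD measurableT ib h2).
have bd : bmeas (fun x => h x - h z) by apply: bmeasB => //; exact: bmeas_cst.
have id := @bmeas_integrable _ _ _ (normal_prob z e) _ bd.
rewrite -{1}(@Rint_cst _ _ _ (normal_prob z e) (h z)).
rewrite -(@RintB _ _ _ (normal_prob z e) _ _ bh (bmeas_cst _)).
have le1 x : `|h x - h z| <= K * e / 2 + K / (2 * e) * (x - z) ^+ 2.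
  apply: (le_trans (hK x)).
  have -> : K * e / 2 + K / (2 * e) * (x - z) ^+ 2 =
    K / (2 * e) * (e ^+ 2 + `|x - z| ^+ 2).
    by rewrite real_normK ?num_real//; field; rewrite gt_eqF.
  have -> : K * `|x - z| = K / (2 * e) * (2 * e * `|x - z|) by field; rewrite gt_eqF.
  apply: ler_wpM2l; first by rewrite divr_ge0// mulr_ge0// ltW.
  have := sqr_ge0 (e - `|x - z|); move: `|x - z| => t; nra.
apply: (le_trans (le_normr_Rintegral measurableT id)).
have in' := @bmeas_integrable _ _ _ (normal_prob z e) _ (bmeas_norm bd).
apply: (le_trans (le_Rintegral measurableT in' i2 (fun x _ => le1 x))).
rewrite (RintegralD measurableT ib (integrableZl measurableT (K / (2 * e)) isq)).
rewrite (RintegralZl (K / (2 * e)) measurableT isq) (normal_variance z e0) Rint_cst.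
rewrite le_eqVlt; apply/orP; left; apply/eqP; field.
by rewrite gt_eqF.
Qed.

End normal_tilt.

(** * From trigonometric functions to Gaussian smoothings *)

Section levy.
Context {R : realType}.
Variables (mu : nat -> probability (R * R)%type R) (mu0 : probability (R * R)%type R).

Definition cvgI (f : R * R -> R) : Prop :=
  \int[mu l]_z f z @[l --> \oo] --> \int[mu0]_z f z.

Lemma cvgI_ext f g : f =1 g -> cvgI f -> cvgI g.
Proof. by move=> /funext ->. Qed.

Lemma cvgIZ c f : bmeas f -> cvgI f -> cvgI (fun z => c * f z).
Proof.
move=> bf cf; rewrite /cvgI RintZl//.
under eq_fun do rewrite RintZl//.
by apply: cvgM => //; exact: cvg_cst.
Qed.

Lemma cvgID f g : bmeas f -> bmeas g -> cvgI f -> cvgI g -> cvgI (fun z => f z + g z).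
Proof.
move=> bf bg cf cg; rewrite /cvgI RintD//.
under eq_fun do rewrite RintD//.
exact: cvgD.
Qed.

(** Fubini moves the mixing variable outside, where the inner integrals converge pointwise and are
    uniformly bounded. *)
Lemma cvgI_mix d (Y : measurableType d) (nu : probability Y R) (F : Y * (R * R) -> R) :
  bmeas F -> (forall y, cvgI (fun z => F (y, z))) ->
  cvgI (fun z => \int[nu]_y F (y, z)).
Proof.
move=> bF cF; rewrite /cvgI -Rint_fubini//.
under eq_fun do rewrite -Rint_fubini//.
have [M FM] := bF.2.
apply: (@Rint_bounded_cvg _ _ _ _ _ _ M) => //.
- by move=> l; case: (bmeas_Rint1 nu (mu l) bF).
- by case: (bmeas_Rint1 nu mu0 bF).
- move=> l y; apply: Rint_norm_le => //; exact: bmeas_pair1.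
Qed.

Lemma cvgI_unif (g : R * R -> R) : bmeas g ->
  (forall e, 0 < e -> exists f, [/\ bmeas f, cvgI f & forall z, `|f z - g z| <= e]) ->
  cvgI g.
Proof.
move=> bg H; apply/cvgrPdist_le => e e0.
have [f [bf cf fg]] := H (e / 3) (ltac:(by rewrite divr_gt0)).
have close (P : probability (R * R)%type R) : `|\int[P]_z f z - \int[P]_z g z| <= e / 3.
  by rewrite -RintB//; apply: Rint_norm_le => //; exact: bmeasB.
move/cvgrPdist_le : cf => /(_ (e / 3) (ltac:(by rewrite divr_gt0))).
apply: filterS => l h.
have := close mu0; have := close (mu l); move: h; rewrite !ler_norml.
by move=> /andP[? ?] /andP[? ?] /andP[? ?]; apply/andP; split; lra.
Qed.

Hypothesis cvg_cos : forall u v, cvgI (fun z => cos (u * z.1 + v * z.2)).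
Hypothesis cvg_sin : forall u v, cvgI (fun z => sin (u * z.1 + v * z.2)).

Let mcos : measurable_fun setT (@cos R).
Proof. by apply: continuous_measurable_fun; exact: continuous_cos. Qed.

Let msin : measurable_fun setT (@sin R).
Proof. by apply: continuous_measurable_fun; exact: continuous_sin. Qed.

Let bcos d (T : measurableType d) (f : T -> R) : measurable_fun setT f ->
  bmeas (fun x => cos (f x)).
Proof.
move=> mf; split; first exact: (measurableT_comp mcos mf).
by exists 1 => x; rewrite ler_norml cos_geN1 cos_le1.
Qed.

Let bsin d (T : measurableType d) (f : T -> R) : measurable_fun setT f ->
  bmeas (fun x => sin (f x)).
Proof.
move=> mf; split; first exact: (measurableT_comp msin mf).
by exists 1 => x; rewrite ler_norml sin_geN1 sin_le1.
Qed.

Let mlin (u v : R) : measurable_fun setT (fun z : R * R => u * z.1 + v * z.2).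
Proof.
by apply: measurable_funD; apply: measurable_funM.
Qed.

Let cvg_phase c u v : cvgI (fun z => cos (c - (u * z.1 + v * z.2))).
Proof.
apply: (@cvgI_ext (fun z => cos c * cos (u * z.1 + v * z.2) + sin c * sin (u * z.1 + v * z.2))).
  by move=> z; rewrite cosB.
apply: cvgID; last 2 first.
- by apply: cvgIZ => //; exact: (bcos (mlin u v)).
- by apply: cvgIZ => //; exact: (bsin (mlin u v)).
- by apply: bmeasM; [exact: bmeas_cst|exact: (bcos (mlin u v))].
- by apply: bmeasM; [exact: bmeas_cst|exact: (bsin (mlin u v))].
Qed.

(** Product-to-sum formulas reduce this to the assumed convergences. The subtracted zeros give the
    integrand the shape it has in [normal_cos] for mean 0. *)
Let cvg_coscos (x t : R * R) :
  cvgI (fun z => cos ((x.1 - z.1) * (t.1 - 0)) * cos ((x.2 - z.2) * (t.2 - 0))).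
Proof.
apply: (@cvgI_ext (fun z =>
  2^-1 * cos ((x.1 * t.1 + x.2 * t.2) - (t.1 * z.1 + t.2 * z.2)) +
  2^-1 * cos ((x.1 * t.1 - x.2 * t.2) - (t.1 * z.1 + (- t.2) * z.2)))).
  move=> z.
  have -> : x.1 * t.1 + x.2 * t.2 - (t.1 * z.1 + t.2 * z.2) =
    (x.1 - z.1) * (t.1 - 0) + (x.2 - z.2) * (t.2 - 0) by ring.
  have -> : x.1 * t.1 - x.2 * t.2 - (t.1 * z.1 + (- t.2) * z.2) =
    (x.1 - z.1) * (t.1 - 0) - (x.2 - z.2) * (t.2 - 0) by ring.
  by rewrite cosD cosB; field.
have b c u v : bmeas (fun z : R * R => cos (c - (u * z.1 + v * z.2))).
  by apply: bcos; apply: measurable_funB => //; exact: mlin.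
apply: cvgID; last 2 first.
- by apply: cvgIZ.
- by apply: cvgIZ.
- by apply: bmeasM; [exact: bmeas_cst|exact: b].
- by apply: bmeasM; [exact: bmeas_cst|exact: b].
Qed.

(** The Gaussian is its own Fourier transform up to scaling: averaging [cos ((x - z) t)] over a
    normal [t] with standard deviation [1 / e] gives [exp (- (x - z) ^ 2 / (2 e ^ 2))], so the
    density is a mixture of cosines. *)
Let cvg_gauss (e : R) (x : R * R) : 0 < e ->
  cvgI (fun z => normal_pdf z.1 e x.1 * normal_pdf z.2 e x.2).
Proof.
move=> e0; have ei : 0 < e^-1 by rewrite invr_gt0.
pose nu := normal_law (0 : R) e^-1.
have bF : bmeas (fun w : (R * R) * (R * R) =>
    cos ((x.1 - w.2.1) * (w.1.1 - 0)) * cos ((x.2 - w.2.2) * (w.1.2 - 0))).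
  have m1 : measurable_fun setT (fun w : (R * R) * (R * R) => w.1.1).
    exact: (measurableT_comp measurable_fst measurable_fst).
  have m2 : measurable_fun setT (fun w : (R * R) * (R * R) => w.1.2).
    exact: (measurableT_comp measurable_snd measurable_fst).
  have m3 : measurable_fun setT (fun w : (R * R) * (R * R) => w.2.1).
    exact: (measurableT_comp measurable_fst measurable_snd).
  have m4 : measurable_fun setT (fun w : (R * R) * (R * R) => w.2.2).
    exact: (measurableT_comp measurable_snd measurable_snd).
  by apply: bmeasM; apply: bcos; apply: measurable_funM; apply: measurable_funB.
have := @cvgI_mix _ _ (product_prob nu nu) _ bF (fun t => @cvg_coscos x t).
have bc a : bmeas (fun y : R => cos (a * (y - 0))).
  by apply: bcos; apply: measurable_funM => //; exact: measurable_funB.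
under [X in cvgI X]eq_fun => z.
  rewrite (Rint_product_probM nu nu (bc (x.1 - z.1)) (bc (x.2 - z.2))).
  rewrite (Rint_normal_law _ _ (bc (x.1 - z.1))) (Rint_normal_law _ _ (bc (x.2 - z.2))).
  rewrite !normal_cos//.
  over.
set F := (X in cvgI X) => cF.
have bF' : bmeas F.
  have h (a : R) : measurable_fun setT (fun t : R => expR (- (e^-1 ^+ 2 * (a - t) ^+ 2 / 2))).
    apply: (measurableT_comp (@measurable_expR R)).
    apply: (measurableT_comp (@oppr_measurable R setT)).
    apply: measurable_funM => //; apply: measurable_funM => //.
    by apply: measurable_funX; exact: measurable_funB.
  have hb (a : R) : bmeas (fun t : R => expR (- (e^-1 ^+ 2 * (a - t) ^+ 2 / 2))).
    split => //; exists 1 => t; rewrite ger0_norm ?expR_ge0// -[leRHS]expR0 ler_expR.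
    by rewrite oppr_le0 divr_ge0// mulr_ge0// sqr_ge0.
  apply: bmeasM.
    exact: (bmeas_comp (hb x.1) measurable_fst).
  exact: (bmeas_comp (hb x.2) measurable_snd).
have := @cvgIZ (normal_peak e * normal_peak e) _ bF' cF.
apply: cvgI_ext => z; rewrite /F /normal_pdf gt_eqF// /normal_fun mulrACA.
by congr (_ * expR _ * (_ * expR _)); field; rewrite gt_eqF.
Qed.

Let kern (e x z : R) : R := expR (- (x - z) ^+ 2 / (2 * e ^+ 2)).

Let pdfE (e x z : R) : 0 < e -> normal_pdf z e x = normal_peak e * kern e x z.
Proof.
move=> e0; rewrite /normal_pdf gt_eqF// /normal_fun.
by congr (_ * expR _); rewrite mulr_natl.
Qed.

Let mkern (e : R) d (T : measurableType d) (f g : T -> R) :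
  measurable_fun setT f -> measurable_fun setT g ->
  measurable_fun setT (fun w => kern e (f w) (g w)).
Proof.
move=> mf mg; apply: (measurableT_comp (@measurable_expR R)).
apply: measurable_funM => //.
apply: (measurableT_comp (@oppr_measurable R setT)).
by apply: measurable_funX; exact: measurable_funB.
Qed.

Let kern_le1 e x z : `|kern e x z| <= 1.
Proof.
rewrite ger0_norm ?expR_ge0// -[leRHS]expR0 ler_expR mulNr oppr_le0.
by rewrite divr_ge0 ?sqr_ge0// mulr_ge0 ?sqr_ge0.
Qed.

Let bkern (e : R) d (T : measurableType d) (f g : T -> R) :
  measurable_fun setT f -> measurable_fun setT g ->
  bmeas (fun w => kern e (f w) (g w)).
Proof. by move=> mf mg; split; [exact: mkern|exists 1 => w; exact: kern_le1]. Qed.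

(* [Kg] is [g] convolved with a Gaussian.  As a function of [z] it is a mixture of
   products of normal densities, themselves mixtures of cosines; the mixing measure
   is made a probability by the weight [q], which is bounded on the support of [g]. *)
Lemma cvgI_smooth (e L : R) (g : R * R -> R) : 0 < e -> bmeas g ->
  (forall x, L < `|x.1| \/ L < `|x.2| -> g x = 0) ->
  let Kg z := \int[normal_law z.1 e]_x1 \int[normal_law z.2 e]_x2 g (x1, x2) in
  bmeas Kg /\ cvgI Kg.
Proof.
move=> e0 bg g0 Kg.
(* [q z] is the ratio of the normal density with centre [z] and deviation [e] to the standard one;
   [w] is its factor independent of [z]. *)
pose w (x : R) := normal_peak e / normal_peak 1 * expR (x ^+ 2 / 2).
pose q z x := w x * kern e x z.
have pk1 : normal_peak 1 != 0 :> R by rewrite gt_eqF// normal_peak_gt0.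
have qE z x : q z x * normal_pdf 0 1 x = normal_pdf z e x.
  rewrite !pdfE// /q /w /kern.
  have -> : - (x - 0) ^+ 2 / (2 * 1 ^+ 2) = - (x ^+ 2 / 2) by field.
  rewrite expRN; set a := expR (_ / _ : R); set b := expR _.
  by field; rewrite pk1 gt_eqF// expR_gt0.
have mw : measurable_fun setT w.
  apply: measurable_funM => //; apply: (measurableT_comp (@measurable_expR R)).
  by apply: measurable_funM => //; exact: measurable_funX.
have mq z : measurable_fun setT (q z).
  by apply: measurable_funM => //; exact: mkern.
have [M gM] := bg.2.
have c0 : 0 <= normal_peak e / normal_peak 1.
  by apply: divr_ge0; exact: normal_peak_ge0.
have w0 x : 0 <= w x by rewrite /w mulr_ge0 ?expR_ge0.
pose B := w L.
have wB x : `|x| <= L -> w x <= B.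
  move=> xL; rewrite /B /w; apply: ler_wpM2l => //; rewrite ler_expR.
  rewrite ler_pM2r ?invr_gt0// -(real_normK (num_real x)).
  by have := normr_ge0 x; nra.
have gwwM (x : R * R) : `|g x * (w x.1 * w x.2)| <= M * (B * B).
  have M0 : 0 <= M by exact: le_trans (gM x).
  have BB : 0 <= B * B := mulr_ge0 (w0 _) (w0 _).
  have [h1|h1] := ltP L `|x.1|; first by rewrite (g0 x (or_introl h1)) mul0r normr0 mulr_ge0.
  have [h2|h2] := ltP L `|x.2|; first by rewrite (g0 x (or_intror h2)) mul0r normr0 mulr_ge0.
  rewrite normrM; apply: ler_pM => //; rewrite (ger0_norm (mulr_ge0 (w0 _) (w0 _))).
  by apply: ler_pM; rewrite ?w0// wB.
have mg := bg.1.
have m1 : measurable_fun setT (fun y : (R * R) * (R * R) => y.1.1).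
  exact: (measurableT_comp measurable_fst measurable_fst).
have m2 : measurable_fun setT (fun y : (R * R) * (R * R) => y.1.2).
  exact: (measurableT_comp measurable_snd measurable_fst).
have m3 : measurable_fun setT (fun y : (R * R) * (R * R) => y.2.1).
  exact: (measurableT_comp measurable_fst measurable_snd).
have m4 : measurable_fun setT (fun y : (R * R) * (R * R) => y.2.2).
  exact: (measurableT_comp measurable_snd measurable_snd).
pose F (y : (R * R) * (R * R)) := (g y.1 * (w y.1.1 * w y.1.2)) *
   (kern e y.1.1 y.2.1 * kern e y.1.2 y.2.2).
have bgww : bmeas (fun x => g x * (w x.1 * w x.2)).
  split; last by exists (M * (B * B)) => y; exact: gwwM.
  apply: measurable_funM => //; apply: measurable_funM.
    exact: (measurableT_comp mw measurable_fst).
  exact: (measurableT_comp mw measurable_snd).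
have bF : bmeas F.
  apply: bmeasM; first exact: (bmeas_comp bgww measurable_fst).
  exact: (bmeasM (bkern e m1 m3) (bkern e m2 m4)).
have cF x : cvgI (fun z => F (x, z)).
  have bp : bmeas (fun z : R * R => normal_pdf z.1 e x.1 * normal_pdf z.2 e x.2).
    under eq_fun do rewrite !pdfE//.
    have k1 := bkern e (measurable_cst x.1) (@measurable_fst _ _ R R).
    have k2 := bkern e (measurable_cst x.2) (@measurable_snd _ _ R R).
    have kc d (T : measurableType d) : bmeas (fun=> normal_peak e : R) := @bmeas_cst R d T _.
    exact: (bmeasM (bmeasM (kc _ _) k1) (bmeasM (kc _ _) k2)).
  have := @cvgIZ (g x * (w x.1 * w x.2) / (normal_peak e * normal_peak e)) _ bp
    (@cvg_gauss e x e0).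
  apply: cvgI_ext => z; rewrite !pdfE// /F/=.
  by field; rewrite gt_eqF// normal_peak_gt0// gt_eqF.
pose nu := normal_law (0 : R) 1.
suff KgE : (fun z => \int[product_prob nu nu]_y F (y, z)) = Kg.
  rewrite -KgE; split; first exact: (bmeas_Rint2 (product_prob nu nu) mu0 bF).
  exact: (@cvgI_mix _ _ (product_prob nu nu) F bF cF).
apply/funext => z; rewrite /Kg.
have bFz : bmeas (fun y => F (y, z)) by exact: (bmeas_pair2 bF).
rewrite (Rint_product_prob nu nu bFz).
have bg1 x1 : bmeas (fun x2 => g (x1, x2)) by exact: (bmeas_pair1 bg).
pose h (x1 : R) := \int[normal_law z.2 e]_x2 g (x1, x2).
have bh : bmeas h by exact: (bmeas_Rint1 (normal_law 0 1) (normal_law z.2 e) bg).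
rewrite -(@Rint_normal_tilt _ 0 1 z.1 e h (q z.1) bh (mq _) (qE _)).
apply: eq_Rintegral => x1 _.
rewrite /h -(@Rint_normal_tilt _ 0 1 z.2 e _ (q z.2) (bg1 x1) (mq _) (qE _)).
have bgq : bmeas (fun x2 => g (x1, x2) * q z.2 x2).
  split; first by apply: measurable_funM => //; case: (bg1 x1).
  exists (M * B) => x2.
  have M0 : 0 <= M by exact: le_trans (gM (x1, x2)).
  have [h2|h2] := ltP L `|x2|; first by rewrite (g0 (x1, x2) (or_intror h2)) mul0r normr0 (mulr_ge0 M0 (w0 _)).
  rewrite normrM; apply: ler_pM => //; rewrite /q normrM -[leRHS]mulr1.
  by apply: ler_pM => //; rewrite ger0_norm ?w0// wB.
rewrite -(@RintZr _ _ _ (normal_law 0 1) (q z.1 x1) _ bgq); apply: eq_Rintegral => x2 _.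
by rewrite /F /q /=; ring.
Qed.

End levy.

(** * Lipschitz test functions and tightness *)

Section levy_continuity.
Context {R : realType}.
Variables (mu : nat -> probability (R * R)%type R) (mu0 : probability (R * R)%type R).
Notation cvgI := (cvgI mu mu0).
Hypothesis cvg_cos : forall u v, cvgI (fun z => cos (u * z.1 + v * z.2)).
Hypothesis cvg_sin : forall u v, cvgI (fun z => sin (u * z.1 + v * z.2)).

Definition l1lip (K : R) (g : R * R -> R) := forall x y, `|g x - g y| <= K * l1dist x y.

(** A Lipschitz function is uniformly close to its Gaussian smoothing. Each coordinate costs at most
    [K' * r], whence [r = e / (2 K')]. *)
Let cvgI_lip_supp (K L : R) (g : R * R -> R) : bmeas g -> l1lip K g ->
  (forall x, L < `|x.1| \/ L < `|x.2| -> g x = 0) -> cvgI g.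
Proof.
move=> bg lip g0; apply: cvgI_unif => // e e0.
pose K' := `|K| + 1.
have K'0 : 0 < K' by rewrite ltr_wpDl.
pose r := e / (2 * K').
have r0 : 0 < r by rewrite divr_gt0// mulr_gt0.
have lip' x y : `|g x - g y| <= K' * l1dist x y.
  apply: (le_trans (lip x y)); apply: ler_wpM2r; first exact: l1dist_ge0.
  by rewrite (le_trans (ler_norm K))// lerDl.
have bg1 x1 : bmeas (fun x2 => g (x1, x2)) by exact: (bmeas_pair1 bg).
have bg2 x2 : bmeas (fun x1 => g (x1, x2)) by exact: (bmeas_pair2 bg).
have cs := cvgI_smooth cvg_cos cvg_sin r0 bg g0.
exists (fun z => \int[normal_law z.1 r]_x1 \int[normal_law z.2 r]_x2 g (x1, x2)).
have close z : `|\int[normal_law z.1 r]_x1 \int[normal_law z.2 r]_x2 g (x1, x2) - g z| <= e.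
  have bh : bmeas (fun x1 => \int[normal_law z.2 r]_x2 g (x1, x2)).
    exact: (bmeas_Rint1 (normal_law z.1 r) (normal_law z.2 r) bg).
  have h1 x1 : `|\int[normal_law z.2 r]_x2 g (x1, x2) - g (x1, z.2)| <= K' * r.
    apply: (@Rint_normal_lip _ _ _ _ (fun x2 => g (x1, x2))) => // x.
    by have := lip' (x1, x) (x1, z.2); rewrite /l1dist/= subrr normr0 add0r.
  have h2 : `|\int[normal_law z.1 r]_x1 g (x1, z.2) - g z| <= K' * r.
    have -> : g z = g (z.1, z.2) by case: (z).
    apply: (@Rint_normal_lip _ _ _ _ (fun x1 => g (x1, z.2))) => // x.
    by have := lip' (x, z.2) (z.1, z.2); rewrite /l1dist/= subrr normr0 addr0.
  have h3 : `|\int[normal_law z.1 r]_x1 \int[normal_law z.2 r]_x2 g (x1, x2) -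
      \int[normal_law z.1 r]_x1 g (x1, z.2)| <= K' * r.
    rewrite -(RintB (normal_law z.1 r) bh (bg2 z.2)).
    by apply: Rint_norm_le => //; exact: bmeasB.
  have -> : e = K' * r + K' * r by rewrite /r; field; rewrite gt_eqF.
  by apply: (le_trans (ler_distD (\int[normal_law z.1 r]_x1 g (x1, z.2)) _ _)); rewrite lerD.
by case: cs.
Qed.

(* A Lipschitz cut-off; its integrals give the tightness needed for non-compact supports. *)
Let chi (L : R) (z : R * R) : R := Num.max 0 (Num.min 1 (L + 1 - (`|z.1| + `|z.2|))).

Let chi_ge0 L z : 0 <= chi L z. Proof. by rewrite /chi le_max lexx. Qed.

Let chi_le1 L z : chi L z <= 1.
Proof. by rewrite /chi ge_max ler01/= ge_min lexx. Qed.

Let chi_norm L z : `|chi L z| <= 1.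
Proof. by rewrite ger0_norm ?chi_le1. Qed.

Let chi_supp L z : L + 1 < `|z.1| \/ L + 1 < `|z.2| -> chi L z = 0.
Proof.
move=> h; apply/max_idPl; rewrite ge_min; apply/orP; right.
by have := normr_ge0 z.1; have := normr_ge0 z.2; case: h; lra.
Qed.

Let clamp_lip (a b : R) :
  `|Num.max 0 (Num.min 1 a) - Num.max 0 (Num.min 1 b)| <= `|a - b|.
Proof.
wlog ab : a b / a <= b => [h|].
  have [/h//|/ltW/h] := leP a b.
  by rewrite (distrC b) (distrC (Num.max _ _)).
rewrite [leRHS]ler0_norm ?subr_le0// opprB.
have m1 : Num.min 1 a <= Num.min 1 b by rewrite le_min !ge_min lexx ab orbT.
have m2 : Num.min 1 b - Num.min 1 a <= b - a.
  rewrite lerBlDr addrC -lerBlDr.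
  by rewrite /Num.min; do 2 case: ifPn; rewrite -?leNgt => *; lra.
rewrite ler0_norm ?opprB; last first.
  by rewrite subr_le0 ge_max !le_max lexx/= m1 orbT.
apply: le_trans m2; move: (Num.min 1 a) (Num.min 1 b) m1 => c c' cc'.
by rewrite /Num.max; do 2 case: ifPn; rewrite -?leNgt => *; lra.
Qed.

Let chi_lip L : l1lip 1 (chi L).
Proof.
move=> x y; rewrite mul1r /l1dist.
rewrite (le_trans (clamp_lip _ _))//.
have -> : L + 1 - (`|x.1| + `|x.2|) - (L + 1 - (`|y.1| + `|y.2|)) =
  (`|y.1| - `|x.1|) + (`|y.2| - `|x.2|) by ring.
rewrite (le_trans (ler_normD _ _))// lerD// distrC; exact: ler_dist_dist.
Qed.

Let bchi L : bmeas (chi L).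
Proof.
split; first exact: (l1lip_measurable (chi_lip L)).
by exists 1 => z; exact: chi_norm.
Qed.

Let chi_cvg (P : probability (R * R)%type R) :
  \int[P]_z chi n%:R z @[n --> \oo] --> (1 : R).
Proof.
rewrite -[X in _ --> X](@Rint_cst _ _ _ P 1).
apply: (@Rint_bounded_cvg _ _ _ _ _ _ 1) => //.
- by move=> n; case: (bchi n%:R).
- move=> z; apply: cvg_near_cst; near=> n.
  have : `|z.1| + `|z.2| <= n%:R by near: n; exact: nbhs_infty_ger.
  move=> h; rewrite /chi min_l; last lra.
  by rewrite max_r.
Unshelve. all: end_near. Qed.

(** Replacing [g] by [g * chi L] costs at most [M (1 - E chi L)] under any law. Since [chi L] is
    itself a test function with convergent integrals, a cut-off that suits [mu0] also suits [mu l]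
    for large [l]. *)
Lemma cvgI_lip (K : R) (g : R * R -> R) : bmeas g -> l1lip K g -> cvgI g.
Proof.
move=> bg lip; have [M gM] := bg.2.
have M0 : 0 <= M by exact: le_trans (gM (0, 0)).
apply/cvgrPdist_le => e e0.
(* The cut-off costs at most [M e' <= e / 4] under [mu0] and [2 M e' <= e / 2] under [mu l]; the
   last [e / 4] is for the convergence of the truncated integrals. *)
pose e' := e / (4 * (M + 1)).
have M1 : 0 < M + 1 by rewrite ltr_wpDl.
have e'0 : 0 < e' by rewrite divr_gt0// mulr_gt0.
have [L hL] : exists L, 1 - \int[mu0]_z chi L z <= e'.
  have /cvgrPdist_le/(_ _ e'0)[n _ /(_ n (leqnn n)) h] := chi_cvg mu0.
  by exists n%:R; exact: le_trans (ler_norm _) h.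
have c1 : cvgI (chi L).
  by apply: (@cvgI_lip_supp 1 (L + 1)) => //; exact: chi_supp.
have bgc : bmeas (fun z => g z * chi L z) by exact: bmeasM.
have c2 : cvgI (fun z => g z * chi L z).
  apply: (@cvgI_lip_supp (`|K| + M) (L + 1)) => //; last first.
    by move=> x /chi_supp ->; rewrite mulr0.
  move=> x y.
  have -> : g x * chi L x - g y * chi L y =
    (g x - g y) * chi L x + g y * (chi L x - chi L y) by ring.
  rewrite (le_trans (ler_normD _ _))//.
  have -> : (`|K| + M) * l1dist x y = `|K| * l1dist x y + M * l1dist x y by ring.
  rewrite lerD// normrM.
    rewrite -[leRHS]mulr1 ler_pM// (le_trans (lip x y))// ler_wpM2r ?l1dist_ge0//.
    exact: ler_norm.
  by rewrite ler_pM//; have := @chi_lip L x y; rewrite mul1r.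
have near_g (P : probability (R * R)%type R) :
    `|\int[P]_z g z - \int[P]_z (g z * chi L z)| <= M * (1 - \int[P]_z chi L z).
  have -> : 1 - \int[P]_z chi L z = \int[P]_z (1 - chi L z).
    by rewrite (RintB P (bmeas_cst 1) (bchi L)) Rint_cst.
  rewrite -(RintB P bg bgc).
  have b1 : bmeas (fun z => 1 - chi L z) by apply: bmeasB => //; exact: bmeas_cst.
  have b2 : bmeas (fun z => g z - g z * chi L z) by exact: bmeasB.
  rewrite -(RintZl P M b1); apply: (le_trans (le_normr_Rintegral measurableT _)).
    exact: (bmeas_integrable P b2).
  apply: le_Rint; first exact: bmeas_norm.
    by apply: bmeasM => //; exact: bmeas_cst.
  move=> z; have -> : g z - g z * chi L z = g z * (1 - chi L z) by ring.
  by rewrite normrM ler_pM// ger0_norm// subr_ge0.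
have Me : M * e' <= e / 4.
  have -> : e / 4 = (M + 1) * e' by rewrite /e'; field; rewrite gt_eqF.
  by rewrite ler_pM2r// lerDl.
have /cvgrPdist_le/(_ _ e'0) n1 := c1.
have e4 : 0 < e / 4 by rewrite divr_gt0.
have /cvgrPdist_le/(_ _ e4) n2 := c2.
near=> l.
have h1 : `|\int[mu0]_z chi L z - \int[mu l]_z chi L z| <= e' by near: l.
have h2 : `|\int[mu0]_z (g z * chi L z) - \int[mu l]_z (g z * chi L z)| <= e / 4 by near: l.
have h3 := near_g mu0; have h4 := near_g (mu l).
move: h1 hL => /ler_normlP[_].
move: h3 h4 h2; rewrite !ler_norml => /andP[? ?] /andP[? ?] /andP[? ?] hc hL.
have hM : M * (1 - \int[mu0]_z chi L z) <= e / 4.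
  by rewrite (le_trans _ Me)// ler_wpM2l.
have hM' : M * (1 - \int[mu l]_z chi L z) <= e / 2.
  have : M * (1 - \int[mu l]_z chi L z) <= M * (e' + e') by rewrite ler_wpM2l//; lra.
  lra.
by apply/andP; split; lra.
Unshelve. all: end_near. Qed.

End levy_continuity.

(** * The continuity theorem through lower semicontinuous functions *)

Section levy_continuity_theorem.
Context {R : realType}.
Variables (mu : nat -> probability (R * R)%type R) (mu0 : probability (R * R)%type R).
Notation cvgI := (cvgI mu mu0).
Hypothesis cvg_cos : forall u v, cvgI (fun z => cos (u * z.1 + v * z.2)).
Hypothesis cvg_sin : forall u v, cvgI (fun z => sin (u * z.1 + v * z.2)).

Section lower_semicontinuous.
Variables (h : R * R -> R) (M : R).
Hypothesis hM : forall x, `|h x| <= M.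
Hypothesis lsc : forall x e, 0 < e ->
  exists2 r, 0 < r & forall y, l1dist x y < r -> h x - e < h y.

(* [f k], the inf-convolution of [h] with [k] times the distance, is [k]-Lipschitz
   and increases to [h]. *)
Let vals (k : nat) (x : R * R) : set R := [set h y + k%:R * l1dist x y | y in setT].
Let f (k : nat) (x : R * R) : R := inf (vals k x).

Let vals_lb k x : lbound (vals k x) (- M).
Proof.
move=> _ [y _ <-]; have := hM y; rewrite ler_norml => /andP[? _].
by rewrite ler_wpDr// mulr_ge0// l1dist_ge0.
Qed.

Let vals_has_lb k x : has_lbound (vals k x).
Proof. by exists (- M); exact: vals_lb. Qed.

Let vals0 k x : vals k x !=set0.
Proof. by exists (h x + k%:R * l1dist x x), x. Qed.

Let f_le k x y : f k x <= h y + k%:R * l1dist x y.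
Proof. by apply: ge_inf => //; exists y. Qed.

Let f_le_h k x : f k x <= h x.
Proof. by have := f_le k x x; rewrite l1distxx mulr0 addr0. Qed.

Let f_norm k x : `|f k x| <= M.
Proof.
rewrite ler_norml; apply/andP; split; first exact: (lb_le_inf (vals0 k x) (@vals_lb k x)).
by rewrite (le_trans (f_le_h k x))// (le_trans (ler_norm _)).
Qed.

Let f_lip k : l1lip k%:R (f k).
Proof.
suff half x y : f k x - f k y <= k%:R * l1dist x y.
  by move=> x y; rewrite ler_norml lerNl opprB half andbT l1distC half.
rewrite lerBlDl -lerBlDr; apply: lb_le_inf; [exact: vals0|move=> _ [z _ <-]].
rewrite lerBlDr (le_trans (f_le k x z))// -addrA lerD2l -mulrDr ler_wpM2l//.
by rewrite addrC; exact: l1dist_tri.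
Qed.

Let f_cvg x : f k x @[k --> \oo] --> h x.
Proof.
apply/cvgrPdist_le => e e0; have [r r0 hr] := lsc x e0.
near=> k.
(* Outside the ball of radius [r] the penalty exceeds the oscillation [2 M] of [h], so points there
   cannot lower the infimum below [h x]. *)
have kr : M + M <= k%:R * r.
  by rewrite -ler_pdivrMr//; near: k; exact: nbhs_infty_ger.
rewrite ger0_norm ?subr_ge0// lerBlDr addrC -lerBlDr.
apply: lb_le_inf; [exact: vals0|move=> _ [y _ <-]].
have k0 : 0 <= k%:R :> R by [].
have := hM x; have := hM y; rewrite !ler_norml => /andP[? ?] /andP[? ?].
have [xy|xy] := ltP (l1dist x y) r.
  have := hr y xy; have := mulr_ge0 k0 (l1dist_ge0 x y); lra.
have : k%:R * r <= k%:R * l1dist x y by rewrite ler_wpM2l.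
lra.
Unshelve. all: end_near. Qed.

(** The portmanteau inequality. Some Lipschitz minorant [f k] has an integral within [e / 2] of that
    of [h] under [mu0]; its integrals converge, and under [mu l] they stay below those of [h]. *)
Lemma liminf_lsc e : 0 < e ->
  \forall l \near \oo, \int[mu0]_z h z - e <= \int[mu l]_z h z.
Proof.
move=> e0; have mh := l1lsc_measurable lsc.
have bh : bmeas h by split => //; exists M.
have bf k : bmeas (f k).
  by split; [exact: (l1lip_measurable (f_lip k))|exists M => x; exact: f_norm].
have cf : \int[mu0]_z f k z @[k --> \oo] --> \int[mu0]_z h z.
  by apply: (@Rint_bounded_cvg _ _ _ _ _ _ M) => // k; case: (bf k).
have e2 : 0 < e / 2 by rewrite divr_gt0.
have [k hk] : exists k, \int[mu0]_z h z - \int[mu0]_z f k z <= e / 2.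
  have /cvgrPdist_le/(_ _ e2)[n _ /(_ n (leqnn n)) hn] := cf.
  by exists n; exact: le_trans (ler_norm _) hn.
have /cvgrPdist_le/(_ _ e2) := cvgI_lip cvg_cos cvg_sin (bf k) (f_lip k).
apply: filterS => l hl.
have := le_Rint (mu l) (bf k) bh (f_le_h k).
have := le_trans (ler_norm _) hl; lra.
Qed.

End lower_semicontinuous.

(** A continuous function is lower semicontinuous together with its opposite, so the one-sided
    inequality applies twice. *)
Lemma levy_continuity (h : R * R -> R) (M : R) : (forall x, `|h x| <= M) ->
  (forall x e, 0 < e -> exists2 r, 0 < r & forall y, l1dist x y < r -> `|h x - h y| < e) ->
  cvgI h.
Proof.
move=> hM ch.
have l1 x e : 0 < e -> exists2 r, 0 < r & forall y, l1dist x y < r -> h x - e < h y.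
  move=> /(ch x)[r r0 hr]; exists r => // y /hr; rewrite ltr_norml => /andP[? ?]; lra.
have l2 x e : 0 < e -> exists2 r, 0 < r & forall y, l1dist x y < r -> - h x - e < - h y.
  move=> /(ch x)[r r0 hr]; exists r => // y /hr; rewrite ltr_norml => /andP[? ?]; lra.
have bh : bmeas h by split; [exact: l1lsc_measurable|exists M].
have intN (P : probability (R * R)%type R) : \int[P]_z (- h z) = - \int[P]_z h z.
  rewrite -mulN1r -(RintZl P (-1) bh); apply: eq_Rintegral => z _.
  by rewrite mulN1r.
apply/cvgrPdist_le => e e0; near=> l.
have h1 : \int[mu0]_z h z - e <= \int[mu l]_z h z.
  by near: l; exact: (liminf_lsc hM l1).
have h2 : \int[mu0]_z - h z - e <= \int[mu l]_z - h z.
  by near: l; apply: (@liminf_lsc (fun z => - h z) M) => // x; rewrite normrN.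
rewrite !intN in h2.
by rewrite ler_norml; apply/andP; split; lra.
Unshelve. all: end_near. Qed.

End levy_continuity_theorem.

Section uniqueness.
Context {R : realType}.

(* Uniqueness is the continuity theorem for a constant sequence, tested on the
   lower semicontinuous indicator of an open set. *)
Lemma charfun_le_open (P Q : probability (R * R)%type R) :
  (forall u v, \int[P]_z cos (u * z.1 + v * z.2) = \int[Q]_z cos (u * z.1 + v * z.2)) ->
  (forall u v, \int[P]_z sin (u * z.1 + v * z.2) = \int[Q]_z sin (u * z.1 + v * z.2)) ->
  forall U : set (R * R),
  (forall x, U x -> exists2 e, 0 < e & forall y, l1dist x y < e -> U y) ->
  (Q U <= P U)%E.
Proof.
move=> hc hs U oU.
have mU := l1open_measurable oU.
have bI : bmeas (\1_U : R * R -> R).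
  split; first exact: measurable_indic.
  by exists 1 => x; rewrite indicE; case: (_ \in _); rewrite /= ?normr1 ?normr0.
have IE (S : probability (R * R)%type R) : S U = (\int[S]_z (\1_U z : R))%:E.
  by rewrite -EFin_Rint// integral_indic// setIT.
rewrite !IE lee_fin; apply/ler_addgt0Pr => e e0.
have lsc x r : 0 < r -> exists2 s, 0 < s & forall y, l1dist x y < s ->
    (\1_U x : R) - r < \1_U y.
  move=> r0; have [xU|xU] := boolP (x \in U).
    have [s s0 hs'] := oU x (set_mem xU); exists s => // y /hs' yU.
    by rewrite !indicE xU (mem_set yU); lra.
  exists 1 => // y _; rewrite !indicE (negbTE xU).
  by case: (y \in U) => /=; lra.
have c1 u v : cvgI (fun=> P) Q (fun z => cos (u * z.1 + v * z.2)).
  by rewrite /cvgI -hc; exact: cvg_cst.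
have c2 u v : cvgI (fun=> P) Q (fun z => sin (u * z.1 + v * z.2)).
  by rewrite /cvgI -hs; exact: cvg_cst.
have I1 x : `|(\1_U x : R)| <= 1.
  by rewrite indicE; case: (_ \in _); rewrite /= ?normr1 ?normr0.
have [n _ /(_ n (leqnn n)) /=] := @liminf_lsc R (fun=> P) Q c1 c2 (\1_U) 1 I1 lsc e e0.
lra.
Qed.

End uniqueness.

(** * Topology and Borel sets of the complex plane *)

Section complex_plane.
Context {R : realType}.
Implicit Types z w : R[i].

Lemma ltc_normE z (e : R) : (`|z| < e%:C) = (Normc.normc z < e).
Proof. by rewrite ltcR. Qed.

Lemma normc_le_l1 z : Normc.normc z <= `|complex.Re z| + `|complex.Im z|.
Proof.
case: z => a b /=.
have s0 : 0 <= `|a| + `|b| by exact: addr_ge0.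
rewrite -[leRHS](ger0_norm s0) -sqrtr_sqr; apply: ler_wsqrtr.
by rewrite sqrrD !real_normK ?num_real// addrAC lerDl mulrn_wge0// mulr_ge0.
Qed.

Lemma Re_le_normc z : `|complex.Re z| <= Normc.normc z.
Proof. by have := normc_ge_Re z; rewrite lecR. Qed.

Lemma Im_le_normc z : `|complex.Im z| <= Normc.normc z.
Proof.
by case: z => a b /=; rewrite -sqrtr_sqr ler_wsqrtr// lerDr sqr_ge0.
Qed.

Lemma nbhs_complexP z (U : set R[i]) : nbhs z U <->
  exists2 e : R, 0 < e & forall w, l1dist (complex.Re z, complex.Im z) (complex.Re w, complex.Im w) < e -> U w.
Proof.
split.
  move=> /nbhs_normP[e /= e0 eU].
  (* The radius is an element of [R[i]]; being positive for the order of [R[i]], it is a positive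
     real number. *)
  have /andP[/eqP ie re] : (complex.Im e == 0) && (0 < complex.Re e).
    by move: e0; rewrite ltcE /= => /andP[/eqP -> ->]; rewrite eqxx.
  exists (complex.Re e) => // w wz; apply: eU => /=.
  have -> : e = (complex.Re e)%:C by case: (e) ie => a b /= ->.
  rewrite ltc_normE; apply: le_lt_trans (normc_le_l1 _) _.
  by move: wz; rewrite /l1dist/= raddfB raddfB.
(* Each of the two coordinates is bounded by the modulus, so the l1 distance is at most twice the
   modulus. *)
move=> [e e0 eU]; apply/nbhs_normP; exists (e / 2)%:C.
  by rewrite /= ltcR divr_gt0.
move=> w /=; rewrite ltc_normE => h; apply: eU; rewrite /l1dist/=.
have h1 := le_lt_trans (Re_le_normc _) h.
have h2 := le_lt_trans (Im_le_normc _) h.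
move: h1 h2; rewrite raddfB raddfB /=; lra.
Qed.

Lemma open_complexP (U : set R[i]) : open U <-> forall z, U z ->
  exists2 e : R, 0 < e & forall w, l1dist (complex.Re z, complex.Im z) (complex.Re w, complex.Im w) < e -> U w.
Proof. by rewrite openE; split => oU z /oU /nbhs_complexP. Qed.

Definition pair_complex (x : R * R) : R[i] := x.1 +i* x.2.
Definition complex_pair z : R * R := (complex.Re z, complex.Im z).

Lemma complex_pairK : cancel complex_pair pair_complex.
Proof. by case. Qed.

Lemma open_measurable_complex (U : set R[i]) : open U -> measurable U.
Proof. exact: sub_sigma_algebra. Qed.

Lemma measurable_Re : measurable_fun setT (@complex.Re R).
Proof.
apply: (measurability _ (RGenOInfty.measurableE R)) => _ [_ [a ->] <-].
rewrite setTI; apply: open_measurable_complex; apply/open_complexP => z /=.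
rewrite in_itv/= andbT => az.
exists (complex.Re z - a); first by rewrite subr_gt0.
move=> w; rewrite in_itv/= andbT /l1dist/= => h.
have := normr_ge0 (complex.Im z - complex.Im w).
have := ler_norm (complex.Re z - complex.Re w); lra.
Qed.

Lemma measurable_Im : measurable_fun setT (@complex.Im R).
Proof.
apply: (measurability _ (RGenOInfty.measurableE R)) => _ [_ [a ->] <-].
rewrite setTI; apply: open_measurable_complex; apply/open_complexP => z /=.
rewrite in_itv/= andbT => az.
exists (complex.Im z - a); first by rewrite subr_gt0.
move=> w; rewrite in_itv/= andbT /l1dist/= => h.
have := normr_ge0 (complex.Re z - complex.Re w).
have := ler_norm (complex.Im z - complex.Im w); lra.
Qed.

Lemma measurable_complex_pair : measurable_fun setT complex_pair.
Proof. exact: (measurable_fun_pair measurable_Re measurable_Im). Qed.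

Lemma measurable_pair_complex : measurable_fun setT pair_complex.
Proof.
apply: (@measurability _ _ _ _ _ _ (@open R[i])) => // _ [U oU <-].
rewrite setTI; apply: l1open_measurable => x /= /((open_complexP U).1 oU)[e e0 eU].
by exists e => // y; exact: (eU (pair_complex y)).
Qed.

Lemma measurable_complexP d (T : measurableType d) (Z : T -> R[i]) :
  measurable_fun setT (fun t => complex.Re (Z t)) ->
  measurable_fun setT (fun t => complex.Im (Z t)) -> measurable_fun setT Z.
Proof.
move=> mR mI; have h := measurableT_comp measurable_pair_complex (measurable_fun_pair mR mI).
apply: (eq_measurable_fun _ _ h) => t _ /=.
by rewrite /pair_complex/=; case: (Z t).
Qed.

Lemma measurable_set1_complex z : measurable [set z].
Proof.
have -> : [set z] = (@complex.Re R @^-1` [set complex.Re z]) `&` (@complex.Im R @^-1` [set complex.Im z]).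
  apply/seteqP; split => [w -> //|[a b] [/= -> ->]].
  by case: (z).
apply: measurableI.
  by rewrite -[X in measurable X]setTI; apply: measurable_Re.
by rewrite -[X in measurable X]setTI; apply: measurable_Im.
Qed.

End complex_plane.

(** * Laws and characteristic functions of complex variables *)

Section laws_of_complex_variables.
Context {R : realType}.

Lemma RintE d (T : measurableType d) (P : probability T R) (f : T -> R) : bmeas f ->
  ('E_P[f])%E = (\int[P]_x f x)%:E.
Proof. by move=> bf; rewrite unlock -EFin_Rint. Qed.

Section law.
Variables (d : measure_display) (T : measurableType d) (P : probability T R).
Variable Z : T -> R[i].
Hypothesis mZ : measurable_fun setT Z.

Let mX : measurable_fun setT (complex_pair \o Z) := measurableT_comp measurable_complex_pair mZ.
Let X : {RV P >-> (R * R)%type} := HB.pack (complex_pair \o Z) (isMeasurableFun.Build _ _ _ _ _ mX).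

Definition plane_law : probability (R * R)%type R := distribution P X.

Lemma plane_lawE A : plane_law A = P ((complex_pair \o Z) @^-1` A).
Proof. by []. Qed.

Lemma Rint_plane_law (f : R * R -> R) : bmeas f ->
  \int[plane_law]_x f x = \int[P]_t f (complex_pair (Z t)).
Proof.
move=> bf; have bfX : bmeas (f \o X) by exact: (bmeas_comp bf).
rewrite /Rintegral integral_distribution//.
  by apply/measurable_EFinP; case: bf.
exact: (bmeas_integrable P bfX).
Qed.

End law.

Definition re_charfun d (T : measurableType d) (P : probability T R) (Z : T -> R[i]) (u v : R) : R :=
  \int[P]_t cos (u * complex.Re (Z t) + v * complex.Im (Z t)).

Definition im_charfun d (T : measurableType d) (P : probability T R) (Z : T -> R[i]) (u v : R) : R :=
  \int[P]_t sin (u * complex.Re (Z t) + v * complex.Im (Z t)).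

Lemma bmeas_cos d (T : measurableType d) (f : T -> R) : measurable_fun setT f ->
  bmeas (fun x => cos (f x)).
Proof.
move=> mf; split.
  by apply: (measurableT_comp _ mf); apply: continuous_measurable_fun; exact: continuous_cos.
by exists 1 => x; rewrite ler_norml cos_geN1 cos_le1.
Qed.

Lemma bmeas_sin d (T : measurableType d) (f : T -> R) : measurable_fun setT f ->
  bmeas (fun x => sin (f x)).
Proof.
move=> mf; split.
  by apply: (measurableT_comp _ mf); apply: continuous_measurable_fun; exact: continuous_sin.
by exists 1 => x; rewrite ler_norml sin_geN1 sin_le1.
Qed.

Lemma measurable_linear_form d (T : measurableType d) (f g : T -> R) (u v : R) :
  measurable_fun setT f -> measurable_fun setT g ->
  measurable_fun setT (fun t => u * f t + v * g t).
Proof. by move=> mf mg; apply: measurable_funD; apply: measurable_funM. Qed.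

Let mlin (u v : R) : measurable_fun setT (fun z : R * R => u * z.1 + v * z.2).
Proof. exact: measurable_linear_form. Qed.

Lemma re_charfunE d (T : measurableType d) (P : probability T R) (Z : T -> R[i])
    (mZ : measurable_fun setT Z) u v :
  re_charfun P Z u v = \int[plane_law P mZ]_z cos (u * z.1 + v * z.2).
Proof.
by rewrite (Rint_plane_law P mZ (bmeas_cos (mlin u v))).
Qed.

Lemma im_charfunE d (T : measurableType d) (P : probability T R) (Z : T -> R[i])
    (mZ : measurable_fun setT Z) u v :
  im_charfun P Z u v = \int[plane_law P mZ]_z sin (u * z.1 + v * z.2).
Proof.
by rewrite (Rint_plane_law P mZ (bmeas_sin (mlin u v))).
Qed.

(** Passing to the laws on the plane removes the dependence of the sample space on [l], after which
    the continuity theorem applies. *)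
Lemma cvg_in_distribution_charfun (d : nat -> measure_display)
    (T : forall l, measurableType (d l)) (P : forall l, probability (T l) R)
    (Z : forall l, T l -> R[i])
    d' (T' : measurableType d') (Q : probability T' R) (W : T' -> R[i]) :
  (forall l, measurable_fun setT (Z l)) -> measurable_fun setT W ->
  (forall u v, re_charfun (P l) (Z l) u v @[l --> \oo] --> re_charfun Q W u v) ->
  (forall u v, im_charfun (P l) (Z l) u v @[l --> \oo] --> im_charfun Q W u v) ->
  cvg_in_distribution P Z Q W.
Proof.
move=> mZ mW hc hs; split => // f cf [M fM].
pose mu l := plane_law (P l) (mZ l).
pose mu0 := plane_law Q mW.
pose h (x : R * R) := f (pair_complex x).
have ch x e : 0 < e -> exists2 r, 0 < r & forall y, l1dist x y < r -> `|h x - h y| < e.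
  move=> e0; have /cvgrPdist_lt/(_ _ e0)/nbhs_complexP[r r0 hr] := cf (pair_complex x).
  by exists r => // y xy; apply: hr => /=; case: x y xy => [x1 x2] [y1 y2].
have hM x : `|h x| <= M by exact: fM.
have bh : bmeas h.
  split; last by exists M.
  apply: l1lsc_measurable => x e /(ch x)[r r0 hr]; exists r => // y /hr.
  by rewrite ltr_norml => /andP[? ?]; lra.
have c1 u v : cvgI mu mu0 (fun z => cos (u * z.1 + v * z.2)).
  rewrite /cvgI -re_charfunE; under eq_fun do rewrite -re_charfunE.
  exact: hc.
have c2 u v : cvgI mu mu0 (fun z => sin (u * z.1 + v * z.2)).
  rewrite /cvgI -im_charfunE; under eq_fun do rewrite -im_charfunE.
  exact: hs.
have E d1 (T1 : measurableType d1) (P1 : probability T1 R) (Z1 : T1 -> R[i])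
    (mZ1 : measurable_fun setT Z1) :
    ('E_P1[fun t => f (Z1 t)])%E = (\int[plane_law P1 mZ1]_z h z)%:E.
  rewrite Rint_plane_law// -RintE.
    by congr expectation; apply/funext => t; rewrite /h complex_pairK.
  exact: (bmeas_comp bh (measurableT_comp measurable_complex_pair mZ1)).
rewrite (E _ _ _ _ mW); under eq_fun do rewrite (E _ _ _ _ (mZ _)).
apply: cvg_EFin; first exact: nearW.
exact: (levy_continuity c1 c2 hM ch).
Qed.

(** The two laws agree on open sets by two opposite inequalities; open sets are stable under
    intersection and generate the Borel sets. *)
Lemma charfun_inj d1 (T1 : measurableType d1) (P : probability T1 R) (Z : T1 -> R[i])
    d2 (T2 : measurableType d2) (Q : probability T2 R) (W : T2 -> R[i]) :
  measurable_fun setT Z -> measurable_fun setT W ->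
  re_charfun P Z =2 re_charfun Q W -> im_charfun P Z =2 im_charfun Q W ->
  forall A, measurable A -> P (Z @^-1` A) = Q (W @^-1` A).
Proof.
move=> mZ mW hc hs A mA.
have openE U : @open R[i] U -> P (Z @^-1` U) = Q (W @^-1` U).
  move=> oU.
  have oU' x : (pair_complex @^-1` U) x -> exists2 e, 0 < e & forall y, l1dist x y < e -> (pair_complex @^-1` U) y.
    move=> /((open_complexP U).1 oU)[e e0 eU]; exists e => // y.
    exact: (eU (pair_complex y)).
  have preE d (T : measurableType d) (S : probability T R) (V : T -> R[i]) (mV : measurable_fun setT V) :
      S (V @^-1` U) = plane_law S mV (pair_complex @^-1` U).
    rewrite plane_lawE; congr (S _); apply/seteqP; split => t /=.
      by rewrite complex_pairK.
    by rewrite complex_pairK.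
  rewrite (preE _ _ P Z mZ) (preE _ _ Q W mW); apply/eqP; rewrite eq_le; apply/andP; split.
    apply: charfun_le_open => // u v.
      by rewrite -!re_charfunE hc.
    by rewrite -!im_charfunE hs.
  apply: charfun_le_open => // u v.
    by rewrite -!re_charfunE hc.
  by rewrite -!im_charfunE hs.
pose Z' : {RV P >-> R[i]} := HB.pack Z (isMeasurableFun.Build _ _ _ _ _ mZ).
pose W' : {RV Q >-> R[i]} := HB.pack W (isMeasurableFun.Build _ _ _ _ _ mW).
apply: (measure_unique (@open R[i]) (fun=> setT) _ _ _ _ (distribution P Z') (distribution Q W')) => //.
- by move=> U V; exact: openI.
- by move=> _; exact: openT.
- by rewrite -subTset => x _; exists 0%N.
- by move=> _; rewrite -ge0_fin_numE// fin_num_measure.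
Qed.

End laws_of_complex_variables.

(** * Independence and expectations of products *)

Section complex_expectation.
Context {R : realType} d (T : measurableType d) (P : probability T R).
Implicit Types (f Y : T -> R) (Z : T -> R[i]).

Definition Cint Z : R[i] :=
  \int[P]_t complex.Re (Z t) +i* \int[P]_t complex.Im (Z t).

Definition cbmeas Z := bmeas (fun t => complex.Re (Z t)) /\ bmeas (fun t => complex.Im (Z t)).

Lemma cbmeasM Z1 Z2 : cbmeas Z1 -> cbmeas Z2 -> cbmeas (fun t => Z1 t * Z2 t).
Proof.
move=> [r1 i1] [r2 i2]; split.
  rewrite (_ : (fun t => _) = (fun t => complex.Re (Z1 t) * complex.Re (Z2 t) - complex.Im (Z1 t) * complex.Im (Z2 t))).
    by apply: bmeasB; exact: bmeasM.
  by apply/funext => t; case: (Z1 t) => a b; case: (Z2 t).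
rewrite (_ : (fun t => _) = (fun t => complex.Re (Z1 t) * complex.Im (Z2 t) + complex.Im (Z1 t) * complex.Re (Z2 t))).
  by apply: bmeasD; exact: bmeasM.
by apply/funext => t; case: (Z1 t) => a b; case: (Z2 t).
Qed.

Lemma cbmeas_cst c : cbmeas (fun=> c).
Proof. by split; exact: bmeas_cst. Qed.

Lemma cbmeas_prod (I : Type) (r : seq I) (p : pred I) (g : I -> T -> R[i]) :
  (forall i, cbmeas (g i)) -> cbmeas (fun t => \prod_(i <- r | p i) g i t).
Proof.
move=> bg; elim: r => [|i r IH].
  by under eq_fun do rewrite big_nil; exact: cbmeas_cst.
under eq_fun do rewrite big_cons.
by case: (p i) => //; exact: cbmeasM.
Qed.

Lemma cbmeas_indic (A : set T) : measurable A -> cbmeas (fun t => (\1_A t)%:C).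
Proof.
move=> mA; split; last exact: bmeas_cst.
split; first exact: measurable_indic.
by exists 1 => t; rewrite /= indicE; case: (_ \in _); rewrite /= ?normr1 ?normr0.
Qed.

Lemma Cint_indic (A : set T) : measurable A -> Cint (fun t => (\1_A t)%:C) = (fine (P A))%:C.
Proof.
move=> mA; rewrite /Cint /= Rint_cst; congr (_ +i* _).
by rewrite /Rintegral integral_indic// setIT.
Qed.

(* Layer-cake approximation: bounded functions are uniform limits of combinations
   of indicators of their superlevel sets. *)
Lemma staircase (e g : R) (N : nat) : 0 < e -> 0 <= g ->
  (N%:R * e <= g -> e * \sum_(j < N) (j.+1%:R * e <= g)%R%:R = N%:R * e) /\
  (g < N%:R * e -> g - e <= e * \sum_(j < N) (j.+1%:R * e <= g)%R%:R <= g).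
Proof.
move=> e0 g0; elim: N => [|N [IH1 IH2]].
  by rewrite big_ord0 mulr0 mul0r; split => //; rewrite ltNge g0.
rewrite big_ord_recr/= mulrDr; split => h.
  have hN : N%:R * e <= g.
    by apply: le_trans h; apply: ler_wpM2r; rewrite ?ler_nat// ltW.
  by rewrite (IH1 hN) h mulr1 -natr1 mulrDl mul1r.
rewrite (leNgt _ g) h /= mulr0 addr0.
have [hN|hN] := leP (N%:R * e) g; last exact: IH2.
rewrite (IH1 hN) hN andbT; move: h; rewrite -natr1 mulrDl mul1r; lra.
Qed.

Variable F : set (set T).
Hypothesis Fm : forall A, F A -> measurable A.

(** Factorization for indicators extends by linearity to staircases and by uniform approximation to
    [f]. Only preimages under [f] have to lie in [F], so no closure property of [F] is required. *)
Let expect_prod_real f Y : bmeas f -> bmeas Y ->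
  (forall B, measurable B -> F (f @^-1` B)) ->
  (forall A, F A -> \int[P]_t (\1_A t * Y t) = fine (P A) * \int[P]_t Y t) ->
  \int[P]_t (f t * Y t) = \int[P]_t f t * \int[P]_t Y t.
Proof.
move=> bf bY fF FY.
have [M fM] := bf.2; have [C YC] := bY.2.
have C0 : 0 <= C by exact: le_trans (YC point).
apply/eqP; rewrite -subr_eq0 -normr_le0; apply/ler_addgt0Pr => eps eps0; rewrite add0r.
pose e := eps / (2 * (C + 1)).
have C1 : 0 < C + 1 by rewrite ltr_wpDl.
have e0 : 0 < e by rewrite divr_gt0// mulr_gt0.
(* [f + M] takes its values in [[0, 2 M]], so a staircase with [N] steps of height [e] reaches above
   it. *)
have [N hN] : exists N : nat, M + M < N%:R * e.
  exists (Num.truncn ((M + M) / e)).+1; rewrite -ltr_pdivrMr//.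
  exact: truncnS_gt.
pose A (j : nat) : set T := f @^-1` `[(j.+1%:R * e - M), +oo[.
have FA j : F (A j) by apply: fF; exact: measurable_itv.
have AE j t : \1_(A j) t = (j.+1%:R * e <= f t + M)%R%:R :> R.
  rewrite indicE; congr (nat_of_bool _)%:R.
  by apply/idP/idP; rewrite inE /A/= in_itv/= andbT lerBlDr.
have bA j : bmeas (\1_(A j) : T -> R).
  split; first exact/measurable_indic/Fm.
  by exists 1 => t; rewrite indicE; case: (_ \in _); rewrite /= ?normr1 ?normr0.
have intA j : \int[P]_t (\1_(A j) t) = fine (P (A j)).
  by rewrite /Rintegral integral_indic ?setIT//; exact: Fm.
pose fe t := e * \sum_(j < N) \1_(A j) t - M.
have fe_close t : `|f t - fe t| <= e.
  have h0 : 0 <= f t + M by have := fM t; rewrite ler_norml => /andP[? ?]; lra.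
  have [_] := staircase N e0 h0.
  have hlt : f t + M < N%:R * e by have := fM t; rewrite ler_norml => /andP[? ?]; lra.
  move=> /(_ hlt); rewrite /fe.
  have <- : \sum_(j < N) \1_(A j) t = \sum_(j < N) (j.+1%:R * e <= f t + M)%R%:R :> R.
    by apply: eq_bigr => j _; exact: AE.
  by move=> /andP[? ?]; rewrite ler_norml; apply/andP; split; lra.
have bs : bmeas (fun t => \sum_(j < N) \1_(A j) t : R).
  exact: (bmeas_sum _ (fun j : 'I_N => bA j)).
have bes : bmeas (fun t => e * \sum_(j < N) \1_(A j) t : R).
  by apply: bmeasM => //; exact: bmeas_cst.
have bfe : bmeas fe by apply: bmeasB => //; exact: bmeas_cst.
have intfe : \int[P]_t fe t = e * \sum_(j < N) fine (P (A j)) - M.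
  rewrite (RintB P bes (bmeas_cst M)) Rint_cst (RintZl P e bs) (Rint_sum P _ (fun j : 'I_N => bA j)).
  by congr (_ * _ - _); apply: eq_bigr => j _.
have intfeY : \int[P]_t (fe t * Y t) = \int[P]_t fe t * \int[P]_t Y t.
  transitivity (\int[P]_t (e * (\sum_(j < N) \1_(A j) t * Y t) - M * Y t)).
    apply: eq_Rintegral => t _; rewrite /fe mulrBl -mulrA; congr (_ * _ - _).
    by rewrite mulr_suml.
  have b1 : bmeas (fun t => \sum_(j < N) \1_(A j) t * Y t).
    exact: (bmeas_sum _ (fun j : 'I_N => bmeasM (bA j) bY)).
  have b2 : bmeas (fun t => e * (\sum_(j < N) \1_(A j) t * Y t)).
    by apply: bmeasM => //; exact: bmeas_cst.
  have b3 : bmeas (fun t => M * Y t) by apply: bmeasM => //; exact: bmeas_cst.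
  rewrite (RintB P b2 b3) (RintZl P e b1) (RintZl P M bY) (Rint_sum P _ (fun j : 'I_N => bmeasM (bA j) bY)).
  rewrite intfe mulrBl; congr (_ - _); rewrite -[RHS]mulrA; congr (_ * _).
  by rewrite big_distrl/=; apply: eq_bigr => j _; exact: FY.
have bdf : bmeas (fun t => f t - fe t) by exact: bmeasB.
have -> : \int[P]_t (f t * Y t) - \int[P]_t f t * \int[P]_t Y t =
  \int[P]_t ((f t - fe t) * Y t) - \int[P]_t (f t - fe t) * \int[P]_t Y t.
  rewrite (RintB P bf bfe) mulrBl -intfeY.
  have -> : \int[P]_t ((f t - fe t) * Y t) = \int[P]_t (f t * Y t) - \int[P]_t (fe t * Y t).
    rewrite -(RintB P (bmeasM bf bY) (bmeasM bfe bY)).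
    by apply: eq_Rintegral => t _; rewrite mulrBl.
  by ring.
have h1 : `|\int[P]_t ((f t - fe t) * Y t)| <= e * C.
  by apply: Rint_norm_le => [|t]; [exact: bmeasM|rewrite normrM ler_pM].
have h2 : `|\int[P]_t (f t - fe t) * \int[P]_t Y t| <= e * C.
  by rewrite normrM ler_pM//; apply: Rint_norm_le.
rewrite (le_trans (ler_normB _ _))// (le_trans (lerD h1 h2))//.
have -> : eps = e * (C + 1) + e * (C + 1) by rewrite /e; field; rewrite gt_eqF.
by rewrite lerD// ler_pM2l// lerDl.
Qed.

Lemma Cint_prod Z1 Z2 : cbmeas Z1 -> cbmeas Z2 ->
  (forall B : set R, measurable B -> F ((fun t => complex.Re (Z1 t)) @^-1` B)) ->
  (forall B : set R, measurable B -> F ((fun t => complex.Im (Z1 t)) @^-1` B)) ->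
  (forall A, F A -> Cint (fun t => (\1_A t)%:C * Z2 t) = (fine (P A))%:C * Cint Z2) ->
  Cint (fun t => Z1 t * Z2 t) = Cint Z1 * Cint Z2.
Proof.
move=> [r1 i1] [r2 i2] FR FI H.
have HR A : F A -> \int[P]_t (\1_A t * complex.Re (Z2 t)) = fine (P A) * \int[P]_t complex.Re (Z2 t).
  move=> /H/(congr1 (@complex.Re R)) /=; rewrite mul0r subr0 => <-.
  by apply: eq_Rintegral => t _; case: (Z2 t) => a b /=; rewrite mul0r subr0.
have HI A : F A -> \int[P]_t (\1_A t * complex.Im (Z2 t)) = fine (P A) * \int[P]_t complex.Im (Z2 t).
  move=> /H/(congr1 (@complex.Im R)) /=; rewrite mul0r addr0 => <-.
  by apply: eq_Rintegral => t _; case: (Z2 t) => a b /=; rewrite mul0r addr0.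
rewrite /Cint /=; congr (_ +i* _).
  rewrite -!expect_prod_real// -RintB; [|exact: bmeasM|exact: bmeasM].
  by apply: eq_Rintegral => t _; case: (Z1 t) => a b; case: (Z2 t).
rewrite -!expect_prod_real// -RintD; [|exact: bmeasM|exact: bmeasM].
by apply: eq_Rintegral => t _; case: (Z1 t) => a b; case: (Z2 t).
Qed.

End complex_expectation.

(** * Expectation of a product over an independent family *)

Section independent_products.
Context {R : realType} d (T : measurableType d) (P : probability T R).

Definition adapted (F : set (set T)) (Z : T -> R[i]) : Prop :=
  forall B : set R, measurable B ->
    F ((fun t => complex.Re (Z t)) @^-1` B) /\ F ((fun t => complex.Im (Z t)) @^-1` B).

Variables (I : finType) (F : I -> set (set T)).
Hypothesis Fm : forall i A, F i A -> measurable A.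
Hypothesis FT : forall i, F i setT.
Hypothesis indepF : forall A : I -> set T, (forall i, F i (A i)) ->
  P (\bigcap_i A i) = (\prod_i P (A i))%E.

Let indic_prod (A : I -> set T) t :
  \prod_i (\1_(A i) t : R)%:C = (\1_(\bigcap_i A i) t : R)%:C.
Proof.
rewrite !indicE; have [h|h] := pselect (forall i, A i t).
  rewrite mem_set; last by move=> i _; exact: h.
  by rewrite big1// => i _; rewrite indicE mem_set.
have [i Ai] : exists i, ~ A i t by apply/existsNP.
rewrite memNset; last by move=> /(_ i Logic.I)/Ai.
by rewrite (bigD1 i)//= indicE memNset// mul0r.
Qed.

Let indep_indic (A : I -> set T) : (forall i, F i (A i)) ->
  Cint P (fun t => \prod_i (\1_(A i) t : R)%:C) =
  \prod_i Cint P (fun t => (\1_(A i) t : R)%:C).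
Proof.
move=> FA; have mA i : measurable (A i) by exact: Fm (FA i).
have mI : measurable (\bigcap_i A i) by exact: fin_bigcap_measurable.
under [in LHS]eq_fun do rewrite indic_prod.
rewrite Cint_indic// indepF//.
under eq_bigr => i _ do rewrite Cint_indic//.
rewrite -rmorph_prod; congr (_%:C).
rewrite (_ : (\prod_i P (A i))%E = (\prod_i fine (P (A i)))%:E)//.
rewrite -prodEFin; apply: eq_bigr => i _.
by rewrite fineK// fin_num_measure.
Qed.

(** Induction on the list of indices that carry their true function, all others carrying an
    indicator of their class. With no true function left this is independence of events; the
    induction hypothesis, with one function replaced by an arbitrary indicator, is what [Cint_prod]
    asks for. *)
Lemma Cint_prod_indep (f : I -> T -> R[i]) :
  (forall i, cbmeas (f i)) -> (forall i, adapted (F i) (f i)) ->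
  Cint P (fun t => \prod_i f i t) = \prod_i Cint P (f i).
Proof.
move=> bf af.
suff H (r : seq I) (g : I -> T -> R[i]) : uniq r ->
    (forall i, i \in r -> g i = f i) ->
    (forall i, i \notin r -> exists2 A, F i A & g i = (fun t => (\1_A t)%:C)) ->
    Cint P (fun t => \prod_i g i t) = \prod_i Cint P (g i).
  by apply: (H (enum I)) => // [|i]; [exact: enum_uniq|rewrite mem_enum].
elim: r g => [|k r IH] g /=.
  move=> _ _ hg.
  have hg' i : {A | F i A & g i = (fun t => (\1_A t)%:C)} by apply: cid2; exact: hg.
  pose A i := s2val (hg' i).
  have gE i : g i = (fun t => (\1_(A i) t)%:C) by exact: (s2valP' (hg' i)).
  under [in LHS]eq_fun => t do under eq_bigr => i _ do rewrite gE.
  under [in RHS]eq_bigr => i _ do rewrite gE.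
  by apply: indep_indic => i; exact: (s2valP (hg' i)).
move=> /andP[kr ur] gf gA.
have bg i : cbmeas (g i).
  have [ir|ir] := boolP (i \in k :: r); first by rewrite gf.
  have [A FA ->] := gA _ ir; apply: cbmeas_indic; exact: Fm FA.
have gk : g k = f k by rewrite gf// mem_head.
pose Y t := \prod_(i | i != k) g i t.
have bY : cbmeas Y := cbmeas_prod (index_enum I) (fun i => i != k) bg.
pose g' (A : set T) i := if i == k then fun t => (\1_A t : R)%:C else g i.
have g'E A i : i != k -> g' A i = g i by rewrite /g' => /negbTE ->.
have IHg' A : F k A -> Cint P (fun t => (\1_A t : R)%:C * Y t) =
    (fine (P A))%:C * \prod_(i | i != k) Cint P (g i).
  move=> FA; transitivity (Cint P (fun t => \prod_i g' A i t)).
    congr (Cint P); apply/funext => t; rewrite (bigD1 k)//= {1}/g' eqxx; congr (_ * _).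
    by apply: eq_bigr => i ik; rewrite g'E.
  rewrite (IH (g' A))//.
  - rewrite (bigD1 k)//= {1}/g' eqxx Cint_indic//; last exact: Fm FA.
    by congr (_ * _); apply: eq_bigr => i ik; rewrite g'E.
  - move=> i ir; rewrite g'E; first by rewrite gf// in_cons ir orbT.
    by apply: contraNneq kr => <-.
  - move=> i ir; have [->|ik] := eqVneq i k.
      by exists A => //; rewrite /g' eqxx.
    by rewrite g'E//; apply: gA; rewrite in_cons negb_or ik.
have YE : Cint P Y = \prod_(i | i != k) Cint P (g i).
  have := IHg' setT (FT k); rewrite probability_setT mul1r => <-.
  by congr (Cint P); apply/funext => t; rewrite indicT mul1r.
transitivity (Cint P (fun t => g k t * Y t)).
  by congr (Cint P); apply/funext => t; rewrite (bigD1 k).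
rewrite (@Cint_prod _ _ _ P (F k))//.
- by rewrite [RHS](bigD1 k)//= YE.
- by move=> A; exact: Fm.
- by move=> B mB; rewrite gk; case: (af k B mB).
- by move=> B mB; rewrite gk; case: (af k B mB).
- by move=> A FA; rewrite IHg'// YE.
Qed.

End independent_products.

(** * Joint independence of symbols, phases and channel noise *)

Section three_independent_vectors.
Context {R : realType} d (T : measurableType d) (P : probability T R).
Context d1 (T1 : measurableType d1) d2 (T2 : measurableType d2) d3 (T3 : measurableType d3).
Variable N : nat.
Variables (X : 'I_N -> {RV P >-> T1}) (Y : 'I_N -> {RV P >-> T2}) (Z : 'I_N -> {RV P >-> T3}).
Hypotheses (iX : independent_rvs P X) (iY : independent_rvs P Y) (iZ : independent_rvs P Z).
Hypothesis iXYZ : independent_vectors3 P X Y Z.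

Let all_indep d' (T' : measurableType d') (V : 'I_N -> {RV P >-> T'}) (A : 'I_N -> set T) :
  independent_rvs P V -> (forall i, g_sigma_algebra_preimage (V i) (A i)) ->
  P (\bigcap_i A i) = (\prod_i P (A i))%E.
Proof.
move=> iV hA; have := iV [set: 'I_N]%SET A (fun i _ => hA i).
rewrite (_ : [set` [set: 'I_N]%SET] = setT); last first.
  by apply/seteqP; split => i //= _; rewrite inE.
by move=> ->; apply: eq_bigl => i; rewrite inE.
Qed.

Let bigcap_gen d' (T' : measurableType d') (V : 'I_N -> {RV P >-> T'}) (A : 'I_N -> set T) :
  (forall i, g_sigma_algebra_preimage (V i) (A i)) ->
  g_sigma_preimage V (\bigcap_i A i).
Proof.
move=> hA; rewrite /g_sigma_preimage.
set G := \big[_/_]_(i < N) _.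
have GA i : (<<s G >> : set (set T)) (A i).
  apply: sub_sigma_algebra; rewrite /G (bigD1 i)//=; left.
  exact: hA.
have fin : finite_set [set: 'I_N] by exact: finite_finset.
exact: (@fin_bigcap_measurable _ (g_sigma_algebraType G) 'I_N setT A fin (fun i _ => GA i)).
Qed.

(** A sum type of indices makes the entries of the three vectors one family, so that a single
    factorization handles all of them. *)
Definition three_classes (i : 'I_N + ('I_N + 'I_N)) : set (set T) :=
  match i with
  | inl k => g_sigma_algebra_preimage (X k)
  | inr (inl k) => g_sigma_algebra_preimage (Y k)
  | inr (inr k) => g_sigma_algebra_preimage (Z k)
  end.

(** Intersecting within each vector gives an event of its generated sigma-algebra. Independence of
    the vectors separates these three events, and independence of the entries splits each of
    them. *)
Let three_indep (A : 'I_N + ('I_N + 'I_N) -> set T) : (forall i, three_classes i (A i)) ->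
  P (\bigcap_i A i) = (\prod_i P (A i))%E.
Proof.
move=> hA.
pose B : 'I_3 -> set T := tnth [tuple \bigcap_k A (inl k); \bigcap_k A (inr (inl k)); \bigcap_k A (inr (inr k))].
have := iXYZ (J := [set: 'I_3]%SET) (A := B).
have -> : \bigcap_(i in [set` [set: 'I_3]%SET]) B i = \bigcap_i A i.
  apply/seteqP; split => t Ht.
    move=> [k|[k|k]] _.
    - by have := Ht ord0; rewrite /= inE; apply.
    - by have := Ht (inord 1); rewrite /B (tnth_nth setT) inordK//= inE; apply.
    - by have := Ht (inord 2); rewrite /B (tnth_nth setT) inordK//= inE; apply.
  move=> [[|[|[|//]]] i3] _; rewrite /B (tnth_nth setT)/= => k _; exact: Ht.
have -> : (\prod_(i in [set: 'I_3]%SET) P (B i) =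
    P (\bigcap_k A (inl k)) * (P (\bigcap_k A (inr (inl k))) * P (\bigcap_k A (inr (inr k)))))%E.
  rewrite (eq_bigl xpredT) => [|i]; last by rewrite inE.
  rewrite !big_ord_recl big_ord0 mule1.
  by rewrite /B !(tnth_nth setT).
move=> ->; last first.
  move=> [[|[|[|//]]] i3] _; rewrite /B !(tnth_nth setT)/=; apply: bigcap_gen => k.
  - exact: (hA (inl k)).
  - exact: (hA (inr (inl k))).
  - exact: (hA (inr (inr k))).
rewrite (all_indep iX) => [|k]; last exact: (hA (inl k)).
rewrite (all_indep iY) => [|k]; last exact: (hA (inr (inl k))).
rewrite (all_indep iZ) => [|k]; last exact: (hA (inr (inr k))).
by rewrite big_sumType/= big_sumType.
Qed.

Let preimage_adapted d' (T' : measurableType d') (V : {RV P >-> T'}) (f : T' -> R[i]) :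
  cbmeas f -> cbmeas (fun t => f (V t)) /\
  adapted (g_sigma_algebra_preimage V) (fun t => f (V t)).
Proof.
move=> [fR fI]; split.
  by split; [apply: (bmeas_comp fR)|apply: (bmeas_comp fI)]; exact: measurable_funPT.
move=> B mB; split; rewrite /g_sigma_algebra_preimage /preimage_set_system/=.
  exists ((fun x => complex.Re (f x)) @^-1` B); last by rewrite setTI.
  by rewrite -[X in measurable X]setTI; case: fR => mf _; exact: mf.
exists ((fun x => complex.Im (f x)) @^-1` B); last by rewrite setTI.
by rewrite -[X in measurable X]setTI; case: fI => mf _; exact: mf.
Qed.

Lemma Cint_three_indep (f : 'I_N -> T1 -> R[i]) (g : 'I_N -> T2 -> R[i]) (h : 'I_N -> T3 -> R[i]) :
  (forall k, cbmeas (f k)) -> (forall k, cbmeas (g k)) -> (forall k, cbmeas (h k)) ->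
  Cint P (fun t => (\prod_k f k (X k t)) * ((\prod_k g k (Y k t)) * \prod_k h k (Z k t))) =
  (\prod_k Cint P (fun t => f k (X k t))) *
  ((\prod_k Cint P (fun t => g k (Y k t))) * \prod_k Cint P (fun t => h k (Z k t))).
Proof.
move=> bf bg bh.
pose F (i : 'I_N + ('I_N + 'I_N)) (t : T) : R[i] :=
  match i with
  | inl k => f k (X k t)
  | inr (inl k) => g k (Y k t)
  | inr (inr k) => h k (Z k t)
  end.
have h1 : forall i, cbmeas (F i) /\ adapted (three_classes i) (F i).
  by move=> [k|[k|k]]; exact: preimage_adapted.
transitivity (Cint P (fun t => \prod_i F i t)).
  congr (Cint P); apply/funext => t.
  by rewrite [RHS]big_sumType/= big_sumType.
rewrite (@Cint_prod_indep _ _ _ P _ three_classes).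
- by rewrite big_sumType/= big_sumType.
- move=> i A; have pre d' (T' : measurableType d') (V : {RV P >-> T'}) :
      g_sigma_algebra_preimage V A -> measurable A.
    move=> [B mB <-]; rewrite setTI -[X in measurable X]setTI.
    exact: (@measurable_funPT _ _ _ _ V).
  by case: i => [k|[k|k]]; exact: pre.
- by move=> [k|[k|k]]; exists setT => //; rewrite preimage_setT setTI.
- exact: three_indep.
- by move=> i; case: (h1 i).
- by move=> i; case: (h1 i).
Qed.

End three_independent_vectors.

(** * Hadamard matrices and the effective noise *)

Section hadamard_entries.
Context {R : realType}.
Notation s2 := ((Num.sqrt 2)^-1 : R).

Let s2E : s2 * s2 = 2^-1.
Proof. by rewrite -invfM -expr2 sqr_sqrtr. Qed.

Definition had2_entry (i j : nat) : R := s2 * (if (j < i)%N then -1 else 1).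

(** Entries as a function of natural numbers, read off the binary digits of the indices; this avoids
    the casts between matrix sizes. *)
Fixpoint had_entry (l i j : nat) : R :=
  if l is l'.+1 then
    had2_entry (i %/ 2 ^ l') (j %/ 2 ^ l') * had_entry l' (i %% 2 ^ l') (j %% 2 ^ l')
  else 1.

Lemma hadamard2E (i j : 'I_2) : @hadamard2 R i j = had2_entry i j.
Proof. by rewrite /hadamard2 !mxE. Qed.

Lemma hadamardE l (i j : 'I_(2 ^ l)) : @hadamard R l i j = had_entry l i j.
Proof.
elim: l i j => [|l IH] i j /=.
  by move: i j; rewrite /= expn0 => i j; rewrite !ord1 mxE eqxx.
by rewrite castmxE mxE /= hadamard2E IH.
Qed.

(* The binary digits of the indices can be split off from either end. *)
Lemma had_entry_low l i j : (i < 2 ^ l.+1)%N -> (j < 2 ^ l.+1)%N ->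
  had_entry l.+1 i j = had_entry l (i %/ 2) (j %/ 2) * had2_entry (i %% 2) (j %% 2).
Proof.
elim: l i j => [|l IH] i j hi hj.
  by rewrite /= expn0 !divn1 mulr1 mul1r !modn_small.
have pow0 : (0 < 2 ^ l.+1)%N by rewrite expn_gt0.
have e1 k : (k %/ 2 %/ 2 ^ l = k %/ 2 ^ l.+1)%N by rewrite -divnMA expnS.
have e2 k : ((k %% 2 ^ l.+1) %/ 2 = k %/ 2 %% 2 ^ l)%N.
  by rewrite expnS mulnC modn_divl.
have e3 k : ((k %% 2 ^ l.+1) %% 2 = k %% 2)%N.
  by rewrite modn_dvdm// expnS dvdn_mulr.
transitivity (had2_entry (i %/ 2 ^ l.+1) (j %/ 2 ^ l.+1) *
    had_entry l.+1 (i %% 2 ^ l.+1) (j %% 2 ^ l.+1)); first by [].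
rewrite IH ?ltn_mod// !e2 !e3 mulrA; congr (_ * _).
by rewrite /= !e1.
Qed.

(** The recursion splits off the factor of order 2 on the left, whereas the pairing of real and
    imaginary parts needs it on the right. Both describe the same tensor power. *)
Lemma hadamard_rotE l : hadamard_rot l = hadamard l *t hadamard2 :> 'M[R]_(2 ^ l * 2).
Proof.
apply/matrixP => i j; rewrite /hadamard_rot castmxE mxE hadamardE hadamard2E.
rewrite hadamardE had_entry_low//=.
- by apply: (leq_trans (ltn_ord i)); rewrite expnSr.
- by apply: (leq_trans (ltn_ord j)); rewrite expnSr.
Qed.

Lemma sqr_had_entry l i j : had_entry l i j ^+ 2 = (2 ^+ l)^-1.
Proof.
elim: l i j => [|l IH] i j /=; first by rewrite expr1n expr0 invr1.
rewrite exprMn IH [in RHS]exprS invfM; congr (_ * _).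
by rewrite /had2_entry exprMn expr2 s2E; case: ifP; rewrite ?sqrrN expr1n mulr1.
Qed.

Lemma sqr_hadamard l (i j : 'I_(2 ^ l)) : @hadamard R l i j ^+ 2 = (2 ^+ l)^-1.
Proof. by rewrite hadamardE sqr_had_entry. Qed.

Lemma hadamard2_orthogonal : hadamard2^T *m hadamard2 = 1%:M :> 'M[R]_2.
Proof.
apply/matrixP => i j; rewrite !mxE !big_ord_recl big_ord0 !mxE addr0 /=.
have s := s2E; case: i => [[|[|//]] ?]; case: j => [[|[|//]] ?] /=; lra.
Qed.

Lemma hadamard_orthogonal l : (hadamard l)^T *m hadamard l = 1%:M :> 'M[R]_(2 ^ l).
Proof.
elim: l => [|l IH]; first by rewrite /= trmx1 mulmx1.
rewrite /= trmx_cast /= trmx_tens.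
(* With the size equation generalized, case analysis on it removes the casts. *)
move: (esym (expnS 2 l)) => e.
have -> : 1%:M = castmx (e, e) (1%:M : 'M[R]_(2 * 2 ^ l)).
  by case: _ / e; rewrite castmx_id.
case: _ / e; rewrite !castmx_id tensmx_mul IH hadamard2_orthogonal.
apply/matrixP => i j; case: (mxtens_indexP i) => i0 i1; case: (mxtens_indexP j) => j0 j1.
have E : (mxtens_index (i0, i1) == mxtens_index (j0, j1)) = (i0 == j0) && (i1 == j1).
  by rewrite (inj_eq (can_inj (@mxtens_indexK _ _))) xpair_eqE.
by rewrite tensmxE [RHS]mxE E !mxE -natrM mulnb.
Qed.

Lemma hadamard_dot l (i m : 'I_(2 ^ l)) :
  \sum_k @hadamard R l k i * hadamard l k m = (i == m)%:R.
Proof.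
have := congr1 (fun M : 'M[R]_(2 ^ l) => M i m) (hadamard_orthogonal l).
by rewrite !mxE => <-; apply: eq_bigr => k _; rewrite mxE.
Qed.

Lemma hadamard_parseval l (x : 'I_(2 ^ l) -> R) :
  \sum_k (\sum_m hadamard l k m * x m) ^+ 2 = \sum_m x m ^+ 2.
Proof.
transitivity (\sum_k \sum_m \sum_m' (hadamard l k m * hadamard l k m') * (x m * x m')).
  apply: eq_bigr => k _; rewrite expr2 mulr_suml; apply: eq_bigr => m _.
  by rewrite mulr_sumr; apply: eq_bigr => m' _; rewrite mulrACA.
rewrite exchange_big/=; apply: eq_bigr => m _.
rewrite exchange_big/= (bigD1 m)//= -mulr_suml hadamard_dot eqxx mul1r -expr2.
rewrite big1 ?addr0// => m' m'm; rewrite -mulr_suml hadamard_dot eq_sym.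
by rewrite (negbTE m'm) mul0r.
Qed.

Lemma hadamard_row l (k : 'I_(2 ^ l)) : \sum_m @hadamard R l k m ^+ 2 = 1.
Proof.
rewrite (eq_bigr (fun=> (2 ^+ l)^-1)) => [|m _]; last exact: sqr_hadamard.
by rewrite sumr_const card_ord -(mulr_natl (2 ^+ l)^-1) natrX mulfV// expf_neq0.
Qed.

Lemma sum_mxtens m n (F : 'I_(m * n) -> R) :
  \sum_j F j = \sum_(i < m) \sum_(b < n) F (mxtens_index (i, b)).
Proof.
rewrite pair_big /= (reindex (@mxtens_index m n))/=; last first.
  by exists (@mxtens_unindex m n) => i _; rewrite (mxtens_indexK, mxtens_unindexK).
by apply: eq_bigr => -[].
Qed.

(* The factor by which [hadamard2] acts, up to conjugation, on [x + i y]. *)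
Definition rot8 : R[i] := s2 +i* s2.

Lemma rot8_conj : rot8 * rot8^* = 1.
Proof.
rewrite /rot8 /=; simpc; congr (_ +i* _); have := s2E; lra.
Qed.

Let mul_real (a : R) (z : R[i]) :
  a%:C * z = (a * complex.Re z) +i* (a * complex.Im z).
Proof. by case: z => x y; simpc. Qed.

Lemma ReD (z w : R[i]) : complex.Re (z + w) = complex.Re z + complex.Re w.
Proof. by case: z; case: w. Qed.

Lemma ImD (z w : R[i]) : complex.Im (z + w) = complex.Im z + complex.Im w.
Proof. by case: z; case: w. Qed.

Lemma Re_sum (I : Type) (r : seq I) (F : I -> R[i]) :
  complex.Re (\sum_(k <- r) F k) = \sum_(k <- r) complex.Re (F k).
Proof. by elim: r => [|k r IH]; rewrite ?big_nil// !big_cons ReD IH. Qed.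

Lemma Im_sum (I : Type) (r : seq I) (F : I -> R[i]) :
  complex.Im (\sum_(k <- r) F k) = \sum_(k <- r) complex.Im (F k).
Proof. by elim: r => [|k r IH]; rewrite ?big_nil// !big_cons ImD IH. Qed.

Let sum_real_complex (I : finType) (a : I -> R) (z : I -> R[i]) :
  \sum_m (a m)%:C * z m =
  (\sum_m a m * complex.Re (z m)) +i* (\sum_m a m * complex.Im (z m)).
Proof.
apply/eqP; rewrite eq_complex Re_sum Im_sum; apply/andP; split; apply/eqP => /=;
  by apply: eq_bigr => m _; rewrite mul_real.
Qed.

Let to_realE n (z : 'cV[R[i]]_n) m (b : 'I_2) : to_real z (mxtens_index (m, b)) 0 =
  if b == ord0 then complex.Re (z m 0) else complex.Im (z m 0).
Proof. by rewrite mxE mxtens_indexK. Qed.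

Let lift01 : lift ord0 ord0 = ord_max :> 'I_2. Proof. exact: val_inj. Qed.

Lemma real_map_rot l (z : 'cV[R[i]]_(2 ^ l)) k :
  real_map (hadamard_rot l) z k 0 = rot8^* * \sum_m (hadamard l k m)%:C * z m 0.
Proof.
have E c : (hadamard_rot l *m to_real z) (mxtens_index (k, c)) 0 =
    hadamard2 c ord0 * (\sum_m hadamard l k m * complex.Re (z m 0)) +
    hadamard2 c ord_max * (\sum_m hadamard l k m * complex.Im (z m 0)).
  rewrite mxE sum_mxtens !mulr_sumr -big_split/=; apply: eq_bigr => m _.
  rewrite !big_ord_recl big_ord0 addr0 lift01 hadamard_rotE !to_realE !tensmxE /=.
  ring.
rewrite mxE !E sum_real_complex /rot8 /= !mxE /=; simpc.
congr (_ +i* _); ring.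
Qed.

Lemma real_map_rotT l (z : 'cV[R[i]]_(2 ^ l)) k :
  real_map (hadamard_rot l)^T z k 0 = rot8 * \sum_m (hadamard l m k)%:C * z m 0.
Proof.
have E c : ((hadamard_rot l)^T *m to_real z) (mxtens_index (k, c)) 0 =
    hadamard2 ord0 c * (\sum_m hadamard l m k * complex.Re (z m 0)) +
    hadamard2 ord_max c * (\sum_m hadamard l m k * complex.Im (z m 0)).
  rewrite mxE sum_mxtens !mulr_sumr -big_split/=; apply: eq_bigr => m _.
  rewrite !big_ord_recl big_ord0 addr0 lift01 hadamard_rotE !to_realE.
  rewrite trmx_tens !tensmxE /= ![_^T _ _]mxE; ring.
rewrite mxE !E sum_real_complex /rot8 /= !mxE /=; simpc.
congr (_ +i* _); ring.
Qed.

Variables (sigmap : R) (l : nat).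
Variables (s n : 'cV[R[i]]_(2 ^ l)) (theta : 'cV[R]_(2 ^ l)).
Notation H := (@hadamard R l).

(** The scalars [rot8] and its conjugate cancel, since they commute with the phases. Orthogonality
    rewrites [alpha s] as [alpha] times the transpose of [H] applied to [H s], so it can be
    subtracted term by term. *)
Lemma effective_noiseE k : effective_noise sigmap s theta n k 0 =
  \sum_j (H j k)%:C * ((expi (theta j 0) - (expR (- (sigmap ^+ 2 / 2)))%:C) *
      \sum_m (H j m)%:C * s m 0) +
  rot8 * \sum_j (H j k)%:C * n j 0.
Proof.
set al := (expR _)%:C.
have subE (A : 'cV[R[i]]_(2 ^ l)) : (A - al *: s) k 0 = A k 0 - al * s k 0.
  by rewrite mxE; congr (_ + _); rewrite !mxE.
rewrite /effective_noise /derotated subE real_map_rotT.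
have dotE m : \sum_j (H j k)%:C * ((H j m)%:C * s m 0) = ((k == m)%:R)%:C * s m 0.
  by rewrite -hadamard_dot rmorph_sum/= mulr_suml; apply: eq_bigr => j _; rewrite rmorphM mulrA.
have sE : s k 0 = \sum_j (H j k)%:C * (\sum_m (H j m)%:C * s m 0).
  under eq_bigr => j _ do rewrite mulr_sumr.
  rewrite exchange_big/= (bigD1 k)//= dotE eqxx mul1r big1 ?addr0// => m mk.
  by rewrite dotE eq_sym (negbTE mk) mul0r.
rewrite {1}sE.
have rE j : received s theta n j 0 =
    expi (theta j 0) * (rot8^* * \sum_m (H j m)%:C * s m 0) + n j 0.
  by rewrite -real_map_rot /received mxE mul_diag_mx; congr (_ + _); rewrite mxE [in LHS]mxE.
under eq_bigr => j _ do rewrite rE mulrDr.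
rewrite big_split/= mulrDr addrAC; congr (_ + _).
rewrite !mulr_sumr -sumrB; apply: eq_bigr => j _.
set y := \sum_m _.
have -> : rot8 * ((H j k)%:C * (expi (theta j 0) * (rot8^* * y))) =
  (rot8 * rot8^*) * ((H j k)%:C * (expi (theta j 0) * y)) by ring.
by rewrite rot8_conj; ring.
Qed.

(* With [A + i B = (u - i v) y], the form [u Re + v Im] of [(e^(i theta) - alpha) y]. *)
Lemma effective_noise_form (u v : R) k :
  u * complex.Re (effective_noise sigmap s theta n k 0) +
  v * complex.Im (effective_noise sigmap s theta n k 0) =
  \sum_j ((cos (theta j 0) - expR (- (sigmap ^+ 2 / 2))) *
      (H j k * \sum_m H j m * (u * complex.Re (s m 0) + v * complex.Im (s m 0))) -
    sin (theta j 0) *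
      (H j k * \sum_m H j m * (u * complex.Im (s m 0) - v * complex.Re (s m 0)))) +
  \sum_j (H j k * (s2 * (u + v)) * complex.Re (n j 0) +
    H j k * (s2 * (v - u)) * complex.Im (n j 0)).
Proof.
rewrite effective_noiseE; set al := expR _.
rewrite ReD ImD !mulrDr addrACA; congr (_ + _).
  rewrite Re_sum Im_sum !mulr_sumr -big_split/=; apply: eq_bigr => j _.
  rewrite sum_real_complex mul_real /expi.
  have -> : \sum_m H j m * (u * complex.Re (s m 0) + v * complex.Im (s m 0)) =
     u * (\sum_m H j m * complex.Re (s m 0)) + v * (\sum_m H j m * complex.Im (s m 0)).
    rewrite !mulr_sumr -big_split/=; apply: eq_bigr => m _; ring.
  have -> : \sum_m H j m * (u * complex.Im (s m 0) - v * complex.Re (s m 0)) =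
     u * (\sum_m H j m * complex.Im (s m 0)) - v * (\sum_m H j m * complex.Re (s m 0)).
    rewrite !mulr_sumr -sumrB; apply: eq_bigr => m _; ring.
  move: (\sum_m _) (\sum_m _) => a b.
  rewrite /=; ring.
rewrite sum_real_complex /rot8; simpc.
rewrite /= !mulr_sumr -!sumrN -!big_split/= !mulr_sumr -big_split/=.
by apply: eq_bigr => j _; ring.
Qed.

End hadamard_entries.

(** * Gaussian approximation of the rotated sum *)

(** The factors are exchanged one at a time, all the others having modulus at most 1. *)
Lemma prod_sub_le (C : numDomainType) (I : finType) (a b : I -> C) :
  (forall k, `|a k| <= 1) -> (forall k, `|b k| <= 1) ->
  `|\prod_k a k - \prod_k b k| <= \sum_k `|a k - b k|.
Proof.
move=> a1 b1; elim: (index_enum I) => [|k r IH]; first by rewrite !big_nil subrr normr0.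
rewrite !big_cons.
set A := \prod_(_ <- r) a _; set B := \prod_(_ <- r) b _.
have -> : a k * A - b k * B = (a k - b k) * B + a k * (A - B) by ring.
have B1 : `|B| <= 1.
  rewrite /B; elim: r {A B IH} => [|j r IH]; first by rewrite big_nil normr1.
  by rewrite big_cons normrM; exact: mulr_ile1.
apply: le_trans (ler_normD _ _) _; rewrite !normrM; apply: lerD.
  exact: ler_piMr.
by apply: le_trans IH; exact: ler_piMl.
Qed.

(** * Elementary bounds for the exponential *)

Section expR_estimates.
Context {R : realType}.
Implicit Types t z : R.

(** With [w = z / 2], the bound [1 - w <= exp (- w)] gives [exp w * (1 - w) <= 1]; squaring recovers
    [exp z]. The constant 4 is chosen for convenience. *)
Lemma expR_le_quad z : `|z| <= 1 -> expR z <= 1 + z + 4 * z ^+ 2.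
Proof.
rewrite ler_norml => /andP[z1 z2].
have e1 : 1 - z / 2 <= expR (- (z / 2)) := expR_ge1Dx _.
have e0 : 0 < expR (z / 2) := expR_gt0 _.
have eN : expR (z / 2) * expR (- (z / 2)) = 1 by rewrite -expRD subrr expR0.
have -> : expR z = expR (z / 2) ^+ 2 by rewrite expr2 -expRD -splitr.
set e := expR (z / 2) in eN e0 *; set w := z / 2 in eN e1 *.
have -> : z = 2 * w by rewrite /w; field.
have w1 : - 2^-1 <= w by rewrite /w; lra.
have w2 : w <= 2^-1 by rewrite /w; lra.
have ew : e * (1 - w) <= 1 by rewrite -[leRHS]eN ler_pM2l.
have ew2 : (e * (1 - w)) ^+ 2 <= 1 by rewrite expr_le1// mulr_ge0 ?(ltW e0)//; lra.
have q : 1 <= (1 - w) ^+ 2 * (1 + 2 * w + 4 * (2 * w) ^+ 2) by nra.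
have p0 : 0 < (1 - w) ^+ 2 by rewrite exprn_gt0//; lra.
rewrite -(ler_pM2l p0); apply: le_trans q.
by rewrite -exprMn mulrC.
Qed.

Lemma expR_neg_quad t : 0 <= t -> `|expR (- t) - 1 + t| <= t ^+ 2.
Proof.
move=> t0; have e1 : 1 - t <= expR (- t) := expR_ge1Dx _.
rewrite ger0_norm; last lra.
have e2 : expR (- t) * (1 + t) <= 1.
  rewrite -[leRHS](mulVf (lt0r_neq0 (expR_gt0 t))) -expRN ler_pM2l ?expR_gt0//.
  exact: expR_ge1Dx.
have t1 : 0 < 1 + t by lra.
rewrite -(ler_pM2l t1); set e := expR _ in e1 e2 *; nra.
Qed.

Lemma expR_neg_le1 t : 0 <= t -> expR (- t) <= 1.
Proof. by move=> t0; rewrite -expR0 ler_expR oppr_le0. Qed.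

Lemma cube_le_expR z : `|z| ^+ 3 <= 6 * (expR z + expR (- z)).
Proof.
have pos t : 0 <= t -> t ^+ 3 <= 6 * (expR t + expR (- t)).
  move=> t0; have := expR_ge1Dxn 2 t0; have -> : 3`!%:R = 6 :> R by [].
  have := expR_gt0 (- t); set a := expR (- t); set b := expR t; lra.
case: (ger0P z) => z0; first exact: pos.
have := pos (- z); rewrite opprK addrC; apply; lra.
Qed.

End expR_estimates.

(** * Moments of weighted sums of i.i.d. symbols *)

Section iid_sums.
Context {R : realType} (I : finType) (p : I -> R).
Hypotheses (p0 : forall i, 0 <= p i) (p1 : \sum_i p i = 1).

(** The law of [N] independent symbols as a weight on finite functions: averages over the symbols
    become finite sums. *)
Definition iid_weight N (x : {ffun 'I_N -> I}) : R := \prod_m p (x m).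

Lemma iid_weight_ge0 N (x : {ffun 'I_N -> I}) : 0 <= iid_weight x.
Proof. exact: prodr_ge0. Qed.

Lemma iid_expect_prod N (F : 'I_N -> I -> R) :
  \sum_x iid_weight x * \prod_m F m (x m) = \prod_m \sum_i p i * F m i.
Proof. by rewrite bigA_distr_bigA; apply: eq_bigr => x _; rewrite big_split. Qed.

(* Sub-Gaussian bound; it yields moments of the weighted sums uniformly in [N]. *)
Lemma iid_expect_expR N (h : 'I_N -> R) (f : I -> R) :
  (forall i, `|f i| <= 1) -> \sum_i p i * f i = 0 -> \sum_m h m ^+ 2 = 1 ->
  \sum_x iid_weight x * expR (\sum_m h m * f (x m)) <= expR 4.
Proof.
move=> f1 f0 h1; under eq_bigr do rewrite expR_sum.
rewrite (iid_expect_prod (fun m i => expR (h m * f i))).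
(* Each factor is then compared with [exp (4 h_m ^ 2)]; its linear term vanishes because [f] is
   centred. *)
have -> : 4 = \sum_m 4 * h m ^+ 2 by rewrite -mulr_sumr h1 mulr1.
rewrite expR_sum; apply: ler_prod => m _.
rewrite sumr_ge0/=; last by move=> i _; rewrite mulr_ge0// expR_ge0.
have hm : `|h m| <= 1.
  have h2 : h m ^+ 2 <= 1.
    by rewrite -h1 (bigD1 m)//= lerDl sumr_ge0// => j _; exact: sqr_ge0.
  by rewrite ler_norml; apply/andP; split; nra.
apply: le_trans (expR_ge1Dx _).
apply: (@le_trans _ _ (\sum_i (p i + h m * (p i * f i) + 4 * h m ^+ 2 * p i))).
  apply: ler_sum => i _.
  have hf : `|h m * f i| <= 1 by rewrite normrM mulr_ile1.
  have -> : p i + h m * (p i * f i) + 4 * h m ^+ 2 * p i =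
    p i * (1 + h m * f i + 4 * h m ^+ 2) by ring.
  apply: ler_wpM2l => //; apply: le_trans (expR_le_quad hf) _.
  rewrite lerD2l ler_pM2l// exprMn ler_piMr ?sqr_ge0//.
  by rewrite -[f i ^+ 2]real_normK ?num_real// expr_le1.
by rewrite !big_split/= -!mulr_sumr f0 p1 mulr0 addr0 mulr1.
Qed.

(** After scaling by [c], the cube is at most [6 (exp S + exp (- S))], and the sub-Gaussian bound
    for [f] and [- f] gives [exp 4] twice. *)
Lemma iid_third_moment N (h : 'I_N -> R) (f : I -> R) (c : R) : 0 < c ->
  (forall i, `|f i| <= c) -> \sum_i p i * f i = 0 -> \sum_m h m ^+ 2 = 1 ->
  \sum_x iid_weight x * `|\sum_m h m * f (x m)| ^+ 3 <= c ^+ 3 * (12 * expR 4).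
Proof.
move=> c0 fc f0 h1.
pose fn i := c^-1 * f i; pose S (x : {ffun 'I_N -> I}) := \sum_m h m * fn (x m).
have SE (x : {ffun 'I_N -> I}) : \sum_m h m * f (x m) = c * S x.
  by rewrite mulr_sumr; apply: eq_bigr => m _; rewrite /fn; field; exact: lt0r_neq0.
have fn1 i : `|fn i| <= 1 by rewrite normrM gtr0_norm ?invr_gt0// mulrC ler_pdivrMr// mul1r.
have fn0 : \sum_i p i * fn i = 0.
  by under eq_bigr do rewrite mulrCA; rewrite -mulr_sumr f0 mulr0.
have fm1 i : `|- fn i| <= 1 by rewrite normrN.
have fm0 : \sum_i p i * - fn i = 0.
  by under eq_bigr do rewrite mulrN; rewrite sumrN fn0 oppr0.
have E1 := iid_expect_expR fn1 fn0 h1; have E2 := iid_expect_expR fm1 fm0 h1.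
apply: (@le_trans _ _ (\sum_x c ^+ 3 * (6 * (iid_weight x * expR (\sum_m h m * fn (x m)) +
    iid_weight x * expR (\sum_m h m * - fn (x m)))))).
  apply: ler_sum => x _; rewrite SE normrM (gtr0_norm c0) exprMn -mulrDr.
  have SN : \sum_m h m * - fn (x m) = - S x.
    by rewrite -sumrN; apply: eq_bigr => m _; rewrite mulrN.
  rewrite SN -/(S x) [leLHS]mulrCA ler_pM2l ?exprn_gt0// [leRHS]mulrCA.
  by apply: ler_wpM2l; [exact: iid_weight_ge0 | exact: cube_le_expR].
rewrite -mulr_sumr -mulr_sumr big_split/= ler_pM2l ?exprn_gt0//.
move: E1 E2; set a := \sum_x _; set b := \sum_x _; lra.
Qed.

End iid_sums.

(** * Averaging the product of phase factors over the symbols *)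

Section rotated_sum.
Context {R : realType} (I : finType) (p g1 g2 : I -> R) (chi : R -> R -> R[i]).
Variables (vc vs K c : R).
Hypotheses (p0 : forall i, 0 <= p i) (p1 : \sum_i p i = 1).
Hypotheses (c0 : 0 < c) (g1c : forall i, `|g1 i| <= c) (g2c : forall i, `|g2 i| <= c).
Hypotheses (g10 : \sum_i p i * g1 i = 0) (g20 : \sum_i p i * g2 i = 0).
Hypotheses (vc0 : 0 <= vc) (vs0 : 0 <= vs) (K0 : 0 <= K).
Hypothesis chi1 : forall a b, `|chi a b| <= 1.
Hypothesis chiE : forall a b,
  `|chi a b - (expR (- ((vc * a ^+ 2 + vs * b ^+ 2) / 2)))%:C| <=
  (K * (`|a| ^+ 3 + `|b| ^+ 3))%:C.
Notation H := (@hadamard R _).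
Notation s2 := ((Num.sqrt 2)^-1 : R).

Let G i := (vc * g1 i ^+ 2 + vs * g2 i ^+ 2) / 2.

Let G0 i : 0 <= G i.
Proof. by rewrite divr_ge0// addr_ge0// mulr_ge0// sqr_ge0. Qed.

Let mean_G : R := \sum_i p i * G i.

Let normC_real (a : R) : `|a%:C| = `|a|%:C.
Proof. by rewrite normc_def /= expr0n addr0 sqrtr_sqr. Qed.

Let normC_exp t : 0 <= t -> `|(expR (- t))%:C| <= 1 :> R[i].
Proof. by move=> t0; rewrite normC_real lecR ger0_norm ?expR_ge0// expR_neg_le1. Qed.

Let norm_had l (k j : 'I_(2 ^ l)) : `|H k j| = s2 ^+ l.
Proof.
have s0 : 0 <= s2 by rewrite invr_ge0 sqrtr_ge0.
apply/eqP; rewrite -(@eqrXn2 _ 2)// ?exprn_ge0// real_normK ?num_real// sqr_hadamard.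
by rewrite exprAC exprVn sqr_sqrtr// exprVn.
Qed.

Definition mix l (g : I -> R) (x : {ffun 'I_(2 ^ l) -> I}) (k : 'I_(2 ^ l)) : R :=
  \sum_m H k m * g (x m).

(* Parseval exchanges the product over rows with a product over symbols. *)
Let gauss_part l (j : 'I_(2 ^ l)) (x : {ffun 'I_(2 ^ l) -> I}) :
  \prod_k (expR (- ((vc * (H k j * mix g1 x k) ^+ 2 + vs * (H k j * mix g2 x k) ^+ 2) / 2))) =
  \prod_m expR (- ((2 ^+ l)^-1 * G (x m))).
Proof.
rewrite -!expR_sum; congr expR; rewrite !sumrN; congr (- _).
have E k : (vc * (H k j * mix g1 x k) ^+ 2 + vs * (H k j * mix g2 x k) ^+ 2) / 2 =
    (2 ^+ l)^-1 / 2 * (vc * mix g1 x k ^+ 2 + vs * mix g2 x k ^+ 2).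
  by rewrite !exprMn sqr_hadamard; ring.
rewrite (eq_bigr _ (fun k _ => E k)) -mulr_sumr big_split/= -!mulr_sumr !hadamard_parseval.
rewrite /G -mulr_suml big_split/= -!mulr_sumr; ring.
Qed.

Let gauss_mean l (j : 'I_(2 ^ l)) :
  \sum_x iid_weight p x * \prod_k
    (expR (- ((vc * (H k j * mix g1 x k) ^+ 2 + vs * (H k j * mix g2 x k) ^+ 2) / 2))) =
  (\sum_i p i * expR (- ((2 ^+ l)^-1 * G i))) ^+ (2 ^ l).
Proof.
under eq_bigr do rewrite gauss_part.
rewrite (iid_expect_prod p (fun _ i => expR (- ((2 ^+ l)^-1 * G i)))).
by rewrite prodr_const card_ord.
Qed.

(** Both terms are powers with [N = 2 ^ l] equal factors. The factors differ by a second-order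
    remainder of size [N ^ (-2)], hence the powers by [N ^ (-1)], which is weakened to [N ^ (-1/2)]
    to match the other error. *)
Let poisson_limit l :
  `|(\sum_i p i * expR (- ((2 ^+ l)^-1 * G i))) ^+ (2 ^ l) - expR (- mean_G)| <=
  (\sum_i p i * G i ^+ 2 + mean_G ^+ 2) * s2 ^+ l.
Proof.
set e := (2 ^+ l)^-1.
have e0 : 0 < e by rewrite invr_gt0 exprn_gt0.
have m0 : 0 <= mean_G by rewrite sumr_ge0// => i _; exact: mulr_ge0.
set a := \sum_i _.
have a1 : `|a| <= 1.
  rewrite ger0_norm; last by rewrite sumr_ge0// => i _; rewrite mulr_ge0// expR_ge0.
  rewrite -p1; apply: ler_sum => i _; apply: ler_piMr => //.
  by apply: expR_neg_le1; rewrite mulr_ge0// ltW.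
pose b := expR (- (e * mean_G)).
have em0 : 0 <= e * mean_G by rewrite mulr_ge0// ltW.
have b1 : `|b| <= 1 by rewrite ger0_norm ?expR_ge0//; exact: expR_neg_le1.
have -> : expR (- mean_G) = b ^+ (2 ^ l).
  by rewrite /b -expRM_natl; congr expR; rewrite mulrN natrX mulrA /e mulfV ?mul1r.
have -> : a ^+ (2 ^ l) - b ^+ (2 ^ l) = \prod_(k < 2 ^ l) a - \prod_(k < 2 ^ l) b.
  by rewrite !prodr_const !card_ord.
apply: le_trans (prod_sub_le (fun _ => a1) (fun _ => b1)) _.
rewrite sumr_const card_ord -[leLHS]mulr_natl natrX.
have ab : `|a - b| <= e ^+ 2 * (\sum_i p i * G i ^+ 2 + mean_G ^+ 2).
  have -> : a - b = \sum_i p i * (expR (- (e * G i)) - 1 + e * G i) - (b - 1 + e * mean_G).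
    have -> : \sum_i p i * (expR (- (e * G i)) - 1 + e * G i) = a - 1 + e * mean_G.
      rewrite /a /mean_G mulr_sumr -[X in _ - X + _]p1 -sumrB -big_split/=.
      by apply: eq_bigr => i _; ring.
    ring.
  apply: le_trans (ler_normB _ _) _; rewrite mulrDr; apply: lerD; last first.
    by rewrite -exprMn; exact: expR_neg_quad.
  apply: le_trans (ler_norm_sum _ _ _) _; rewrite mulr_sumr; apply: ler_sum => i _.
  rewrite normrM (ger0_norm (p0 i)) [leRHS]mulrCA; apply: ler_wpM2l => //.
  by rewrite -exprMn; apply: expR_neg_quad; rewrite mulr_ge0// ltW.
apply: (@le_trans _ _ (2 ^+ l * (e ^+ 2 * (\sum_i p i * G i ^+ 2 + mean_G ^+ 2)))).
  by apply: ler_wpM2l => //; exact: exprn_ge0.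
have -> : 2 ^+ l * (e ^+ 2 * (\sum_i p i * G i ^+ 2 + mean_G ^+ 2)) =
    (\sum_i p i * G i ^+ 2 + mean_G ^+ 2) * e.
  by rewrite /e; field; rewrite expf_neq0.
apply: ler_wpM2l.
  by rewrite addr_ge0 ?sqr_ge0// sumr_ge0// => i _; rewrite mulr_ge0// sqr_ge0.
have s0 : 0 <= s2 by rewrite invr_ge0 sqrtr_ge0.
have sE : s2 * s2 = 2^-1 by rewrite -invfM -expr2 sqr_sqrtr.
rewrite /e -exprVn lerXn2r ?nnegrE ?invr_ge0//; nra.
Qed.

(** In the cubic error of row [k], one factor [|H k j|] equals [N ^ (-1/2)] and is the rate; the
    remaining squares add up to 1 over the column and only average the third moments. *)
Lemma rotated_sum_estimate l (j : 'I_(2 ^ l)) :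
  `|\sum_x (iid_weight p x)%:C * \prod_k chi (H k j * mix g1 x k) (H k j * mix g2 x k) -
    (expR (- mean_G))%:C| <=
  ((K * (2 * (c ^+ 3 * (12 * expR 4))) + (\sum_i p i * G i ^+ 2 + mean_G ^+ 2)) * s2 ^+ l)%:C.
Proof.
set L := (\sum_i p i * expR (- ((2 ^+ l)^-1 * G i))) ^+ (2 ^ l).
have LE : L%:C = \sum_x (iid_weight p x)%:C * \prod_k
    (expR (- ((vc * (H k j * mix g1 x k) ^+ 2 + vs * (H k j * mix g2 x k) ^+ 2) / 2)))%:C.
  rewrite /L -(gauss_mean j) rmorph_sum/=; apply: eq_bigr => x _.
  by rewrite rmorphM; congr (_ * _); rewrite rmorph_prod.
rewrite -[X in `|X|](subrKA L%:C) mulrDl rmorphD/=.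
apply: le_trans (ler_normD _ _) _; apply: lerD; last first.
  by rewrite -rmorphB/= normC_real lecR; exact: poisson_limit.
rewrite LE -sumrB; apply: le_trans (ler_norm_sum _ _ _) _.
pose M x : R := \sum_k s2 ^+ l * (H k j ^+ 2 * (K * (`|mix g1 x k| ^+ 3 + `|mix g2 x k| ^+ 3))).
apply: (@le_trans _ _ (\sum_x (iid_weight p x * M x)%:C)).
  apply: ler_sum => x _; rewrite -mulrBr normrM normC_real (ger0_norm (iid_weight_ge0 p0 x)).
  rewrite rmorphM/=; apply: ler_wpM2l; first by rewrite lecR iid_weight_ge0.
  apply: le_trans (prod_sub_le _ _) _ => [k|k|]; first exact: chi1.
    by apply: normC_exp; rewrite divr_ge0// addr_ge0// mulr_ge0// sqr_ge0.
  rewrite /M rmorph_sum/=; apply: ler_sum => k _.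
  apply: le_trans (chiE _ _) _; rewrite lecR !normrM !exprMn -mulrDr norm_had.
  rewrite -(real_normK (num_real (H k j))) norm_had le_eqVlt; apply/orP; left.
  apply/eqP; ring.
rewrite -rmorph_sum/= lecR.
have -> : \sum_x iid_weight p x * M x = s2 ^+ l * (K * \sum_k H k j ^+ 2 *
    (\sum_x iid_weight p x * `|mix g1 x k| ^+ 3 + \sum_x iid_weight p x * `|mix g2 x k| ^+ 3)).
  rewrite /M; under eq_bigr do rewrite mulr_sumr.
  rewrite exchange_big/= !mulr_sumr; apply: eq_bigr => k _.
  by rewrite -big_split/= !mulr_sumr; apply: eq_bigr => x _; ring.
rewrite mulrC; apply: ler_wpM2r; first by rewrite exprn_ge0// invr_ge0 sqrtr_ge0.
apply: ler_wpM2l => //.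
have third (g : I -> R) (k : 'I_(2 ^ l)) : (forall i, `|g i| <= c) -> \sum_i p i * g i = 0 ->
    \sum_x iid_weight p x * `|mix g x k| ^+ 3 <= c ^+ 3 * (12 * expR 4).
  by move=> gc g0; apply: (@iid_third_moment _ _ _ p0 p1 _ (fun m => H k m)) => //; exact: hadamard_row.
apply: (@le_trans _ _ (\sum_k H k j ^+ 2 * (2 * (c ^+ 3 * (12 * expR 4))))).
  apply: ler_sum => k _; apply: ler_wpM2l; first exact: sqr_ge0.
  by rewrite mulr_natl mulr2n; apply: lerD; exact: third.
rewrite -mulr_suml ler_piMl//.
  by rewrite !mulr_ge0 ?expR_ge0 ?(ltW c0).
have := hadamard_dot j j; rewrite eqxx => /= h; rewrite le_eqVlt; apply/orP; left; apply/eqP.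
by rewrite -[RHS]h; apply: eq_bigr => k _; rewrite expr2.
Qed.

End rotated_sum.

(** * Taylor remainders with explicit constants *)

Section taylor.
Context {R : realType}.
Implicit Types (x q t : R).

(** The mean value theorem raises the order of a bound by one while keeping its constant, so the
    trigonometric estimates follow from one another. *)
Lemma mvt_power_bound (f df : R -> R) (C : R) k x :
  (forall t, is_derive t (1 : R) f (df t)) -> f 0 = 0 -> 0 <= C ->
  (forall t, `|df t| <= C * `|t| ^+ k) -> `|f x| <= C * `|x| ^+ k.+1.
Proof.
move=> dF f0 C0 dfC.
have cf : continuous f.
  by move=> t; apply: differentiable_continuous; apply/derivable1_diffP; have [] := dF t.
have mvt a b : a <= b -> exists2 c : R, a <= c <= b & f b - f a = df c * (b - a).
  move=> ab; have [|c] := @MVT_segment R f df a b ab (fun t _ => dF t).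
    exact: continuous_subspaceT.
  by rewrite in_itv => ? ?; exists c.
have fin c : `|c| <= `|x| -> `|f x| = `|df c| * `|x| -> `|f x| <= C * `|x| ^+ k.+1.
  move=> cx ->; rewrite exprSr mulrA; apply: ler_wpM2r => //.
  apply: le_trans (dfC c) _; apply: ler_wpM2l => //.
  by rewrite lerXn2r// nnegrE.
case: (lerP 0 x) => x0.
  have [c /andP[c0 cx]] := mvt _ _ x0; rewrite f0 !subr0 => fx.
  by apply: (fin c); rewrite ?fx ?normrM// !ger0_norm.
have [c /andP[cx c0]] := mvt _ _ (ltW x0); rewrite f0 !sub0r => fx.
apply: (fin c); first by rewrite !ler0_norm ?lerN2// ltW.
by rewrite -normrN fx normrM normrN.
Qed.

Let dsin t : is_derive t (1 : R) sin (cos t). Proof. exact: is_derive_sin. Qed.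

Let dcos1 t : is_derive t (1 : R) (fun t => cos t - 1) (- sin t).
Proof. by apply: (is_derive_eq (is_deriveB _ _)); rewrite subr0. Qed.

Lemma sin_le_norm x : `|sin x| <= `|x|.
Proof.
have := @mvt_power_bound sin cos 1 0 x dsin (sin0 R) ler01.
by rewrite expr1 mul1r; apply => t; rewrite expr0 mul1r ler_norml cos_geN1 cos_le1.
Qed.

Lemma cos_sub1_le x : `|cos x - 1| <= `|x| ^+ 2.
Proof.
have := @mvt_power_bound (fun t => cos t - 1) (fun t => - sin t) 1 1 x dcos1.
rewrite mul1r; apply => //; first by rewrite cos0 subrr.
by move=> t; rewrite mul1r normrN expr1 sin_le_norm.
Qed.

Lemma sin_sub_le x : `|sin x - x| <= `|x| ^+ 3.
Proof.
have := @mvt_power_bound (fun t => sin t - t) (fun t => cos t - 1) 1 2 x.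
rewrite mul1r; apply => //; first by rewrite sin0 subrr.
by move=> t; rewrite mul1r cos_sub1_le.
Qed.

(** Interpolates between the cubic bound for [|x| <= 1] and the linear bound beyond. The square is
    the order that integrates to a cubic remainder for the cosine. *)
Lemma sin_sub_le2 x : `|sin x - x| <= 2 * `|x| ^+ 2.
Proof.
have h1 := sin_sub_le x.
have h2 : `|sin x - x| <= 2 * `|x|.
  by apply: le_trans (ler_normB _ _) _; rewrite mulr_natl mulr2n lerD2r sin_le_norm.
have x0 : 0 <= `|x| by [].
move: (`|sin x - x|) (`|x|) h1 h2 x0 => a y h1 h2 y0.
have [y1|y1] := lerP y 1; nra.
Qed.

Lemma cos_quad_le x : `|cos x - 1 + x ^+ 2 / 2| <= 2 * `|x| ^+ 3.
Proof.
apply: (@mvt_power_bound (fun t => cos t - 1 + t ^+ 2 / 2) (fun t => - sin t + t)) => //.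
- move=> t.
  have := is_derive1D (dcos1 t) (is_derive1M (is_derive1M (is_derive_id t (1 : R))
    (is_derive_id t (1 : R))) (is_derive_cst (2^-1 : R) t (1 : R))).
  by move=> h; apply: (is_derive_eq h); rewrite /cst /=; field.
- by rewrite cos0 subrr expr0n mul0r addr0.
- by move=> t; rewrite -normrN opprD opprK sin_sub_le2.
Qed.

(** The remainder is at most [t ^ 2 <= q ^ 4] and at most [t <= q ^ 2]; the first serves for
    [q <= 1], the second for [q > 1]. *)
Lemma expR_neg_cube t q : 0 <= q -> 0 <= t -> t <= q ^+ 2 ->
  `|expR (- t) - 1 + t| <= q ^+ 3.
Proof.
move=> q0 t0 tq; have h1 := expR_neg_quad t0.
have h2 : `|expR (- t) - 1 + t| <= t.
  have e1 : 1 - t <= expR (- t) := expR_ge1Dx _.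
  have e2 := expR_neg_le1 t0.
  by rewrite ger0_norm; lra.
move: (`|_|) h1 h2 => a h1 h2.
have [q1|q1] := lerP q 1.
  apply: le_trans h1 _; apply: le_trans (_ : (q ^+ 2) ^+ 2 <= _).
    by rewrite lerXn2r// nnegrE ?sqr_ge0.
  by rewrite -exprM; apply: ler_wiXn2l.
apply: le_trans h2 _; apply: le_trans tq _.
by apply: ler_weXn2l => //; exact: ltW.
Qed.

End taylor.

Section charfun_expansion.
Context d (T : measurableType d) {R : realType} (P : probability T R).
Variables (f : T -> R).
Hypothesis bf : bmeas f.

Let bcos : bmeas (fun t => cos (f t)).
Proof.
split; first by apply: (measurableT_comp _ bf.1); apply: continuous_measurable_fun; exact: continuous_cos.
by exists 1 => x; rewrite ler_norml cos_geN1 cos_le1.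
Qed.

Let bsin : bmeas (fun t => sin (f t)).
Proof.
split; first by apply: (measurableT_comp _ bf.1); apply: continuous_measurable_fun; exact: continuous_sin.
by exists 1 => x; rewrite ler_norml sin_geN1 sin_le1.
Qed.

Lemma lec_normE (z : R[i]) (e : R) : (`|z| <= e%:C) = (Normc.normc z <= e).
Proof. by rewrite lecR. Qed.

(* Schwarz inequality: with [x + i y] the integral, integrate
   [2 (x cos + y sin) <= x ^ 2 + y ^ 2 + 1]. *)
Lemma Cint_expi_le1 : `|Cint P (fun t => expi (f t))| <= 1.
Proof.
rewrite -[1]/(1%:C) lec_normE /Cint /= -[leRHS]sqrtr1 ler_wsqrtr//.
set x := Rintegral _ _ _; set y := Rintegral _ _ _.
have : \int[P]_t (2 * x * cos (f t) + 2 * y * sin (f t)) <= \int[P]_t (x ^+ 2 + y ^+ 2 + 1).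
  apply: le_Rint => [||t]; first (apply: bmeasD; apply: bmeasM => //; exact: bmeas_cst).
    exact: bmeas_cst.
  have := cos2Dsin2 (f t); have := sqr_ge0 (x - cos (f t)); have := sqr_ge0 (y - sin (f t)).
  rewrite !expr2; lra.
rewrite RintD ?RintZl ?Rint_cst//; try (apply: bmeasM => //; exact: bmeas_cst).
rewrite -/x -/y !expr2; lra.
Qed.

(** The constant 4 adds 2 for the cosine, 1 for the sine, whose linear term has mean 0, and 1 for
    the exponential. *)
Lemma Cint_expi_expansion (q : R) : 0 <= q -> (forall t, `|f t| <= q) -> \int[P]_t f t = 0 ->
  `|Cint P (fun t => expi (f t)) - (expR (- ((\int[P]_t (f t ^+ 2)) / 2)))%:C| <= (4 * q ^+ 3)%:C.
Proof.
move=> q0 fq f0; set V := \int[P]_t _.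
have b1 := bmeas_cst (T := T) (1 : R).
have bV : bmeas (fun t => f t ^+ 2) by exact: bmeasM.
have bV2 : bmeas (fun t => f t ^+ 2 / 2) by apply: bmeasM => //; exact: bmeas_cst.
have f3 t : `|f t| ^+ 3 <= q ^+ 3 by rewrite lerXn2r// nnegrE.
have V0 : 0 <= V by apply: Rintegral_ge0 => t _; exact: sqr_ge0.
have VE : \int[P]_t (f t ^+ 2 / 2) = V / 2 by rewrite RintZr.
have Vq : V / 2 <= q ^+ 2.
  have : V <= q ^+ 2.
    rewrite -(Rint_cst P (q ^+ 2)); apply: le_Rint => //; first exact: bmeas_cst.
    by move=> t; rewrite -[f t ^+ 2]real_normK ?num_real// lerXn2r// nnegrE.
  by move: V0; set q2 := q ^+ 2; lra.
have hc : `|\int[P]_t cos (f t) - 1 + V / 2| <= 2 * q ^+ 3.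
  have -> : \int[P]_t cos (f t) - 1 + V / 2 = \int[P]_t (cos (f t) - 1 + f t ^+ 2 / 2).
    by rewrite RintD ?RintB ?Rint_cst ?VE//; exact: bmeasB.
  apply: Rint_norm_le => [|t]; first by apply: bmeasD => //; exact: bmeasB.
  by apply: le_trans (cos_quad_le _) _; rewrite ler_pM2l.
have hs : `|\int[P]_t sin (f t)| <= q ^+ 3.
  have -> : \int[P]_t sin (f t) = \int[P]_t (sin (f t) - f t) by rewrite RintB// f0 subr0.
  apply: Rint_norm_le => [|t]; first exact: bmeasB.
  exact: le_trans (sin_sub_le _) _.
have he := expR_neg_cube q0 (divr_ge0 V0 (ltW (ltr0Sn R 1))) Vq.
rewrite lec_normE; apply: le_trans (normc_le_l1 _) _ => /=.
move: hc hs he; rewrite -!/(expi _) /= oppr0 addr0.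
set I := \int[P]_t cos _; set J := \int[P]_t sin _; set E := expR _.
move=> hc hs he.
have -> : I - E = (I - 1 + V / 2) - (E - 1 + V / 2) by ring.
have := ler_normB (I - 1 + V / 2) (E - 1 + V / 2).
lra.
Qed.

End charfun_expansion.

(** * The centred phase factor *)

Section phase_noise.
Context {R : realType} (sigma : R).
Hypothesis sigma0 : 0 < sigma.
Notation N := (normal_law 0 sigma).
Notation alpha := (expR (- (sigma ^+ 2 / 2))).

Definition phase_chi (a b : R) : R[i] :=
  Cint N (fun t => expi ((cos t - alpha) * a - sin t * b)).

Definition cos_var : R := \int[N]_t ((cos t - alpha) ^+ 2).

Definition sin_var : R := \int[N]_t (sin t ^+ 2).

Let bcos c : bmeas (fun t : R => cos (c * t)).
Proof.
split; last by exists 1 => x; rewrite ler_norml cos_geN1 cos_le1.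
by apply: (measurableT_comp (continuous_measurable_fun (@continuous_cos R))); exact: measurable_funM.
Qed.

Let bsin c : bmeas (fun t : R => sin (c * t)).
Proof.
split; last by exists 1 => x; rewrite ler_norml sin_geN1 sin_le1.
by apply: (measurableT_comp (continuous_measurable_fun (@continuous_sin R))); exact: measurable_funM.
Qed.

Let bcos1 : bmeas (cos : R -> R).
Proof. by have := bcos 1; under eq_fun do rewrite mul1r. Qed.

Let bsin1 : bmeas (sin : R -> R).
Proof. by have := bsin 1; under eq_fun do rewrite mul1r. Qed.

Let mean_cos : \int[N]_t cos t = alpha.
Proof.
rewrite Rint_normal_law//; have := normal_cos 0 sigma0 1.
by under eq_Rintegral do rewrite mul1r subr0; rewrite expr1n mulr1.
Qed.

Let mean_sin c : \int[N]_t sin (c * t) = 0.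
Proof.
rewrite Rint_normal_law//; have := normal_sin 0 sigma0 c.
by under eq_Rintegral do rewrite subr0.
Qed.

Let mean_sin1 : \int[N]_t sin t = 0.
Proof. by rewrite -[RHS](mean_sin 1); under [RHS]eq_Rintegral do rewrite mul1r. Qed.

Let bc : bmeas (fun t : R => cos t - alpha).
Proof. by apply: bmeasB => //; exact: bmeas_cst. Qed.

(** The product [cos t sin t] is half of [sin (2 t)], which has mean 0. Hence the quadratic exponent
    has no mixed term in [a] and [b]. *)
Let cov_cos_sin : \int[N]_t ((cos t - alpha) * sin t) = 0.
Proof.
transitivity (\int[N]_t (2^-1 * sin (2 * t) - alpha * sin t)).
  by apply: eq_Rintegral => t _; rewrite mulr_natl sin_mulr2n -mulr_natl; field.
have bb (g : R -> R) (c : R) : bmeas g -> bmeas (fun t => c * g t).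
  by move=> bg; apply: bmeasM => //; exact: bmeas_cst.
rewrite RintB; [|exact: (bb (fun t => sin (2 * t)))|exact: bb].
by rewrite !RintZl// mean_sin mean_sin1 !mulr0 subrr.
Qed.

(** This is [E |exp (i t) - alpha| ^ 2 = 1 - alpha ^ 2], the source of the factor multiplying the
    symbol energy in the limit variance. *)
Lemma phase_varD : cos_var + sin_var = 1 - expR (- sigma ^+ 2).
Proof.
rewrite /cos_var /sin_var -RintD; [|exact: bmeasM|exact: bmeasM].
transitivity (\int[N]_t (1 + alpha ^+ 2 - (2 * alpha) * cos t)).
  by apply: eq_Rintegral => t _; rewrite sin2cos2; ring.
rewrite RintB; [|exact: bmeas_cst|by apply: bmeasM => //; exact: bmeas_cst].
rewrite Rint_cst RintZl// mean_cos.
have -> : expR (- sigma ^+ 2) = alpha ^+ 2.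
  by rewrite [RHS]expr2 -expRD -opprD -splitr.
ring.
Qed.

Lemma cos_var_ge0 : 0 <= cos_var.
Proof. by apply: Rintegral_ge0 => t _; exact: sqr_ge0. Qed.

Lemma sin_var_ge0 : 0 <= sin_var.
Proof. by apply: Rintegral_ge0 => t _; exact: sqr_ge0. Qed.

Let bX (a b : R) : bmeas (fun t : R => (cos t - alpha) * a - sin t * b).
Proof. by apply: bmeasB; apply: bmeasM => //; exact: bmeas_cst. Qed.

Lemma phase_chi_le1 a b : `|phase_chi a b| <= 1.
Proof. exact: Cint_expi_le1. Qed.

Lemma phase_chi_expansion a b :
  `|phase_chi a b - (expR (- ((cos_var * a ^+ 2 + sin_var * b ^+ 2) / 2)))%:C| <=
  (128 * (`|a| ^+ 3 + `|b| ^+ 3))%:C.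
Proof.
have al0 : 0 < alpha := expR_gt0 _.
have al1 : alpha <= 1 by apply: expR_neg_le1; rewrite divr_ge0// sqr_ge0.
have V : \int[N]_t (((cos t - alpha) * a - sin t * b) ^+ 2) =
    cos_var * a ^+ 2 + sin_var * b ^+ 2.
  transitivity (\int[N]_t ((cos t - alpha) ^+ 2 * a ^+ 2 + sin t ^+ 2 * b ^+ 2 -
      (cos t - alpha) * sin t * (2 * a * b))).
    by apply: eq_Rintegral => t _; ring.
  have bb (g : R -> R) (c : R) : bmeas g -> bmeas (fun t => g t * c).
    by move=> bg; apply: bmeasM => //; exact: bmeas_cst.
  have bcc : bmeas (fun t : R => (cos t - alpha) ^+ 2) by exact: bmeasM.
  have bss : bmeas (fun t : R => sin t ^+ 2) by exact: bmeasM.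
  have bcs : bmeas (fun t : R => (cos t - alpha) * sin t) by exact: bmeasM.
  rewrite RintB; [|by apply: bmeasD; exact: bb|exact: bb].
  rewrite RintD; [|exact: bb|exact: bb].
  by rewrite !RintZr// cov_cos_sin mul0r subr0.
have M0 : \int[N]_t ((cos t - alpha) * a - sin t * b) = 0.
  have bb (g : R -> R) (c : R) : bmeas g -> bmeas (fun t => g t * c).
    by move=> bg; apply: bmeasM => //; exact: bmeas_cst.
  rewrite RintB; [|exact: bb|exact: bb].
  rewrite !RintZr// mean_sin1 RintB//; last exact: bmeas_cst.
  by rewrite mean_cos Rint_cst subrr !mul0r subrr.
(* The exponent is bounded by [2 (|a| + |b|)], so the error is [32 (|a| + |b|) ^ 3]; convexity of
   the cube contributes another factor 4, which gives 128. *)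
have := @Cint_expi_expansion _ _ _ N _ (bX a b) (2 * (`|a| + `|b|)).
rewrite V => h; apply: le_trans (h _ _ M0) _.
- by rewrite mulr_ge0// addr_ge0.
- move=> t; apply: le_trans (ler_normB _ _) _; rewrite !normrM.
  have c2 : `|cos t - alpha| <= 2.
    rewrite ler_norml; have := cos_geN1 t; have := cos_le1 t; move: al0 al1.
    by move=> *; apply/andP; split; lra.
  have s1 : `|sin t| <= 1 by rewrite ler_norml sin_geN1 sin_le1.
  have := ler_wpM2r (normr_ge0 a) c2; have := ler_wpM2r (normr_ge0 b) s1.
  have := normr_ge0 b; lra.
- rewrite lecR; have := normr_ge0 a; have := normr_ge0 b.
  move: (`|a|) (`|b|) => p q q0 p0.
  have : 0 <= (p + q) * (p - q) ^+ 2 by rewrite mulr_ge0 ?sqr_ge0// addr_ge0.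
  rewrite !exprS !expr0; lra.
Qed.

End phase_noise.

(** * Noise, phase and symbol laws *)

Section gaussian_moments.
Context d (T : measurableType d) {R : realType} (P : probability T R).

(** Deviation 0 is treated apart, the law then being a Dirac mass with no density: [U] has the law
    of the constant [m]. *)
Lemma gaussian_law0_integral (U : T -> R) m (f : R -> R) : measurable_fun setT U ->
  is_gaussian P m 0 U -> measurable_fun setT f ->
  P.-integrable setT (EFin \o (f \o U)) /\ \int[P]_t f (U t) = f m.
Proof.
move=> mU gU mf.
have cU A : measurable A -> P ((cst m : T -> R) @^-1` A) = P (U @^-1` A).
  move=> mA; rewrite gU// /gaussian_law eqxx preimage_cst diracE.
  by case: ifPn => _; rewrite ?probability_setT ?measure0.
have [iU EU] := @eq_law_integral R _ _ _ _ _ _ P P (cst m) U (@measurable_cst _ _ _ _ setT m) mU cU f mf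
  (@bmeas_integrable _ _ _ P _ (bmeas_cst (f m))).
by split => //; rewrite -[RHS](Rint_cst P (f m)) /Rintegral -EU.
Qed.

Lemma gaussian_law_integral (U : T -> R) m sd (f : R -> R) : measurable_fun setT U ->
  sd != 0 -> is_gaussian P m sd U -> measurable_fun setT f ->
  (normal_prob m sd).-integrable setT (EFin \o f) ->
  P.-integrable setT (EFin \o (f \o U)) /\ \int[P]_t f (U t) = \int[normal_prob m sd]_x f x.
Proof.
move=> mU sd0 gU mf if_; have [iN EN] := integral_normal_law mf if_.
have cU A : measurable A -> normal_law m sd ((id : R -> R) @^-1` A) = P (U @^-1` A).
  by move=> mA; rewrite gU// /gaussian_law (negbTE sd0).
have [iU EU] := @eq_law_integral R _ _ _ R _ _ (normal_law m sd) P id U (@measurable_id _ _ setT) mU cU f mf iN.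
by split => //; rewrite /Rintegral -EU EN.
Qed.

Lemma gaussian_moments (U : T -> R) m sd : measurable_fun setT U -> 0 <= sd ->
  is_gaussian P m sd U ->
  [/\ P.-integrable setT (EFin \o U), P.-integrable setT (EFin \o (fun t => U t ^+ 2)),
      \int[P]_t U t = m & \int[P]_t (U t ^+ 2) = m ^+ 2 + sd ^+ 2].
Proof.
move=> mU; rewrite le_eqVlt => /orP[/eqP <- gU|sd0 gU].
  have mid : measurable_fun setT (id : R -> R) by exact: measurable_id.
  have [i1 E1] := gaussian_law0_integral mU gU mid.
  have [i2 E2] := gaussian_law0_integral mU gU (measurable_funX 2 mid).
  by split => //; rewrite E2 expr0n addr0.
have mid : measurable_fun setT (id : R -> R) by exact: measurable_id.
have mid2 : measurable_fun setT (fun x : R => x ^+ 2) by exact: measurable_funX.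
have iN1 : (normal_prob m sd).-integrable setT (EFin \o (id : R -> R)).
  apply: (normal_integrable_quad sd0 (A := 1 + `|m|)) => // x.
  have h1 := ler_normD (x - m) m; rewrite subrK in h1.
  have h2 : `|x - m| <= 1 + (x - m) ^+ 2.
    rewrite -(real_normK (num_real (x - m))); move: (`|x - m|) => y; nra.
  have := normr_ge0 m; have := sqr_ge0 (x - m); nra.
have iN2 : (normal_prob m sd).-integrable setT (EFin \o (fun x : R => x ^+ 2)).
  apply: (normal_integrable_quad sd0 (A := 2 + 2 * m ^+ 2)) => // x.
  rewrite ger0_norm ?sqr_ge0//; have := sqr_ge0 (x - 2 * m); have := sqr_ge0 m.
  have := sqr_ge0 (m * (x - m)); nra.
have iN3 : (normal_prob m sd).-integrable setT (EFin \o (fun x : R => x - m)).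
  apply: (normal_integrable_quad sd0 (A := 1)) => [|x]; first exact: measurable_funB.
  by rewrite -(real_normK (num_real (x - m))); move: (`|x - m|) => y; nra.
have iN4 := normal_integrable_sqr m sd0.
have sd0' := lt0r_neq0 sd0.
have [i1 E1] := gaussian_law_integral mU sd0' gU mid iN1.
have [i2 E2] := gaussian_law_integral mU sd0' gU mid2 iN2.
have iC c : (normal_prob m sd).-integrable setT (EFin \o (fun=> c)).
  exact: (@bmeas_integrable _ _ _ (normal_prob m sd) _ (bmeas_cst c)).
have M1 : \int[normal_prob m sd]_x x = m.
  transitivity (\int[normal_prob m sd]_x ((x - m) + m)).
    by apply: eq_Rintegral => x _; rewrite subrK.
  by rewrite RintegralD// normal_mean0// Rint_cst add0r.
split => //; first by rewrite E1.
rewrite E2; transitivity (\int[normal_prob m sd]_x ((x - m) ^+ 2 + (2 * m * (x - m) + m ^+ 2))).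
  by apply: eq_Rintegral => x _; ring.
have iZ : (normal_prob m sd).-integrable setT (EFin \o (fun x : R => 2 * m * (x - m))).
  exact: (integrableZl measurableT (2 * m) iN3).
rewrite RintegralD//; last by rewrite (_ : _ \o _ = (EFin \o (fun x : R => 2 * m * (x - m))) \+ (EFin \o (fun=> m ^+ 2)))//; exact: integrableD.
by rewrite RintegralD// RintegralZl// normal_mean0// Rint_cst normal_variance// mulr0 add0r addrC.
Qed.

Lemma gaussian_charfun (U : T -> R) m sd : measurable_fun setT U -> 0 <= sd ->
  is_gaussian P m sd U ->
  \int[P]_t cos (U t) = cos m * expR (- (sd ^+ 2 / 2)) /\
  \int[P]_t sin (U t) = sin m * expR (- (sd ^+ 2 / 2)).
Proof.
move=> mU.
have mcos : measurable_fun setT (cos : R -> R) by apply: continuous_measurable_fun; exact: continuous_cos.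
have msin : measurable_fun setT (sin : R -> R) by apply: continuous_measurable_fun; exact: continuous_sin.
rewrite le_eqVlt => /orP[/eqP <- gU|sd0 gU].
  rewrite (gaussian_law0_integral mU gU mcos).2 (gaussian_law0_integral mU gU msin).2.
  by rewrite expr0n mul0r oppr0 expR0 !mulr1.
have sd0' := lt0r_neq0 sd0; set N := normal_prob m sd.
have bx (f : R -> R) : measurable_fun setT f -> (forall x, `|f x| <= 1) -> bmeas f.
  by move=> mf f1; split => //; exists 1.
have c1 x : `|cos x| <= 1 :> R by rewrite ler_norml cos_geN1 cos_le1.
have s1 x : `|sin x| <= 1 :> R by rewrite ler_norml sin_geN1 sin_le1.
have mB : measurable_fun setT (fun x : R => x - m) by exact: measurable_funB.
have bc := bx _ mcos c1; have bs := bx _ msin s1.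
have bcm : bmeas (fun x : R => cos (x - m)) := bx _ (measurableT_comp mcos mB) (fun=> c1 _).
have bsm : bmeas (fun x : R => sin (x - m)) := bx _ (measurableT_comp msin mB) (fun=> s1 _).
have Ec : \int[N]_x cos (x - m) = expR (- (sd ^+ 2 / 2)).
  have := normal_cos m sd0 1; rewrite expr1n mulr1 => <-.
  by apply: eq_Rintegral => x _; rewrite mul1r.
have Es : \int[N]_x sin (x - m) = 0.
  have := normal_sin m sd0 1 => <-.
  by apply: eq_Rintegral => x _; rewrite mul1r.
have bb (g : R -> R) (c : R) : bmeas g -> bmeas (fun t => g t * c).
  by move=> bg; apply: bmeasM => //; exact: bmeas_cst.
rewrite (gaussian_law_integral mU sd0' gU mcos (@bmeas_integrable _ _ _ N _ bc)).2.
rewrite (gaussian_law_integral mU sd0' gU msin (@bmeas_integrable _ _ _ N _ bs)).2.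
split.
  transitivity (\int[N]_x (cos (x - m) * cos m - sin (x - m) * sin m)).
    by apply: eq_Rintegral => x _; rewrite -cosD subrK.
  by rewrite (@RintB _ _ _ N _ _ (bb _ _ bcm) (bb _ _ bsm)) (@RintZr _ _ _ N _ _ bcm)
    (@RintZr _ _ _ N _ _ bsm) Ec Es mul0r subr0 mulrC.
transitivity (\int[N]_x (sin (x - m) * cos m + cos (x - m) * sin m)).
  by apply: eq_Rintegral => x _; rewrite -sinD subrK.
by rewrite (@RintD _ _ _ N _ _ (bb _ _ bsm) (bb _ _ bcm)) (@RintZr _ _ _ N _ _ bcm)
  (@RintZr _ _ _ N _ _ bsm) Ec Es mul0r add0r mulrC.
Qed.

End gaussian_moments.

(** * Circular Gaussian channel noise *)

Section circular_noise.
Context d (T : measurableType d) {R : realType} (P : probability T R) (Z : T -> R[i]).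
Hypothesis mZ : measurable_fun setT Z.
Implicit Types a b : R.

Definition linear_form a b t := a * complex.Re (Z t) + b * complex.Im (Z t).
Notation U := linear_form.

Lemma measurable_linear_formZ a b : measurable_fun setT (U a b).
Proof.
by apply: measurable_linear_form; [exact: (measurableT_comp measurable_Re mZ)
  |exact: (measurableT_comp measurable_Im mZ)].
Qed.
Let mU := measurable_linear_formZ.

Lemma expectationE (f : T -> R) : fine ('E_P[f])%E = \int[P]_t f t.
Proof. by rewrite unlock. Qed.

Lemma sqr_normcE (z : R[i]) : Normc.normc z ^+ 2 = complex.Re z ^+ 2 + complex.Im z ^+ 2.
Proof. by case: z => x y /=; rewrite sqr_sqrtr// addr_ge0 ?sqr_ge0. Qed.

Section quadratic_moments.
Hypothesis i2 : forall a b, P.-integrable setT (EFin \o (fun t => U a b t ^+ 2)).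

(** Polarization writes the mixed moment as a difference of squares of linear forms, whose
    integrability is what joint Gaussianity provides. *)
Lemma second_moment_polar a b :
  \int[P]_t (U a b t ^+ 2) = a ^+ 2 * \int[P]_t (U 1 0 t ^+ 2) +
    b ^+ 2 * \int[P]_t (U 0 1 t ^+ 2) +
    a * b / 2 * (\int[P]_t (U 1 1 t ^+ 2) - \int[P]_t (U 1 (-1) t ^+ 2)).
Proof.
have iZ (c a' b' : R) : P.-integrable setT (EFin \o (fun t => c * U a' b' t ^+ 2)).
  exact: (integrableZl measurableT c (i2 a' b')).
have iD (f g : T -> R) : P.-integrable setT (EFin \o f) -> P.-integrable setT (EFin \o g) ->
    P.-integrable setT (EFin \o (fun t => f t + g t)).
  by move=> i j; exact: (integrableD measurableT i j).
transitivity (\int[P]_t (a ^+ 2 * U 1 0 t ^+ 2 + b ^+ 2 * U 0 1 t ^+ 2 +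
    (a * b / 2 * U 1 1 t ^+ 2 + - (a * b / 2) * U 1 (-1) t ^+ 2))).
  by apply: eq_Rintegral => t _; rewrite /U; field.
rewrite RintegralD//; [|by apply: (iD _ _ _ _); exact: iZ..].
rewrite RintegralD//; [|exact: iZ..].
rewrite RintegralD//; [|exact: iZ..].
by rewrite !RintegralZl//; ring.
Qed.

Lemma cvariance_centered : \int[P]_t U 1 0 t = 0 -> \int[P]_t U 0 1 t = 0 ->
  cvariance P Z = (\int[P]_t (U 1 0 t ^+ 2) + \int[P]_t (U 0 1 t ^+ 2))%:E.
Proof.
move=> R0 I0.
have E0 : cexpectation P Z = 0.
  rewrite /cexpectation !expectationE; apply/eqP; rewrite eq_complex; apply/andP; split; apply/eqP.
    by rewrite /= -R0; apply: eq_Rintegral => t _; rewrite /U mul1r mul0r addr0.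
  by rewrite /= -I0; apply: eq_Rintegral => t _; rewrite /U mul1r mul0r add0r.
rewrite /cvariance E0 unlock.
have iE : P.-integrable setT (EFin \o (fun t => U 1 0 t ^+ 2 + U 0 1 t ^+ 2)).
  exact: (integrableD measurableT (i2 1 0) (i2 0 1)).
rewrite -RintegralD// /Rintegral fineK; last exact: integrable_fin_num.
apply: eq_integral => t _; congr EFin.
by rewrite subr0 sqr_normcE /U !mul1r !mul0r addr0 add0r.
Qed.

End quadratic_moments.

Hypotheses (gZ : complex_gaussian P Z) (cZ : circularly_symmetric P Z).
Variable N0 : R.
Hypothesis vZ : cvariance P Z = N0%:E.

Let i1 a b : P.-integrable setT (EFin \o U a b).
Proof. by have [m [sd [sd0 /(gaussian_moments (mU a b) sd0)[]]]] := gZ a b. Qed.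

Let i2 a b : P.-integrable setT (EFin \o (fun t => U a b t ^+ 2)).
Proof. by have [m [sd [sd0 /(gaussian_moments (mU a b) sd0)[]]]] := gZ a b. Qed.

(* Circular symmetry is only used for the rotation by [pi / 2]. *)
Let rotate a b (f : R -> R) : measurable_fun setT f ->
  P.-integrable setT (EFin \o (f \o U a b)) ->
  \int[P]_t f (U a b t) = \int[P]_t f (U b (- a) t).
Proof.
move=> mf if_.
pose F z := f (a * complex.Re z + b * complex.Im z).
have mF : measurable_fun setT F.
  apply: (measurableT_comp mf); apply: measurable_linear_form.
    exact: measurable_Re.
  exact: measurable_Im.
pose Z' t := expi (pi / 2) * Z t.
have Z'E t : Z' t = - complex.Im (Z t) +i* complex.Re (Z t).
  by rewrite /Z' /expi cos_pihalf sin_pihalf; case: (Z t) => x y; simpc.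
have mZ' : measurable_fun setT Z'.
  apply: measurable_complexP; under eq_fun do rewrite Z'E /=.
    by apply: measurable_funN; exact: (measurableT_comp measurable_Im mZ).
  exact: (measurableT_comp measurable_Re mZ).
have ZZ' A : measurable A -> P (Z @^-1` A) = P (Z' @^-1` A).
  by move=> mA; rewrite (cZ (pi / 2) mA).
rewrite (@eq_law_Rint R _ _ _ _ _ _ P P Z Z' mZ mZ' ZZ' F mF if_).
by apply: eq_Rintegral => t _; rewrite /F Z'E /U /=; congr f; ring.
Qed.

(** Two quarter turns change the sign of the form and keep its mean. *)
Let mean0 a b : \int[P]_t U a b t = 0.
Proof.
have mid : measurable_fun setT (id : R -> R) by exact: measurable_id.
have h1 := rotate mid (i1 a b); have h2 := rotate mid (i1 b (- a)).
have h3 : \int[P]_t U (- a) (- b) t = -1 * \int[P]_t U a b t.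
  by rewrite -RintegralZl//; apply: eq_Rintegral => t _; rewrite /U; ring.
move: h1 h2 h3 => /= -> ->; lra.
Qed.

(** A quarter turn exchanges [U 1 1] with [U 1 (-1)], which kills the mixed moment, and [U 0 1] with
    [U 1 0], which gives each coordinate half of the variance. *)
Let square a b : \int[P]_t (U a b t ^+ 2) = (a ^+ 2 + b ^+ 2) * (N0 / 2).
Proof.
have msq : measurable_fun setT (fun x : R => x ^+ 2) by exact: measurable_funX.
have h1 := rotate msq (i2 1 1).
have h2 := rotate msq (i2 0 1); rewrite oppr0 in h2.
have := cvariance_centered i2 (mean0 1 0) (mean0 0 1); rewrite vZ => -[h3].
rewrite second_moment_polar// h1 subrr mulr0 addr0 h2.
have -> : \int[P]_t (U 1 0 t ^+ 2) = N0 / 2 by move: h3; rewrite h2; lra.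
ring.
Qed.

Lemma circular_noise_charfun a b :
  Cint P (fun t => expi (U a b t)) = (expR (- ((a ^+ 2 + b ^+ 2) * (N0 / 4))))%:C.
Proof.
have [m [sd [sd0 gU]]] := gZ a b.
have [_ _ Em Es] := gaussian_moments (mU a b) sd0 gU.
have [Ec Esn] := gaussian_charfun (mU a b) sd0 gU.
have m0 : m = 0 by rewrite -Em mean0.
have sE : sd ^+ 2 / 2 = (a ^+ 2 + b ^+ 2) * (N0 / 4).
  have : sd ^+ 2 = (a ^+ 2 + b ^+ 2) * (N0 / 2) by rewrite -square Es m0 expr0n add0r.
  by move=> ->; field.
by rewrite /Cint /= Ec Esn m0 cos0 sin0 mul0r mul1r sE.
Qed.

End circular_noise.

Lemma eq_Rint_ae d (T : measurableType d) {R : realType} (P : probability T R) (f g : T -> R) :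
  measurable_fun setT f -> measurable_fun setT g -> (\forall t \ae P, f t = g t) ->
  \int[P]_t f t = \int[P]_t g t.
Proof.
move=> mf mg fg; rewrite /Rintegral; congr fine.
apply: ae_eq_integral => //; [exact/measurable_EFinP|exact/measurable_EFinP|].
by apply: filterS fg => t fgt _ /=; rewrite fgt.
Qed.

Lemma eq_Cint_ae d (T : measurableType d) {R : realType} (P : probability T R) (f g : T -> R[i]) :
  cbmeas f -> cbmeas g -> (\forall t \ae P, f t = g t) -> Cint P f = Cint P g.
Proof.
move=> [[fR _] [fI _]] [[gR _] [gI _]] fg; rewrite /Cint; congr (_ +i* _).
  by apply: eq_Rint_ae => //; apply: filterS fg => t ->.
by apply: eq_Rint_ae => //; apply: filterS fg => t ->.
Qed.

Section Cint_linear.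
Context d (T : measurableType d) {R : realType} (P : probability T R).

Lemma cbmeas_sum (I : Type) (r : seq I) (F : I -> T -> R[i]) :
  (forall i, cbmeas (F i)) -> cbmeas (fun t => \sum_(i <- r) F i t).
Proof.
move=> bF; split.
  by under eq_fun do rewrite Re_sum; apply: bmeas_sum => i; exact: (bF i).1.
by under eq_fun do rewrite Im_sum; apply: bmeas_sum => i; exact: (bF i).2.
Qed.

Lemma Cint_sum (I : Type) (r : seq I) (F : I -> T -> R[i]) : (forall i, cbmeas (F i)) ->
  Cint P (fun t => \sum_(i <- r) F i t) = \sum_(i <- r) Cint P (F i).
Proof.
move=> bF; apply/eqP; rewrite eq_complex Re_sum Im_sum /Cint /=.
under eq_Rintegral do rewrite Re_sum.
under [X in _ && (X == _)]eq_Rintegral do rewrite Im_sum.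
by rewrite !Rint_sum ?eqxx// => i; [exact: (bF i).2|exact: (bF i).1].
Qed.

Lemma cbmeas_expi (f : T -> R) : measurable_fun setT f -> cbmeas (fun t => expi (f t)).
Proof. by move=> mf; split; [exact: bmeas_cos|exact: bmeas_sin]. Qed.

End Cint_linear.

Lemma expiD {R : realType} (x y : R) : expi (x + y) = expi x * expi y.
Proof. by rewrite /expi cosD sinD; simpc; congr (_ +i* _); rewrite addrC. Qed.

Lemma expi_sum {R : realType} (I : Type) (r : seq I) (f : I -> R) :
  expi (\sum_(i <- r) f i) = \prod_(i <- r) expi (f i).
Proof.
elim: r => [|i r IH]; last by rewrite !big_cons expiD IH.
by rewrite !big_nil /expi cos0 sin0.
Qed.

(** * Uniform symbols *)

Section uniform.
Context d (T : measurableType d) {R : realType} (P : probability T R) (X : {fset R[i]}).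

Definition uniform_weight (i : X) : R := (#|` X|%:R)^-1.

Lemma uniform_weight_ge0 i : 0 <= uniform_weight i.
Proof. by rewrite invr_ge0. Qed.

Lemma sum_uniform_weight : X != fset0 -> \sum_i uniform_weight i = 1.
Proof.
move=> X0; rewrite sumr_const -cardfE -(mulr_natl _^-1) mulfV// pnatr_eq0.
by rewrite cardfs_eq0.
Qed.

Lemma indic1_sum (z : R[i]) : \sum_(i : X) (\1_[set val i] z : R) = (z \in X)%:R.
Proof.
case: (boolP (z \in X)) => zX.
  rewrite (bigD1 [` zX]%fset)//= indicE mem_set//= big1 ?addr0// => i iz.
  rewrite indicE memNset// => /= zi; move/eqP: iz; apply.
  exact: val_inj.
rewrite big1// => i _; rewrite indicE memNset// => /= zi.
by move/negP: zX; apply; rewrite zi; exact: valP.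
Qed.

Variable S : {RV P >-> R[i]}.
Hypothesis uS : uniform_on P X S.

Let mS : measurable_fun setT S. Proof. exact: measurable_funPT. Qed.

Let bind (z : R[i]) : bmeas (fun t => \1_[set z] (S t) : R).
Proof.
split; first exact: (measurableT_comp (measurable_indic (measurable_set1_complex z)) mS).
by exists 1 => t; rewrite indicE; case: (_ \in _); rewrite ?normr1 ?normr0.
Qed.

Let Rint_ind (i : X) : \int[P]_t (\1_[set val i] (S t)) = uniform_weight i.
Proof.
have mA : measurable (S @^-1` [set val i]).
  by rewrite -[X in measurable X]setTI; exact: mS (measurable_set1_complex _).
transitivity (\int[P]_t (\1_(S @^-1` [set val i]) t)).
  by apply: eq_Rintegral => t _; rewrite !indicE.
rewrite /Rintegral integral_indic// setIT.
exact: (congr1 fine (uS.2 _ (valP i))).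
Qed.

Lemma Cint_uniform_indic (i : X) :
  Cint P (fun t => (\1_[set val i] (S t))%:C) = (uniform_weight i)%:C.
Proof. by rewrite /Cint /= Rint_ind Rint_cst. Qed.

(** [uniform_on] only prescribes the masses of the points of [X]; they add up to 1, so nothing is
    left outside. *)
Lemma uniform_ae : \forall t \ae P, S t \in X.
Proof.
pose A := [set t | S t \in X].
have mA : measurable A.
  rewrite (_ : A = \bigcup_(i in [set: X]) (S @^-1` [set val i])).
    apply: fin_bigcup_measurable => [|i _]; first exact: finite_finset.
    by rewrite -[X in measurable X]setTI; exact: mS (measurable_set1_complex _).
  apply/seteqP; split => t /= => [tX|[i _ ti]]; last exact: (eq_ind_r (fun z => z \in X) (valP i) ti).
  by exists [` tX]%fset.
exists (~` A); split; [exact: measurableC| |by []].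
rewrite probability_setC//.
have : \int[P]_t (\1_A t : R) = 1.
  rewrite -(sum_uniform_weight uS.1) -(eq_bigr _ (fun i _ => Rint_ind i)) -Rint_sum//.
  apply: eq_Rintegral => t _; rewrite indic1_sum indicE; congr (nat_of_bool _)%:R.
  by apply/idP/idP => [/set_mem//|tX]; rewrite mem_set.
rewrite /Rintegral integral_indic// setIT => h.
by rewrite -(fineK (fin_num_measure P A mA)) h subee.
Qed.

Lemma expectation_uniform (f : R[i] -> R) : measurable_fun setT f ->
  ('E_P[fun t => f (S t)])%E = (\sum_i uniform_weight i * f (val i))%:E.
Proof.
move=> mf; pose g t := \sum_(i : X) (\1_[set val i] (S t) : R) * f (val i).
have bterm (i : X) : bmeas (fun t => (\1_[set val i] (S t) : R) * f (val i)).
  by apply: bmeasM => //; exact: bmeas_cst.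
have bg : bmeas g by exact: bmeas_sum.
have -> : \sum_i uniform_weight i * f (val i) = \int[P]_t g t.
  by rewrite Rint_sum//; apply: eq_bigr => i _; rewrite RintZr// Rint_ind.
rewrite unlock -EFin_Rint//; apply: ae_eq_integral => //.
- by apply/measurable_EFinP; exact: (measurableT_comp mf mS).
- by apply/measurable_EFinP; exact: bg.1.
apply: filterS uniform_ae => t tX _ /=; congr EFin.
rewrite /g (eq_bigr (fun i : X => (\1_[set val i] (S t) : R) * f (S t))) => [|i _].
  by rewrite -mulr_suml indic1_sum tX mul1r.
rewrite indicE; case: (boolP (S t \in [set val i])) => [/set_mem /= ->//|_].
by rewrite !mul0r.
Qed.

End uniform.

Lemma gaussian_phase_chi d (T : measurableType d) {R : realType} (P : probability T R)
    (sigma : R) (U : {RV P >-> R}) a b :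
  0 < sigma -> is_gaussian P 0 sigma U ->
  Cint P (fun t => expi ((cos (U t) - expR (- (sigma ^+ 2 / 2))) * a - sin (U t) * b)) =
  phase_chi sigma a b.
Proof.
move=> s0 gU; have mU : measurable_fun setT U by exact: measurable_funPT.
have cU A : measurable A -> P (U @^-1` A) = normal_law 0 sigma ((id : R -> R) @^-1` A).
  by move=> mA; rewrite gU// /gaussian_law gt_eqF.
pose F (x : R) := (cos x - expR (- (sigma ^+ 2 / 2))) * a - sin x * b.
have mF : measurable_fun setT F.
  have mcos := continuous_measurable_fun (@continuous_cos R).
  have msin := continuous_measurable_fun (@continuous_sin R).
  apply: measurable_funB; apply: measurable_funM => //; exact: measurable_funB.
have E (f : R -> R) : bmeas f ->
    \int[P]_t f (U t) = \int[normal_law 0 sigma]_x f x.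
  move=> bf; apply: (@eq_law_Rint R _ _ _ _ R R P (normal_law 0 sigma) U id mU (@measurable_id _ _ setT) cU f bf.1).
  by apply: bmeas_integrable; exact: (bmeas_comp bf mU).
rewrite /phase_chi /Cint /=; congr (_ +i* _).
  exact: (E (fun x => cos (F x)) (bmeas_cos mF)).
exact: (E (fun x => sin (F x)) (bmeas_sin mF)).
Qed.

(** Exactly one [x] matches [z]. The expansion replaces conditioning on the symbols: in each term
    [F] has a deterministic argument. *)
Lemma indic_expansion {R : realType} (X : {fset R[i]}) (N : nat) (z : 'I_N -> R[i])
    (F : ('I_N -> R[i]) -> R[i]) : (forall m, z m \in X) ->
  F z = \sum_(x : {ffun 'I_N -> X})
    (\prod_m (\1_[set val (x m)] (z m) : R)%:C) * F (fun m => val (x m)).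
Proof.
move=> zX.
transitivity (\sum_(x : {ffun 'I_N -> X}) (\prod_m (\1_[set val (x m)] (z m) : R)%:C) * F z).
  rewrite -mulr_suml -(bigA_distr_bigA (fun m (i : X) => (\1_[set val i] (z m) : R)%:C)).
  rewrite big1 ?mul1r// => m _.
  by rewrite -rmorph_sum/= indic1_sum zX.
apply: eq_bigr => x _.
have [/forallP h|] := boolP [forall m, z m == val (x m)].
  by congr (_ * F _); apply/funext => m; apply/eqP.
rewrite negb_forall => /existsP[m zm]; rewrite (bigD1 m)//= indicE memNset ?mul0r//.
by move=> /= h; rewrite h eqxx in zm.
Qed.

(** * Characteristic function of an entry of the effective noise *)

Section decomposition.
Context d (T : measurableType d) {R : realType} (P : probability T R).
Variables (sigma N0 : R) (X : {fset R[i]}) (l : nat).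
Variables (s : 'I_(2 ^ l) -> {RV P >-> R[i]}) (theta : 'I_(2 ^ l) -> {RV P >-> R})
  (n : 'I_(2 ^ l) -> {RV P >-> R[i]}).
Notation alpha := (expR (- (sigma ^+ 2 / 2))).
Notation s2 := ((Num.sqrt 2)^-1 : R).
Notation H := (@hadamard R l).

Definition noise_entry k t : R[i] := effective_noise sigma
  (\col_m s m t) (\col_m theta m t) (\col_m n m t) k 0.

Definition sent_form (u v : R) (z : 'I_(2 ^ l) -> R[i]) j : R :=
  \sum_m H j m * (u * complex.Re (z m) + v * complex.Im (z m)).

Lemma noise_entry_form u v k t :
  u * complex.Re (noise_entry k t) + v * complex.Im (noise_entry k t) =
  \sum_j ((cos (theta j t) - alpha) * (H j k * sent_form u v (fun m => s m t) j) -
    sin (theta j t) * (H j k * sent_form (- v) u (fun m => s m t) j)) +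
  \sum_j linear_form (n j) (H j k * (s2 * (u + v))) (H j k * (s2 * (v - u))) t.
Proof.
rewrite effective_noise_form; congr (_ + _); apply: eq_bigr => j _; rewrite !mxE//.
congr (_ * (_ * _) - _ * (_ * _)); apply: eq_bigr => m _; rewrite !mxE//.
by congr (_ * _); ring.
Qed.

Let mRe (Z : {RV P >-> R[i]}) : measurable_fun setT (fun t => complex.Re (Z t)).
Proof. exact: (measurableT_comp measurable_Re (measurable_funPT Z)). Qed.

Let mIm (Z : {RV P >-> R[i]}) : measurable_fun setT (fun t => complex.Im (Z t)).
Proof. exact: (measurableT_comp measurable_Im (measurable_funPT Z)). Qed.

Let msum (F : 'I_(2 ^ l) -> T -> R) : (forall j, measurable_fun setT (F j)) ->
  measurable_fun setT (fun t => \sum_j F j t).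
Proof. by move=> mF; apply: measurable_sum. Qed.

Let mform u v j : measurable_fun setT (fun t => sent_form u v (fun m => s m t) j).
Proof.
apply: msum => m; apply: measurable_funM => //; exact: measurable_linear_form.
Qed.

Let mcos : measurable_fun setT (@cos R).
Proof. exact: continuous_measurable_fun (@continuous_cos R). Qed.

Let msin : measurable_fun setT (@sin R).
Proof. exact: continuous_measurable_fun (@continuous_sin R). Qed.

Let mphase j : measurable_fun setT (fun t => cos (theta j t) - alpha).
Proof. by apply: measurable_funB => //; exact: (measurableT_comp mcos (measurable_funPT _)). Qed.

Let msin_theta j : measurable_fun setT (fun t => sin (theta j t)).
Proof. exact: (measurableT_comp msin (measurable_funPT _)). Qed.

Lemma measurable_noise_form u v k : measurable_fun setT
  (fun t => u * complex.Re (noise_entry k t) + v * complex.Im (noise_entry k t)).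
Proof.
under eq_fun do rewrite noise_entry_form.
apply: measurable_funD; apply: msum => j; last by apply: measurable_linear_form.
by apply: measurable_funB; apply: measurable_funM => //; apply: measurable_funM.
Qed.

Lemma measurable_noise_entry k : measurable_fun setT (noise_entry k).
Proof.
apply: measurable_complexP.
  have := measurable_noise_form 1 0 k.
  by under eq_fun do rewrite mul1r mul0r addr0.
have := measurable_noise_form 0 1 k.
by under eq_fun do rewrite mul1r mul0r add0r.
Qed.

Hypotheses (sigma0 : 0 < sigma).
Hypotheses (s_unif : forall k, uniform_on P X (s k))
  (theta_gauss : forall k, is_gaussian P 0 sigma (theta k))
  (n_gauss : forall k, complex_gaussian P (n k))
  (n_circ : forall k, circularly_symmetric P (n k))
  (n_var : forall k, cvariance P (n k) = N0%:E).
Hypotheses (s_indep : independent_rvs P s) (theta_indep : independent_rvs P theta)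
  (n_indep : independent_rvs P n) (indep : independent_vectors3 P s theta n).

(** Once the symbols are frozen by the indicator expansion, the integrand is a product of functions
    of single variables, and joint independence factors its expectation. *)
Lemma noise_entry_charfun u v k :
  Cint P (fun t => expi (u * complex.Re (noise_entry k t) + v * complex.Im (noise_entry k t))) =
  (\sum_x (iid_weight (@uniform_weight R X) x)%:C *
    \prod_j phase_chi sigma
      (H j k * mix (fun i : X => u * complex.Re (val i) + v * complex.Im (val i)) x j)
      (H j k * mix (fun i : X => - v * complex.Re (val i) + u * complex.Im (val i)) x j)) *
  (expR (- ((u ^+ 2 + v ^+ 2) * (N0 / 4))))%:C.
Proof.
pose ph (z : 'I_(2 ^ l) -> R[i]) j (y : R) := expi ((cos y - alpha) * (H j k * sent_form u v z j) -
  sin y * (H j k * sent_form (- v) u z j)).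
pose nz j (w : R[i]) := expi (H j k * (s2 * (u + v)) * complex.Re w + H j k * (s2 * (v - u)) * complex.Im w).
pose F z t := (\prod_j ph z j (theta j t)) * \prod_j nz j (n j t).
have bph z j : cbmeas (ph z j).
  apply: cbmeas_expi; apply: measurable_funB; apply: measurable_funM => //.
  exact: measurable_funB.
have bnz j : cbmeas (nz j).
  by apply: cbmeas_expi; apply: measurable_linear_form; [exact: measurable_Re|exact: measurable_Im].
pose ind (x : {ffun 'I_(2 ^ l) -> X}) m (w : R[i]) : R[i] := (\1_[set val (x m)] w : R)%:C.
have bind x m : cbmeas (ind x m) by apply: cbmeas_indic; exact: measurable_set1_complex.
have cRV d' (T' : measurableType d') (V : {RV P >-> T'}) (f : T' -> R[i]) : cbmeas f -> cbmeas (fun t => f (V t)).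
  by move=> [fR fI]; split; [apply: (bmeas_comp fR)|apply: (bmeas_comp fI)]; exact: measurable_funPT.
pose G x t := (\prod_m ind x m (s m t)) * F (fun m => val (x m)) t.
have bG x : cbmeas (G x).
  apply: cbmeasM; first by apply: cbmeas_prod => m; exact: cRV.
  by apply: cbmeasM; apply: cbmeas_prod => m; exact: cRV.
transitivity (Cint P (fun t => \sum_x G x t)).
  (* The expansion only holds almost surely, since the symbols may leave [X] on a null set. *)
  apply: eq_Cint_ae; [|exact: cbmeas_sum|].
    by apply: cbmeas_expi; exact: measurable_noise_form.
  have : \forall t \ae P, forall m, s m t \in X.
    by apply: filter_forall => m; exact: uniform_ae.
  apply: filterS => t sX; rewrite -(indic_expansion (F ^~ t) sX).
  by rewrite noise_entry_form expiD !expi_sum.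
rewrite Cint_sum// mulr_suml; apply: eq_bigr => x _.
rewrite /G /F (Cint_three_indep s_indep theta_indep n_indep indep (bind x) (bph _) bnz).
rewrite -mulrA; congr (_ * _).
  by rewrite /iid_weight rmorph_prod; apply: eq_bigr => m _; exact: Cint_uniform_indic.
congr (_ * _).
  apply: eq_bigr => j _; rewrite /ph gaussian_phase_chi//.
rewrite (eq_bigr (fun j => (expR (- ((H j k) ^+ 2 * ((u ^+ 2 + v ^+ 2) * (N0 / 4)))))%:C)) => [|j _].
  rewrite -(rmorph_prod (real_complex R))/= -expR_sum sumrN -mulr_suml.
  have -> : \sum_j H j k ^+ 2 = 1.
    transitivity (\sum_j H j k * H j k); first by apply: eq_bigr => j _; rewrite expr2.
    by rewrite hadamard_dot eqxx.
  by rewrite mul1r.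
rewrite /nz -[LHS]/(Cint P (fun t => expi (linear_form (n j) (H j k * (s2 * (u + v))) (H j k * (s2 * (v - u))) t))).
rewrite (circular_noise_charfun (measurable_funPT (n j)) (n_gauss j) (n_circ j) (n_var j)).
congr (expR (- _))%:C.
have s2E : s2 * s2 = 2^-1 by rewrite -invfM -expr2 sqr_sqrtr.
(* The unimodular factor [rot8] preserves [u ^ 2 + v ^ 2]. *)
transitivity (H j k ^+ 2 * (s2 * s2) * ((u + v) ^+ 2 + (v - u) ^+ 2) * (N0 / 4)); first by ring.
by rewrite s2E; field.
Qed.

End decomposition.

(** * The Gaussian limit *)

Definition quad_form {R : realType} (A B C u v : R) : R :=
  A * u ^+ 2 + 2 * B * u * v + C * v ^+ 2.

Section planar_gaussian.
Context {R : realType} (A B C : R).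
Hypotheses (A0 : 0 < A) (det0 : B ^+ 2 <= A * C).

Definition std_normal2 : probability (R * R)%type R :=
  product_prob (normal_law 0 1) (normal_law 0 1).

(* Cholesky factor of the covariance matrix [[A, B], [B, C]]. *)
Definition gauss_pair (z : R * R) : R[i] :=
  (Num.sqrt A * z.1) +i* (B / Num.sqrt A * z.1 + Num.sqrt (C - B ^+ 2 / A) * z.2).

Notation Q := std_normal2.
Notation W := gauss_pair.
Notation quad := (quad_form A B C).

Lemma measurable_gauss_pair : measurable_fun setT W.
Proof.
apply: measurable_complexP => /=.
  by apply: measurable_funM => //; exact: measurable_fst.
by apply: measurable_linear_form; [exact: measurable_fst|exact: measurable_snd].
Qed.
Let mW := measurable_gauss_pair.

Let gauss_cos (a : R) : \int[normal_law 0 1]_x cos (a * x) = expR (- (a ^+ 2 / 2)).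
Proof.
rewrite Rint_normal_law; last by apply: bmeas_cos; exact: measurable_funM.
have := normal_cos 0 (@ltr01 R) a; rewrite expr1n mul1r => <-.
by apply: eq_Rintegral => x _; rewrite subr0.
Qed.

Let gauss_sin (a : R) : \int[normal_law 0 1]_x sin (a * x) = 0.
Proof.
rewrite Rint_normal_law; last by apply: bmeas_sin; exact: measurable_funM.
rewrite -[RHS](normal_sin 0 (@ltr01 R) a).
by apply: eq_Rintegral => x _; rewrite subr0.
Qed.

Let bc (a : R) : bmeas (fun x : R => cos (a * x)).
Proof. by apply: bmeas_cos; exact: measurable_funM. Qed.

Let bs (a : R) : bmeas (fun x : R => sin (a * x)).
Proof. by apply: bmeas_sin; exact: measurable_funM. Qed.

Let formE (u v : R) z : u * complex.Re (W z) + v * complex.Im (W z) =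
  (u * Num.sqrt A + v * (B / Num.sqrt A)) * z.1 + v * Num.sqrt (C - B ^+ 2 / A) * z.2.
Proof. by rewrite /W /=; ring. Qed.

Let quadE (u v : R) : (u * Num.sqrt A + v * (B / Num.sqrt A)) ^+ 2 +
  (v * Num.sqrt (C - B ^+ 2 / A)) ^+ 2 = quad u v.
Proof.
rewrite /quad_form; have C0 : 0 <= C - B ^+ 2 / A by rewrite subr_ge0 ler_pdivrMr// mulrC.
rewrite [(v * _) ^+ 2]exprMn sqr_sqrtr//.
have := sqr_sqrtr (ltW A0); have : Num.sqrt A != 0 by rewrite sqrtr_eq0 -ltNge.
move: (Num.sqrt A) => p p0 <-; field.
by rewrite p0.
Qed.

Let bfst (f : R -> R) : bmeas f -> bmeas (fun z : R * R => f z.1).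
Proof. by move=> bf; apply: (bmeas_comp bf); exact: measurable_fst. Qed.

Let bsnd (f : R -> R) : bmeas f -> bmeas (fun z : R * R => f z.2).
Proof. by move=> bf; apply: (bmeas_comp bf); exact: measurable_snd. Qed.

Lemma re_charfun_gauss_pair u v : re_charfun Q W u v = expR (- (quad u v / 2)).
Proof.
rewrite /re_charfun -quadE; under eq_Rintegral do rewrite formE cosD.
rewrite RintB; [|by apply: bmeasM; [exact: (bfst (bc _))|exact: (bsnd (bc _))]
  |by apply: bmeasM; [exact: (bfst (bs _))|exact: (bsnd (bs _))]].
rewrite (Rint_product_probM _ _ (bc _) (bc _)) (Rint_product_probM _ _ (bs _) (bs _)).
by rewrite !gauss_cos !gauss_sin mulr0 subr0 -expRD mulrDl opprD.
Qed.

Lemma im_charfun_gauss_pair u v : im_charfun Q W u v = 0.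
Proof.
rewrite /im_charfun; under eq_Rintegral do rewrite formE sinD.
rewrite RintD; [|by apply: bmeasM; [exact: (bfst (bs _))|exact: (bsnd (bc _))]
  |by apply: bmeasM; [exact: (bfst (bc _))|exact: (bsnd (bs _))]].
rewrite (Rint_product_probM _ _ (bs _) (bc _)) (Rint_product_probM _ _ (bc _) (bs _)).
by rewrite !gauss_sin mul0r mulr0 addr0.
Qed.

Let quad_ge0 u v : 0 <= quad u v.
Proof. by rewrite -quadE addr_ge0// sqr_ge0. Qed.

(** One-dimensional uniqueness is taken from the plane by viewing a real variable as a complex one
    with zero imaginary part. The comparison [key] is applied to the constant 0 or to a normal law,
    according to whether the form degenerates. *)
Lemma gauss_pair_is_gaussian a b :
  is_gaussian Q 0 (Num.sqrt (quad a b)) (linear_form W a b).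
Proof.
move=> S mS; set U := linear_form W a b.
have mU : measurable_fun setT U := measurable_linear_formZ mW a b.
pose Z t : R[i] := U t +i* 0.
have mZ : measurable_fun setT Z by apply: measurable_complexP.
pose S' := @complex.Re R @^-1` S.
have mS' : measurable S' by rewrite -[S']setTI; exact: (@measurable_Re R).
have reZ u v : re_charfun Q Z u v = expR (- (u ^+ 2 * quad a b / 2)).
  transitivity (re_charfun Q W (u * a) (u * b)).
    by apply: eq_Rintegral => t _; congr cos; rewrite /Z /U /linear_form /=; ring.
  by rewrite re_charfun_gauss_pair /quad_form; congr expR; ring.
have imZ u v : im_charfun Q Z u v = 0.
  rewrite -[RHS](im_charfun_gauss_pair (u * a) (u * b)).
  by apply: eq_Rintegral => t _; congr sin; rewrite /Z /U /linear_form /=; ring.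
have key d (T : measurableType d) (P : probability T R) (V : T -> R) : measurable_fun setT V ->
    (forall u, \int[P]_t cos (u * V t) = expR (- (u ^+ 2 * quad a b / 2))) ->
    (forall u, \int[P]_t sin (u * V t) = 0) -> Q (U @^-1` S) = P (V @^-1` S).
  move=> mV cV sV; pose Y t : R[i] := V t +i* 0.
  have mY : measurable_fun setT Y by apply: measurable_complexP.
  apply: (charfun_inj mZ mY _ _ mS') => u v.
    by rewrite reZ -cV; apply: eq_Rintegral => t _; rewrite /= mulr0 addr0.
  by rewrite imZ -(sV u); apply: eq_Rintegral => t _; rewrite /= mulr0 addr0.
rewrite /gaussian_law sqrtr_eq0; case: ifPn => q0.
  have quad0 : quad a b = 0 by apply/eqP; rewrite eq_le q0 quad_ge0.
  rewrite (key _ _ Q (cst 0)).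
  - by rewrite preimage_cst diracE; case: ifPn => _; rewrite ?probability_setT ?measure0.
  - exact: measurable_cst.
  - by move=> u; rewrite /cst mulr0 cos0 Rint_cst quad0 mulr0 mul0r oppr0 expR0.
  - by move=> u; rewrite /cst mulr0 sin0 Rint_cst.
rewrite -ltNge in q0; have sd0 : 0 < Num.sqrt (quad a b) by rewrite sqrtr_gt0.
have cV (u : R) : \int[normal_law 0 (Num.sqrt (quad a b))]_x cos (u * x) =
    expR (- (u ^+ 2 * quad a b / 2)).
  rewrite Rint_normal_law; last by apply: bmeas_cos; exact: measurable_funM.
  rewrite -[quad a b in RHS](sqr_sqrtr (ltW q0)) [u ^+ 2 * _]mulrC -(normal_cos 0 sd0 u).
  by apply: eq_Rintegral => x _; rewrite subr0.
have sV (u : R) : \int[normal_law 0 (Num.sqrt (quad a b))]_x sin (u * x) = 0.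
  rewrite Rint_normal_law; last by apply: bmeas_sin; exact: measurable_funM.
  rewrite -[RHS](normal_sin 0 sd0 u).
  by apply: eq_Rintegral => x _; rewrite subr0.
exact: (key _ R (normal_law 0 (Num.sqrt (quad a b))) (fun x : R => x)
  (@measurable_id _ _ setT) cV sV).
Qed.

Lemma gauss_pair_complex_gaussian : complex_gaussian Q W.
Proof.
by move=> a b; exists 0, (Num.sqrt (quad a b)); split; [exact: sqrtr_ge0|exact: gauss_pair_is_gaussian].
Qed.

Lemma gauss_pair_cvariance : cvariance Q W = (A + C)%:E.
Proof.
have mom a b := gaussian_moments (measurable_linear_formZ mW a b) (sqrtr_ge0 (quad a b))
  (@gauss_pair_is_gaussian a b).
rewrite cvariance_centered; last 3 first.
- by move=> a b; have [] := mom a b.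
- by have [] := mom 1 0.
- by have [] := mom 0 1.
have [_ _ _ ->] := mom 1 0; have [_ _ _ ->] := mom 0 1.
rewrite !sqr_sqrtr ?quad_ge0//; rewrite /quad_form; congr EFin; ring.
Qed.

Lemma gauss_pair_circular : B = 0 -> A = C -> circularly_symmetric Q W.
Proof.
move=> B0 AC phi S mS.
pose Z t := expi phi * W t.
have reZ t : complex.Re (Z t) = cos phi * complex.Re (W t) - sin phi * complex.Im (W t).
  by rewrite /Z; case: (W t) => x y; rewrite /expi; simpc.
have imZ t : complex.Im (Z t) = sin phi * complex.Re (W t) + cos phi * complex.Im (W t).
  by rewrite /Z; case: (W t) => x y; rewrite /expi; simpc; rewrite /= addrC.
have mZ : measurable_fun setT Z.
  have mR := measurableT_comp (@measurable_Re R) mW.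
  have mI := measurableT_comp (@measurable_Im R) mW.
  apply: measurable_complexP.
    under eq_fun do rewrite reZ.
    by apply: measurable_funB; apply: measurable_funM.
  under eq_fun do rewrite imZ.
  exact: measurable_linear_form.
pose u' (u v : R) := u * cos phi + v * sin phi; pose v' (u v : R) := v * cos phi - u * sin phi.
apply: (charfun_inj mZ mW _ _ mS) => u v.
  transitivity (re_charfun Q W (u' u v) (v' u v)).
    by apply: eq_Rintegral => t _; rewrite reZ imZ /u' /v'; congr cos; ring.
  rewrite !re_charfun_gauss_pair /quad_form B0 -AC; congr expR; congr (- (_ / _)).
  transitivity (A * ((cos phi ^+ 2 + sin phi ^+ 2) * (u ^+ 2 + v ^+ 2))); first by rewrite /u' /v'; ring.
  by rewrite cos2Dsin2; ring.
rewrite im_charfun_gauss_pair -(im_charfun_gauss_pair (u' u v) (v' u v)).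
by apply: eq_Rintegral => t _; rewrite reZ imZ /u' /v'; congr sin; ring.
Qed.

End planar_gaussian.

Lemma cvg_geometric_rate {R : realType} (f : nat -> R) (L K q : R) : 0 <= q < 1 ->
  (\forall l \near \oo, `|f l - L| <= K * q ^+ l) -> f l @[l --> \oo] --> L.
Proof.
move=> /andP[q0 q1] fL; apply/cvgrPdist_le => /=.
have Kq : K * q ^+ l @[l --> \oo] --> (0 : R).
  rewrite -[X in _ --> X](mulr0 K); apply: cvgMr.
  by apply: cvg_expr; rewrite ger0_norm.
move=> e e0; have Ke := @cvgr_le _ _ _ _ _ _ Kq e e0.
near=> l; rewrite distrC; apply: (@le_trans _ _ (K * q ^+ l)); near: l; first exact: fL.
exact: Ke.
Unshelve. all: by end_near.
Qed.

(** * Second moments of the constellation and limit covariance *)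

Section uniform_moments.
Context {R : realType} (X : {fset R[i]}).
Notation p := (@uniform_weight R X).

Definition re_sqr : R := \sum_i p i * complex.Re (val i) ^+ 2.
Definition im_sqr : R := \sum_i p i * complex.Im (val i) ^+ 2.
Definition re_im : R := \sum_i p i * (complex.Re (val i) * complex.Im (val i)).

Lemma qam_moments : square_qam X -> re_sqr = im_sqr /\ re_im = 0.
Proof.
move=> [a [k [a0 k1 XE]]].
(* Multiplication by i permutes the constellation. *)
pose rot (z : R[i]) : R[i] := - complex.Im z +i* complex.Re z.
have rotX z : z \in X -> rot z \in X.
  move=> /XE[p' [q' [/andP[p1 p2] /andP[q1 q2] ->]]]; apply/XE.
  (* Replacing [q] by [m + 1 - q] changes the sign of [2 q - 1 - m], where [m = 2 ^ k]. *)
  exists (2 ^ k + 1 - q')%N, p'; split.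
  - by rewrite subn_gt0 addn1 ltnS q2/= leq_subLR -[X in (X < _)%N]add0n ltn_add2r.
  - exact/andP.
  - rewrite /rot /= natrB ?natrD; last by rewrite addn1 ltnW.
    by congr (_ +i* _); ring.
pose h (i : X) : X := [` rotX (val i) (valP i)]%fset.
have hI : injective h.
  move=> i j /(congr1 val) /=; case: i => -[x y] ?; case: j => -[x' y'] ? /= [/oppr_inj yy xx].
  by apply: val_inj; rewrite /= yy xx.
split.
  by rewrite /re_sqr (reindex_inj hI)/=; apply: eq_bigr => i _; rewrite /p sqrrN.
have : re_im = - re_im.
  rewrite {1}/re_im (reindex_inj hI)/= -sumrN; apply: eq_bigr => i _.
  by rewrite /p; ring.
by move: re_im => x; lra.
Qed.

Variables (vc vs N0 : R).

(** With [limit_im] and [limit_cov], the covariance matrix of the sum of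
    [(cos t - alpha + i sin t) s] and the channel noise, for independent terms, a centred symbol [s]
    and a phase [t]. *)
Definition limit_re := vc * re_sqr + vs * im_sqr + N0 / 2.
Definition limit_im := vc * im_sqr + vs * re_sqr + N0 / 2.
Definition limit_cov := (vc - vs) * re_im.

Lemma limit_quad_form u v :
  \sum_i p i * ((vc * (u * complex.Re (val i) + v * complex.Im (val i)) ^+ 2 +
    vs * (- v * complex.Re (val i) + u * complex.Im (val i)) ^+ 2) / 2) +
  (u ^+ 2 + v ^+ 2) * (N0 / 4) = quad_form limit_re limit_cov limit_im u v / 2.
Proof.
transitivity ((vc * u ^+ 2 + vs * v ^+ 2) / 2 * re_sqr +
  (vc * v ^+ 2 + vs * u ^+ 2) / 2 * im_sqr + (vc - vs) * u * v * re_im +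
  (u ^+ 2 + v ^+ 2) * (N0 / 4)); last by rewrite /quad_form /limit_re /limit_im /limit_cov; field.
congr (_ + _); rewrite /re_sqr /im_sqr /re_im !mulr_sumr -!big_split/=.
by apply: eq_bigr => i _; field.
Qed.

Hypotheses (vc0 : 0 <= vc) (vs0 : 0 <= vs) (N00 : 0 < N0).

Lemma limit_re_gt0 : 0 < limit_re.
Proof.
rewrite /limit_re ltr_wpDl ?divr_gt0// addr_ge0// mulr_ge0// sumr_ge0// => i _;
  by rewrite mulr_ge0 ?uniform_weight_ge0// sqr_ge0.
Qed.

(** The quadratic form is nonnegative, and at [(- limit_cov, limit_re)] it equals [limit_re] times
    the determinant. *)
Lemma limit_det_ge0 : limit_cov ^+ 2 <= limit_re * limit_im.
Proof.
have A0 := limit_re_gt0.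
have : 0 <= quad_form limit_re limit_cov limit_im (- limit_cov) limit_re / 2.
  rewrite -limit_quad_form addr_ge0//; last first.
    by rewrite mulr_ge0 ?divr_ge0 ?(ltW N00)// addr_ge0// sqr_ge0.
  rewrite sumr_ge0// => i _; rewrite mulr_ge0 ?uniform_weight_ge0// divr_ge0// addr_ge0//.
    by rewrite mulr_ge0// sqr_ge0.
  by rewrite mulr_ge0// sqr_ge0.
have -> : quad_form limit_re limit_cov limit_im (- limit_cov) limit_re / 2 =
    limit_re * ((limit_re * limit_im - limit_cov ^+ 2) / 2).
  by rewrite /quad_form; field.
rewrite pmulr_rge0//; lra.
Qed.

End uniform_moments.

Lemma expR_neg_norm_le {R : realType} (z : R[i]) (t e : R) : 0 <= t -> `|z| <= e%:C ->
  `|z * (expR (- t))%:C| <= e%:C.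
Proof.
move=> t0 ze; rewrite normrM -[leRHS]mulr1; apply: ler_pM => //.
rewrite normc_def /= expr0n addr0 sqrtr_sqr lecR ger0_norm ?expR_ge0//.
exact: expR_neg_le1.
Qed.

(** * Convergence of the effective noise and properties of the limit *)

Unset Implicit Arguments.

Theorem proposition1 (R : realType) (sigmap N0 Es : R) (X : {fset R[i]})
  (d : nat -> measure_display) (T : forall l, measurableType (d l))
  (P : forall l, probability (T l) R)
  (s : forall l, 'I_(2 ^ l) -> {RV (P l) >-> R[i]})
  (theta : forall l, 'I_(2 ^ l) -> {RV (P l) >-> R})
  (n : forall l, 'I_(2 ^ l) -> {RV (P l) >-> R[i]})
  (hsigmap : 0 < sigmap) (hN0 : 0 < N0) (hEs : 0 < Es)
  (s_unif : forall l k, uniform_on (P l) X (s l k))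
  (s_energy : forall l k,
    'E_(P l)[fun t => (Normc.normc (s l k t) ^+ 2)%R]%E = Es%:E)
  (s_mean : forall l k, cexpectation (P l) (s l k) = 0)
  (s_indep : forall l, independent_rvs (P l) (s l))
  (theta_gauss : forall l k, is_gaussian (P l) 0 sigmap (theta l k))
  (theta_indep : forall l, independent_rvs (P l) (theta l))
  (n_gauss : forall l k, complex_gaussian (P l) (n l k))
  (n_circ : forall l k, circularly_symmetric (P l) (n l k))
  (n_var : forall l k, cvariance (P l) (n l k) = N0%:E)
  (n_indep : forall l, independent_rvs (P l) (n l))
  (indep : forall l, independent_vectors3 (P l) (s l) (theta l) (n l)) :
  forall i : nat,
    exists (d' : measure_display) (T' : measurableType d')
           (Q : probability T' R) (W : {RV Q >-> R[i]}),
      [/\ cvg_in_distribution P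
            (fun l t => entry (effective_noise sigmap
               (\col_k s l k t) (\col_k theta l k t) (\col_k n l k t)) i)
            Q W,
          complex_gaussian Q W,
          cvariance Q W = (N0 + Es * (1 - expR (- sigmap ^+ 2)))%:E &
          square_qam X -> circularly_symmetric Q W].
Proof.
move=> i.
pose vc := cos_var sigmap; pose vs := sin_var sigmap.
have vc0 : 0 <= vc := cos_var_ge0 sigmap.
have vs0 : 0 <= vs := sin_var_ge0 sigmap.
pose A := limit_re X vc vs N0; pose B := limit_cov X vc vs; pose C := limit_im X vc vs N0.
have A0 : 0 < A := limit_re_gt0 X vc0 vs0 hN0.
have det0 : B ^+ 2 <= A * C := limit_det_ge0 X vc0 vs0 hN0.
have mW := @measurable_gauss_pair R A B C.
(* Moments of the constellation are read off the single symbol sent for [l = 0]. *)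
have k0 : 'I_(2 ^ 0) := ord0.
have s_fset0 := (s_unif 0%N k0).1.
have p1 := sum_uniform_weight s_fset0.
have Re0 : \sum_(j : X) uniform_weight j * complex.Re (val j) = 0.
  have := congr1 (@complex.Re R) (s_mean 0%N k0).
  by rewrite /cexpectation (expectation_uniform (s_unif 0%N k0) (@measurable_Re R)).
have Im0 : \sum_(j : X) uniform_weight j * complex.Im (val j) = 0.
  have := congr1 (@complex.Im R) (s_mean 0%N k0).
  by rewrite /cexpectation /= (expectation_uniform (s_unif 0%N k0) (@measurable_Im R)).
have energy : re_sqr X + im_sqr X = Es.
  have mN : measurable_fun setT (fun z : R[i] => complex.Re z ^+ 2 + complex.Im z ^+ 2).
    by apply: measurable_funD; apply: measurable_funX; [exact: measurable_Re|exact: measurable_Im].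
  have := s_energy 0%N k0; under eq_fun do rewrite sqr_normcE.
  rewrite (expectation_uniform (s_unif 0%N k0) mN) => -[<-].
  by rewrite /re_sqr /im_sqr -big_split/=; apply: eq_bigr => j _; rewrite mulrDr.
have lin0 (u v : R) : \sum_(j : X) uniform_weight j * (u * complex.Re (val j) + v * complex.Im (val j)) = 0.
  transitivity (u * (\sum_(j : X) uniform_weight j * complex.Re (val j)) +
    v * (\sum_(j : X) uniform_weight j * complex.Im (val j))).
    by rewrite !mulr_sumr -big_split/=; apply: eq_bigr => j _; ring.
  by rewrite Re0 Im0 !mulr0 addr0.
have rate (u v : R) : exists K, \forall l \near \oo,
    `|re_charfun (P l) (fun t => entry (effective_noise sigmap
        (\col_k s l k t) (\col_k theta l k t) (\col_k n l k t)) i) u v -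
      expR (- (quad_form A B C u v / 2))| <= K * (Num.sqrt 2)^-1 ^+ l /\
    `|im_charfun (P l) (fun t => entry (effective_noise sigmap
        (\col_k s l k t) (\col_k theta l k t) (\col_k n l k t)) i) u v - 0| <= K * (Num.sqrt 2)^-1 ^+ l.
  pose g1 (j : X) := u * complex.Re (val j) + v * complex.Im (val j).
  pose g2 (j : X) := - v * complex.Re (val j) + u * complex.Im (val j).
  (* A crude common bound of both forms on the finite constellation; the 1 keeps it positive. *)
  pose c := 1 + \sum_j (`|g1 j| + `|g2 j|).
  have c0 : 0 < c by rewrite ltr_wpDr// sumr_ge0// => j _; rewrite addr_ge0.
  have gc j : `|g1 j| + `|g2 j| <= c.
    apply: (@le_trans _ _ (\sum_j (`|g1 j| + `|g2 j|))); last by rewrite /c lerDr.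
    by rewrite [leRHS](bigD1 j)//= lerDl sumr_ge0// => k _; rewrite addr_ge0.
  have g1c j : `|g1 j| <= c by apply: le_trans (gc j); rewrite lerDl.
  have g2c j : `|g2 j| <= c by apply: le_trans (gc j); rewrite lerDr.
  have est := @rotated_sum_estimate R X _ g1 g2 _ vc vs 128 c (@uniform_weight_ge0 R X) p1 c0
    g1c g2c (lin0 u v) (lin0 (- v) u) vc0 vs0 (ler0n _ _) (phase_chi_le1 sigmap)
    (phase_chi_expansion hsigmap).
  (* The constant comes from [est] and is free of [l] and of the row. The bound is only claimed for
     large [l], since entry [i] exists as soon as [i <= l < 2 ^ l]. *)
  eexists; near=> l.
  have il : (i < 2 ^ l)%N.
    have : (i <= l)%N by near: l; exact: nbhs_infty_ge.
    by move=> h; apply: leq_ltn_trans h _; exact: ltn_expl.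
  have entryE t : entry (effective_noise sigmap (\col_k s l k t) (\col_k theta l k t) (\col_k n l k t)) i =
      noise_entry sigmap (s l) (theta l) (n l) (Ordinal il) t.
    by rewrite /entry insubT.
  have t0 : 0 <= (u ^+ 2 + v ^+ 2) * (N0 / 4).
    by rewrite mulr_ge0 ?divr_ge0 ?(ltW hN0)// addr_ge0// sqr_ge0.
  have := expR_neg_norm_le t0 (est l (Ordinal il)).
  rewrite mulrBl -(noise_entry_charfun hsigmap (s_unif l) (theta_gauss l) (n_gauss l)
    (n_circ l) (n_var l) (s_indep l) (theta_indep l) (n_indep l) (indep l) u v (Ordinal il)).
  rewrite -rmorphM/= -expRD -opprD limit_quad_form lec_normE => h.
  split.
    apply: le_trans h; apply: le_trans (Re_le_normc _).
    rewrite le_eqVlt; apply/orP; left; apply/eqP; congr (`|_ - _|).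
    by apply: eq_Rintegral => t _; rewrite entryE.
  apply: le_trans h; apply: le_trans (Im_le_normc _).
  rewrite le_eqVlt; apply/orP; left; apply/eqP; congr (`|_ - _|).
  by apply: eq_Rintegral => t _; rewrite entryE.
have q01 : 0 <= ((Num.sqrt 2)^-1 : R) < 1.
  rewrite invr_ge0 sqrtr_ge0/= invf_lt1 ?sqrtr_gt0//.
  by rewrite -[ltLHS]sqrtr1 ltr_sqrt// ltr1n.
pose W : {RV (@std_normal2 R) >-> R[i]} :=
  HB.pack (gauss_pair A B C) (isMeasurableFun.Build _ _ _ _ _ mW).
exists _, _, (@std_normal2 R), W.
split.
- apply: cvg_in_distribution_charfun => //.
  (* For the finitely many [l] with [2 ^ l <= i] the entry is the constant 0. *)
  + move=> l; rewrite /entry; case: insubP => [k _ _|_]; last exact: measurable_cst.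
    exact: measurable_noise_entry.
  + move=> u v; rewrite re_charfun_gauss_pair//; have [K hK] := rate u v.
    by apply: (cvg_geometric_rate q01 (K := K)); apply: filterS hK => l [].
  + move=> u v; rewrite im_charfun_gauss_pair//; have [K hK] := rate u v.
    by apply: (cvg_geometric_rate q01 (K := K)); apply: filterS hK => l [].
- exact: gauss_pair_complex_gaussian.
- rewrite gauss_pair_cvariance//; congr EFin.
  (* The trace [A + C] equals [(vc + vs) (re_sqr X + im_sqr X) + N0]. *)
  by rewrite -(phase_varD hsigmap) -energy /A /C /limit_re /limit_im /vc /vs; field.
- move=> /qam_moments[sqE covE]; apply: gauss_pair_circular => //.
    by rewrite /B /limit_cov covE mulr0.
  by rewrite /A /C /limit_re /limit_im sqE.
Unshelve. all: by end_near.
Qed.
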